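(* Let $R=\mathbb Z$ or $\mathbb F_p$ ($p$ a prime). Let $\mathsf T=(\mathsf T_R(X),d)$ be a colimit of Hirsch extensions, let $G=G_{\mathsf T}$ be the corresponding pronilpotent group, and assume the map $\psi_{\mathsf T}\colon\mathsf T_R(X)\to C^*(BG;R)$ is a quasi-isomorphism. Let also $0\to F\to\overline G\to G\to1$ be a central extension of groups, with $F$ a finitely generated, free $R$-module, and let $\pi\colon B\overline G\to BG$ be the corresponding fibration. Then: (1) There is a Hirsch extension $i\colon\mathsf T\hookrightarrow\overline{\mathsf T}=(\mathsf T_R(X\cup Y),\bar d)$ such that $\overline G=G_{\overline{\mathsf T}}$. (2) The following square commutes: $\psi_{\overline{\mathsf T}}\circ i=\pi^*\circ\psi_{\mathsf T}\colon\mathsf T\to C^*(B\overline G;R)$. (3) The map $\psi_{\overline{\mathsf T}}\colon\overline{\mathsf T}\to C^*(B\overline G;R)$ is a quasi-isomorphism.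
   Context: Free binomial algebra. $\mathrm{Int}(\mathbb{Z}^X)=\{q\in\mathbb{Q}[X] : q(\mathbb{Z}^X)\subseteq\mathbb{Z}\}$, and $\mathrm{Int}(\mathbb{F}_p^X)$ is the quotient of $\mathrm{Int}(\mathbb{Z}^X)$ by the ideal generated by $\binom{x}{n}$ ($x\in X$, $n\ge p$), tensored with $\mathbb{F}_p$. $\mathfrak{m}_{X,R}\subset \mathrm{Int}(R^X)$ is the submodule of polynomials with zero constant term; $\mathsf{T}_R(X)=T^*(\mathfrak{m}_{X,R})$ is the tensor algebra over $R$, with $\cup=\otimes$, $a\cup_1 b=ab$ on $\mathsf T^1=\mathfrak m_{X,R}$, $(a\otimes b)\cup_1 c=ac\otimes b+a\otimes bc$, $(a_1\otimes a_2)\circ(b_1\otimes b_2)=a_1b_1\otimes a_2b_2$. A free binomial $\cup_1$-dga $(\mathsf T_R(X),d)$ is $\mathsf T_R(X)$ with a degree-one $R$-linear map $d$ satisfying $d^2=0$, the graded Leibniz rule, and $d(a\cup_1 b)=-a\cup b-b\cup a+da\cup_1 b+db\cup_1 a-da\circ db$ for all $a,b\in\mathsf T^1$. Colimits of Hirsch extensions. An inclusion $(\mathsf T_R(X),d)\to(\mathsf T_R(X\cup Y),\bar d)$ of free binomial $\cup_1$-dgas is a Hirsch extension if $\bar d(y)$ is a cocycle in $\mathsf T_R^2(X)$ for all $y\in Y$. $(\mathsf T_R(X),d)$ is a colimit of Hirsch extensions if $X=\bigcup_{i\ge1}X_i$ with each $X_i$ finite, $d$ restricts to a differential $d_n$ on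 $\mathsf T_R(X^n)$, $X^n=\bigcup_{i\le n}X_i$, each inclusion $(\mathsf T_R(X^n),d_n)\to(\mathsf T_R(X^{n+1}),d_{n+1})$ is a Hirsch extension, $X_1\ne\emptyset$, and $d_1=0$ on $X_1$. The group $G_{\mathsf T}$ and map $\psi_{\mathsf T}$. For $x\in X$ write $d(x)=\sum_ip_{x,i}\otimes q_{x,i}$ with $p_{x,i},q_{x,i}\in\mathfrak m_{X,R}$. $G_{\mathsf T}$ is the set $M(X,R)$ of all functions $\mathbf a\colon X\to R$, with product $(\mathbf a\mathbf a')(x)=\mathbf a(x)+\mathbf a'(x)-\sum_ip_{x,i}(\mathbf a)q_{x,i}(\mathbf a')$; it is a pronilpotent group. For a group $G$, $B(G)=BG$ is the bar construction $\Delta$-complex, with one $k$-simplex $[g_1|\cdots|g_k]$ for each $k$-tuple, and $C^*(BG;R)$ its simplicial cochain dga. $\psi_{\mathsf T}(q_1\otimes\cdots\otimes q_k)([\mathbf a_1|\cdots|\mathbf a_k])=q_1(\mathbf a_1)\cdots q_k(\mathbf a_k)$ for $q_i\in\mathfrak m_{X,R}$. The equality $\overline G=G_{\overline{\mathsf T}}$ is an identification (isomorphism) of central extensions of $G$, where $G_{\overline{\mathsf T}}\to G_{\mathsf T}$ is restriction of functions from $X\cup Y$ to $X$; it is used in (2) and (3). *)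

(* Defs.v *)
(* Conventions.  The coefficient ring R is Z or F_p, encoded by [base].  A set
   of variables is a choiceType (no restriction, classically), and a function
   X -> R is a point of R^X.  Tensor powers and cochains are graded by nat, one
   module for each degree. *)

From HB Require Import structures.
From mathcomp Require Import all_boot all_order all_algebra all_field.
From mathcomp Require Import finmap boolp functions.
From mathcomp.multinomials Require Import monalg.

Set Implicit Arguments.
Unset Strict Implicit.
Unset Printing Implicit Defensive.

Import GRing.Theory Num.Theory.
Local Open Scope quotient_scope.
Local Open Scope ring_scope.

Section PolySubst.
Context (X : choiceType) (S : comNzRingType).

Definition cmeval (a : X -> S) (m : {cmonom X}) : S :=
  \prod_(x <- finsupp m) a x ^+ m x.

Lemma cmevalEw (a : X -> S) (m : {cmonom X}) (D : {fset X}) :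
  (finsupp m `<=` D)%fset -> cmeval a m = \prod_(x <- D) a x ^+ m x.
Proof.
move=> le; apply: (big_fset_incl _ le) => x _ /fsfun_dflt ->; exact: expr0.
Qed.

Lemma cmeval_is_mmorphism a : mmorphism (cmeval a).
Proof.
split; last by rewrite /cmeval mdom1 big_seq_fset0.
move=> m1 m2; have le : (finsupp (mmul m1 m2) `<=` finsupp m1 `|` finsupp m2)%fset.
  by rewrite mdomD.
rewrite (cmevalEw _ le) (cmevalEw a (fsubsetUl (finsupp m1) (finsupp m2))).
rewrite (cmevalEw a (fsubsetUr (finsupp m1) (finsupp m2))) -big_split /=.
by apply: eq_bigr => x _; rewrite cmM exprD.
Qed.

HB.instance Definition _ a :=
  isMultiplicative.Build {cmonom X} S (cmeval a) (cmeval_is_mmorphism a).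

Context (R : comNzRingType) (f : {rmorphism R -> S}).

Definition psubst (a : X -> S) : {malg R[{cmonom X}]} -> S := mmap f (cmeval a).

HB.instance Definition _ a := GRing.RMorphism.on (psubst a).
End PolySubst.

Definition pvar (R : comNzRingType) (X : choiceType) (x : X) :
  {malg R[{cmonom X}]} := << ucm x >>.

Section PolySubstTheory.
Context (X : choiceType) (S R : comNzRingType) (f : {rmorphism R -> S}).

Lemma psubst_var (a : X -> S) x : psubst f a (pvar R x) = a x.
Proof.
have -> : psubst f a (pvar R x) = f 1 * cmeval a (ucm x) by exact: mmapU.
by rewrite rmorph1 mul1r /cmeval mdomU big_seq_fset1 cmUU expr1.
Qed.

Lemma psubst_C (a : X -> S) c : psubst f a (malgC c) = f c.
Proof. exact: mmapC. Qed.

End PolySubstTheory.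

Lemma psubst_comp (X Y : choiceType) (R S : comNzRingType)
    (f : {rmorphism R -> S}) (b : Y -> S) (a : X -> {malg R[{cmonom Y}]}) q :
  psubst f b (psubst (@malgC {cmonom Y} R) a q)
  = psubst f (fun x => psubst f b (a x)) q.
Proof.
have -> : psubst (@malgC {cmonom Y} R) a q =
    \sum_(m <- msupp q) malgC q@_m * cmeval a m by exact: mmapE.
rewrite (raddf_sum (psubst f b)) [RHS]mmapE; apply: eq_bigr => m _.
rewrite [LHS](rmorphM (psubst f b)) /= psubst_C; congr (_ * _).
rewrite /cmeval [LHS](rmorph_prod (psubst f b)).
by apply: eq_bigr => x _; exact: (rmorphXn (psubst f b)).
Qed.

Section IntZ.
Variable X : choiceType.
Local Notation QX := {malg rat[{cmonom X}]}.

Definition peval (a : X -> int) : QX -> rat := psubst idfun (fun x => (a x)%:~R).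
HB.instance Definition _ a := GRing.RMorphism.on (peval a).

(* Q[X] is {malg rat[{cmonom X}]}, for a possibly infinite X. *)
Definition int_valued : {pred QX} :=
  [pred q | `[< forall a : X -> int, peval a q \is a Num.int >]].

Lemma int_valuedP q :
  reflect (forall a : X -> int, peval a q \is a Num.int) (q \in int_valued).
Proof. exact: asboolP. Qed.

Lemma int_valued_subring : subring_closed int_valued.
Proof.
split=> [|p q /int_valuedP hp /int_valuedP hq|p q /int_valuedP hp /int_valuedP hq];
  apply/int_valuedP => a.
- by rewrite rmorph1 rpred1.
- by rewrite rmorphB; apply: rpredB; [exact: hp|exact: hq].
- by rewrite [peval _ _](rmorphM (peval a)); apply: rpredM; [exact: hp|exact: hq].
Qed.

HB.instance Definition _ := GRing.isSubringClosed.Build QX int_valued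
  int_valued_subring.

Record IntZ := MkIntZ { IntZ_val :> QX; _ : IntZ_val \in int_valued }.

HB.instance Definition _ := [isSub for IntZ_val].
HB.instance Definition _ := [Choice of IntZ by <:].
HB.instance Definition _ := [SubChoice_isSubComNzRing of IntZ by <:].

Lemma IntZ_scaleA (m n : int) (q : IntZ) : q *~ n *~ m = q *~ (m * n).
Proof. by rewrite mulrC mulrzA. Qed.

HB.instance Definition _ := @GRing.Zmodule_isLmodule.Build int IntZ
  (fun n q => q *~ n) IntZ_scaleA (fun q => mulr1z q)
  (fun n p q => mulrzDl_tmp n p q) (fun q m n => mulrzDr_tmp q m n).

HB.instance Definition _ := @GRing.Lmodule_isLalgebra.Build int IntZ
  (fun n (p q : IntZ) => esym (mulrzAl n p q)).

HB.instance Definition _ := GRing.Lalgebra_isComAlgebra.Build int IntZ.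

Lemma int_valued_var x : pvar rat x \in int_valued.
Proof. by apply/int_valuedP => a; rewrite /peval psubst_var intr_int. Qed.

Definition IntZ_var x : IntZ := MkIntZ (int_valued_var x).

Definition evZ (a : X -> int) (q : IntZ) : int := Num.floor (peval a (val q)).

Lemma evZE a q : (evZ a q)%:~R = peval a (val q).
Proof. by apply: floorK; case: q => q /= /int_valuedP. Qed.

Lemma evZ_zmod a : zmod_morphism (evZ a).
Proof.
move=> p q; apply: (@intr_inj rat).
by rewrite intrB !evZE; exact: (rmorphB (peval a)).
Qed.

Lemma evZ_monoid a : monoid_morphism (evZ a).
Proof.
split=> [|p q]; apply: (@intr_inj rat); last first.
  by rewrite intrM !evZE; exact: (rmorphM (peval a)).
by rewrite evZE; exact: (rmorph1 (peval a)).
Qed.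

HB.instance Definition _ a := GRing.isZmodMorphism.Build IntZ int (evZ a) (evZ_zmod a).
HB.instance Definition _ a := GRing.isMonoidMorphism.Build IntZ int (evZ a) (evZ_monoid a).

Lemma evZ0_coeff (q : IntZ) : (evZ (fun=> 0) q)%:~R = (val q)@_mone.
Proof.
have -> : (val q)@_mone = \sum_(m <- msupp (val q)) (val q)@_m *+ (m == mone).
  by rewrite {1}[val q]monalgE raddf_sum; apply: eq_bigr => m _; exact: mcoeffU.
rewrite evZE; transitivity (\sum_(m <- msupp (val q))
    (val q)@_m * cmeval (fun=> 0 : rat) m); first exact: mmapE.
apply: eq_bigr => m _; have [->|m1] := eqVneq m mone.
  by rewrite /cmeval mdom1 big_seq_fset0 mulr1.
suff -> : cmeval (fun=> 0 : rat) m = 0 by rewrite mulr0.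
have [x mx] : exists x, x \in finsupp m.
  apply/fset0Pn; apply: contraNneq m1 => m0; apply/cmP => x.
  by rewrite cm1; apply/eqP; rewrite cmE_eq0 m0 inE.
rewrite /cmeval (big_fsetD1 x) //= expr0n.
by move: mx; rewrite -cmE_neq0 => /negPf ->; rewrite mul0r.
Qed.

Lemma evZ_var a x : evZ a (IntZ_var x) = a x.
Proof. by apply: (@intr_inj rat); rewrite evZE /= /peval psubst_var. Qed.
End IntZ.

Section IntZMap.
Variables (X X' : choiceType) (f : X -> X').

Definition prename : {malg rat[{cmonom X}]} -> {malg rat[{cmonom X'}]} :=
  psubst (@malgC {cmonom X'} rat) (fun x => pvar rat (f x)).

HB.instance Definition _ := GRing.RMorphism.on prename.

Lemma peval_rename a q : peval a (prename q) = peval (a \o f) q.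
Proof.
rewrite /peval /prename psubst_comp; congr (psubst _ _ _).
by apply: funext => x; rewrite psubst_var.
Qed.

Lemma int_valued_rename (q : IntZ X) : prename (val q) \in @int_valued X'.
Proof.
apply/int_valuedP => a; rewrite peval_rename; case: q => q /= /int_valuedP; exact.
Qed.

Definition IntZ_map (q : IntZ X) : IntZ X' := MkIntZ (int_valued_rename q).

Lemma IntZ_map_zmod : zmod_morphism IntZ_map.
Proof. by move=> p q; apply: val_inj; exact: (rmorphB prename). Qed.
Lemma IntZ_map_monoid : monoid_morphism IntZ_map.
Proof.
split=> [|p q]; apply: val_inj; last exact: (rmorphM prename).
exact: (rmorph1 prename).
Qed.
HB.instance Definition _ :=
  GRing.isZmodMorphism.Build (IntZ X) (IntZ X') IntZ_map IntZ_map_zmod.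
HB.instance Definition _ :=
  GRing.isMonoidMorphism.Build (IntZ X) (IntZ X') IntZ_map IntZ_map_monoid.

Lemma evZ_map a q : evZ a (IntZ_map q) = evZ (a \o f) q.
Proof. by apply: (@intr_inj rat); rewrite !evZE peval_rename. Qed.
End IntZMap.

Definition ideal_closed (A : comNzRingType) (I : A -> Prop) :=
  [/\ I 0, forall u v, I u -> I v -> I (u + v) & forall a u, I u -> I (a * u)].

Definition gen_ideal (A : comNzRingType) (S : A -> Prop) (u : A) : Prop :=
  forall I : A -> Prop, ideal_closed I -> (forall s, S s -> I s) -> I u.

Section IntF.
Variables (p : nat) (pr_p : prime p) (X : choiceType).

Definition pbinom (x : X) (n : nat) : {malg rat[{cmonom X}]} :=
  (n`!%:R)^-1 *: \prod_(i < n) (pvar rat x - i%:R).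

(* (A / I) tensored with F_p is A / (I + p A): the constant p is added to the
   generators binom(x, n), p <= n, of I. *)
Definition IntF_rel (q : IntZ X) : Prop :=
  q = p%:R \/ exists x n, (p <= n)%N /\ val q = pbinom x n.

(* The primality argument is what makes the ideal proper; it is kept in the
   term so that the ideal structure can be inferred. *)
Definition IntF_ideal of prime p : {pred IntZ X} :=
  [pred q | `[< gen_ideal IntF_rel q >]].

Lemma IntF_idealP q : reflect (gen_ideal IntF_rel q) (q \in IntF_ideal pr_p).
Proof. exact: asboolP. Qed.

Definition lift_Fp (a : X -> 'F_p) (x : X) : int := (a x : nat)%:Z.

Lemma peval_binom_lift a x n : (p <= n)%N -> peval (lift_Fp a) (pbinom x n) = 0.
Proof.
move=> le_pn; have ltap : (a x < n)%N.
  by rewrite (leq_trans _ le_pn) // -[X in (_ < X)%N](Fp_cast pr_p) ltn_ord.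
rewrite /pbinom /peval -mul_malgC rmorphM rmorph_prod.
rewrite (bigD1 (Ordinal ltap)) //= rmorphB rmorph_nat.
set v := (X in X - _); have -> : v = (lift_Fp a x)%:~R by exact: psubst_var.
by rewrite /lift_Fp subrr mul0r mulr0.
Qed.

Lemma evZ_ideal a q : q \in IntF_ideal pr_p -> (p %| evZ (lift_Fp a) q)%Z.
Proof.
move/IntF_idealP/(_ (fun q => p %| evZ (lift_Fp a) q)%Z); apply.
  split=> [|u v hu hv|b u hu]; first by rewrite rmorph0 dvdz0.
    by rewrite rmorphD; apply: rpredD.
  by rewrite rmorphM dvdz_mull.
move=> s [->|[x [n [le_pn def_s]]]]; first by rewrite rmorph_nat natz dvdzz.
suff -> : evZ (lift_Fp a) s = 0 by rewrite dvdz0.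
by apply: (@intr_inj rat); rewrite evZE def_s peval_binom_lift.
Qed.

Lemma IntF_ideal_closed : idealr_closed (IntF_ideal pr_p).
Proof.
split=> [||b u v /IntF_idealP hu /IntF_idealP hv].
- by apply/IntF_idealP => I [].
- apply/negP => /(evZ_ideal (fun _ => 0)); rewrite rmorph1 dvdz1 /=.
  by apply/negP; rewrite neq_ltn prime_gt1 ?orbT.
apply/IntF_idealP => I idI IS; have [_ ID IM] := idI.
by apply: ID (hv I idI IS); apply: IM; exact: hu.
Qed.

HB.instance Definition _ :=
  isIdealr.Build (IntZ X) (IntF_ideal pr_p) IntF_ideal_closed.

Definition IntF_quot := {ideal_quot (IntF_ideal pr_p)}.

HB.instance Definition _ := GRing.ComNzRing.on IntF_quot.
HB.instance Definition _ := NzRingQuotient.on IntF_quot.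

Lemma pchar_IntF : p \in [pchar IntF_quot].
Proof.
have p0 : \pi_(IntF_quot) (p%:R : IntZ X) = 0.
  have -> : 0 = \pi_(IntF_quot) 0 by rewrite rmorph0.
  apply/eqP; rewrite -Quotient.idealrBE subr0.
  by apply/IntF_idealP => I _; apply; left.
by rewrite inE pr_p -p0 rmorph_nat eqxx.
Qed.

(* The F_p-algebra structure comes from p = 0 in the quotient. *)
Definition IntF := pPrimeCharType pchar_IntF.
HB.instance Definition _ := GRing.ComNzRing.on IntF.
HB.instance Definition _ := GRing.Algebra.on IntF.

Definition IntF_pi (q : IntZ X) : IntF := \pi_(IntF_quot) q.

Lemma IntF_pi_zmod : zmod_morphism IntF_pi.
Proof. exact: rmorphB. Qed.
Lemma IntF_pi_monoid : monoid_morphism IntF_pi.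
Proof. by split; [exact: rmorph1|exact: rmorphM]. Qed.
HB.instance Definition _ :=
  GRing.isZmodMorphism.Build (IntZ X) IntF IntF_pi IntF_pi_zmod.
HB.instance Definition _ :=
  GRing.isMonoidMorphism.Build (IntZ X) IntF IntF_pi IntF_pi_monoid.

Lemma IntF_piP (u v : IntZ X) :
  IntF_pi u = IntF_pi v <-> u - v \in IntF_ideal pr_p.
Proof.
rewrite (@Quotient.idealrBE _ (IntF_ideal pr_p)); split => [e|/eqP e].
  by apply/eqP; exact: e.
exact: e.
Qed.

Definition IntF_repr (q : IntF) : IntZ X := repr (q : IntF_quot).

Lemma IntF_reprK q : IntF_pi (IntF_repr q) = q.
Proof. exact: reprK. Qed.

(* A point of F_p^X is lifted to {0, ..., p-1}^X, where binom(x, n) vanishes for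
   p <= n, so that the value mod p depends only on the class (evF_pi). *)
Definition evF (a : X -> 'F_p) (q : IntF) : 'F_p :=
  (evZ (lift_Fp a) (IntF_repr q))%:~R.

Lemma evF_pi a q : evF a (IntF_pi q) = (evZ (lift_Fp a) q)%:~R.
Proof.
apply/eqP; rewrite -subr_eq0 -intrB -rmorphB /=.
have e := IntF_reprK (IntF_pi q).
have /(evZ_ideal a)/dvdzP[n ->] := (IntF_piP _ _).1 e.
rewrite rmorphM /= [X in _ * X](_ : _ = 0) ?mulr0 //.
exact: (pchar_Fp_0 pr_p).
Qed.

Lemma evF_zmod a : zmod_morphism (evF a).
Proof.
move=> u v; rewrite -[u]IntF_reprK -[v]IntF_reprK -rmorphB !evF_pi.
by rewrite rmorphB intrB.
Qed.
Lemma evF_monoid a : monoid_morphism (evF a).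
Proof.
split=> [|u v]; first by rewrite -(rmorph1 IntF_pi) evF_pi rmorph1.
rewrite -[u]IntF_reprK -[v]IntF_reprK -rmorphM !evF_pi.
by rewrite rmorphM intrM.
Qed.
HB.instance Definition _ a := GRing.isZmodMorphism.Build IntF 'F_p (evF a) (evF_zmod a).
HB.instance Definition _ a := GRing.isMonoidMorphism.Build IntF 'F_p (evF a) (evF_monoid a).

Lemma evF_scalable a : scalable_for *%R (evF a).
Proof.
move=> c u; rewrite [c *: u](_ : _ = c%:R * u) // rmorphM rmorph_nat.
by rewrite natr_Zp.
Qed.

HB.instance Definition _ a :=
  GRing.isScalable.Build 'F_p IntF 'F_p *%R (evF a) (evF_scalable a).

Definition IntF_var (x : X) : IntF := IntF_pi (IntZ_var x).

Lemma evF_var a x : evF a (IntF_var x) = a x.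
Proof. by rewrite evF_pi evZ_var /lift_Fp -pmulrn natr_Zp. Qed.
End IntF.

Section IntFMap.
Variables (p : nat) (pr_p : prime p) (X X' : choiceType) (f : X -> X').

Lemma IntZ_map_ideal q :
  q \in @IntF_ideal p X pr_p -> IntZ_map f q \in @IntF_ideal p X' pr_p.
Proof.
move=> /IntF_idealP Jq; apply/IntF_idealP => I idI IS.
apply: (Jq (fun q => I (IntZ_map f q))).
  case: idI => I0 ID IM; split=> [|u v|b u hu]; first by rewrite rmorph0.
    by rewrite rmorphD; exact: ID.
  by rewrite rmorphM; exact: IM.
move=> s [->|[x [n [le_pn def_s]]]]; apply: IS; first by left; rewrite rmorph_nat.
right; exists (f x), n; split=> //=; rewrite def_s /pbinom -!mul_malgC.
rewrite rmorphM /= rmorph_prod /= /prename psubst_C; congr (_ * _).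
apply: eq_bigr => i _; rewrite rmorphB rmorph_nat; congr (_ - _).
exact: psubst_var.
Qed.

Definition IntF_map (q : IntF pr_p X) : IntF pr_p X' :=
  IntF_pi pr_p (IntZ_map f (IntF_repr q)).

Lemma IntF_map_pi q : IntF_map (IntF_pi pr_p q) = IntF_pi pr_p (IntZ_map f q).
Proof.
apply/IntF_piP; rewrite -rmorphB; apply: IntZ_map_ideal; apply/IntF_piP.
exact: IntF_reprK.
Qed.

Lemma IntF_map_zmod : zmod_morphism IntF_map.
Proof.
move=> u v; rewrite -[u]IntF_reprK -[v]IntF_reprK.
by rewrite -rmorphB !IntF_map_pi -!rmorphB.
Qed.
Lemma IntF_map_monoid : monoid_morphism IntF_map.
Proof.
split=> [|u v]; first by rewrite -(rmorph1 (@IntF_pi p pr_p X)) IntF_map_pi !rmorph1.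
rewrite -[u]IntF_reprK -[v]IntF_reprK.
by rewrite -rmorphM !IntF_map_pi -!rmorphM.
Qed.
HB.instance Definition _ :=
  GRing.isZmodMorphism.Build (IntF pr_p X) (IntF pr_p X') IntF_map IntF_map_zmod.
HB.instance Definition _ :=
  GRing.isMonoidMorphism.Build (IntF pr_p X) (IntF pr_p X') IntF_map IntF_map_monoid.

Lemma IntF_map_scalable : scalable IntF_map.
Proof.
move=> c u; rewrite [c *: u](_ : _ = c%:R * u) // rmorphM rmorph_nat.
by [].
Qed.

HB.instance Definition _ := GRing.isScalable.Build 'F_p
  (IntF pr_p X) (IntF pr_p X') *:%R IntF_map IntF_map_scalable.

Lemma evF_map a q : evF a (IntF_map q) = evF (a \o f) q.
Proof. by rewrite evF_pi evZ_map. Qed.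
End IntFMap.

Inductive base : Type := BaseZ | BaseF p of prime p.

Definition coef (b : base) : comNzRingType :=
  match b with BaseZ => int | BaseF p _ => 'F_p end.

Definition IntR (b : base) (X : choiceType) : comAlgType (coef b) :=
  match b with BaseZ => IntZ X | BaseF p pr_p => IntF pr_p X end.

Definition gen (b : base) (X : choiceType) : X -> IntR b X :=
  match b with BaseZ => @IntZ_var X | BaseF p pr_p => @IntF_var p pr_p X end.

Definition ev (b : base) (X : choiceType) : (X -> coef b) -> IntR b X -> coef b :=
  match b with BaseZ => @evZ X | BaseF p pr_p => @evF p pr_p X end.

Definition IntR_map (b : base) (X X' : choiceType) (f : X -> X') : IntR b X -> IntR b X' :=
  match b with BaseZ => IntZ_map f | BaseF p pr_p => @IntF_map p pr_p X X' f end.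

Section IntRTheory.
Variables (b : base) (X : choiceType).
Implicit Types (a : X -> coef b) (q : IntR b X).

Lemma ev_linear a : linear_for *%R (@ev b X a).
Proof.
case: b a => [|p pr_p] a c u v /=; last by rewrite linearP.
by rewrite [c *: u](_ : _ = u *~ c) // raddfD raddfMz /= -mulrzl intz.
Qed.

Lemma ev_monoid a : monoid_morphism (@ev b X a).
Proof. by case: b a => [|p pr_p] a /=; split; [exact: rmorph1|exact: rmorphM|exact: rmorph1|exact: rmorphM]. Qed.

HB.instance Definition _ a := GRing.isLinear.Build (coef b) (IntR b X) (coef b) *%R (@ev b X a) (ev_linear a).
HB.instance Definition _ a := GRing.isMonoidMorphism.Build (IntR b X) (coef b) (@ev b X a) (ev_monoid a).

Lemma ev_gen a x : ev a (gen b x) = a x.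
Proof. by case: b a => [|p pr_p] a; [exact: evZ_var|exact: evF_var]. Qed.

End IntRTheory.

Section IntRMap.
Context (b : base) (X X' : choiceType) (f : X -> X').

Lemma IntR_map_linear : linear (@IntR_map b X X' f).
Proof.
case: b => [|p pr_p] c u v /=; last by rewrite linearP.
have -> : c *: u + v = u *~ c + v by [].
by rewrite raddfD raddfMz.
Qed.
Lemma IntR_map_monoid : monoid_morphism (@IntR_map b X X' f).
Proof. by case: b => [|p pr_p] /=; split; [exact: rmorph1|exact: rmorphM|exact: rmorph1|exact: rmorphM]. Qed.
HB.instance Definition _ := GRing.isLinear.Build (coef b) (IntR b X) (IntR b X') *:%R (@IntR_map b X X' f) IntR_map_linear.
HB.instance Definition _ := GRing.isMonoidMorphism.Build (IntR b X) (IntR b X') (@IntR_map b X X' f) IntR_map_monoid.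

Lemma ev_map (a : X' -> coef b) (q : IntR b X) : ev a (IntR_map f q) = ev (a \o f) q.
Proof. by case: b a q => [|p pr_p] a q; [exact: evZ_map|exact: evF_map]. Qed.
Lemma IntR_map_gen x : IntR_map f (gen b x) = gen b (f x).
Proof.
have eZ : IntZ_map f (IntZ_var x) = IntZ_var (f x).
  by apply: val_inj; exact: psubst_var.
by case: b => [|p pr_p] //=; rewrite /IntF_var IntF_map_pi eZ.
Qed.
End IntRMap.

Section Aug.
Context (b : base) (X : choiceType).

(* The constant term of a polynomial is its value at the origin; see
   evZ0_coeff for R = Z. *)
Definition aug_pred : {pred IntR b X} := [pred q | ev (fun=> 0) q == 0].

Lemma aug_submod : submod_closed aug_pred.
Proof.
split=> [|c u v]; rewrite !inE ?raddf0 // => /eqP hu /eqP hv.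
by rewrite ev_linear hu hv mulr0 addr0.
Qed.
HB.instance Definition _ := GRing.isSubmodClosed.Build (coef b) (IntR b X) aug_pred aug_submod.

Record aug := MkAug { aug_val :> IntR b X; _ : aug_val \in aug_pred }.
HB.instance Definition _ := [isSub for aug_val].
HB.instance Definition _ := [Choice of aug by <:].
HB.instance Definition _ := [SubChoice_isSubLmodule of aug by <:].

Lemma aug0 (q : aug) : ev (fun=> 0) (val q) = 0.
Proof. by case: q => q /= /eqP. Qed.

Lemma augM_subproof (p q : aug) : val p * val q \in aug_pred.
Proof. by rewrite inE (ev_monoid _).2 aug0 mul0r. Qed.
Definition augM (p q : aug) : aug := MkAug (augM_subproof p q).

Lemma augX_subproof x : gen b x \in aug_pred.
Proof. by rewrite inE ev_gen. Qed.
Definition augX x : aug := MkAug (augX_subproof x).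
End Aug.

Section AugMap.
Context (b : base) (X X' : choiceType) (f : X -> X').
Lemma aug_map_subproof (q : aug b X) : IntR_map f (val q) \in @aug_pred b X'.
Proof. by rewrite inE ev_map; apply/eqP; exact: aug0. Qed.
Definition aug_map q : aug b X' := MkAug (aug_map_subproof q).
Lemma aug_map_linear : linear aug_map.
Proof. by move=> c u v; apply: val_inj; exact: (@linearP _ _ _ _ (@IntR_map b X X' f)). Qed.
HB.instance Definition _ := GRing.isLinear.Build (coef b) (aug b X) (aug b X') *:%R aug_map aug_map_linear.
End AugMap.

Section TensorPower.
Context (R : comNzRingType) (M : lmodType R) (k : nat).
Local Notation FM := {malg R[k.-tuple M]}.

(* tupd s i u is s with its i-th entry replaced by u. *)
Definition tupd (s : k.-tuple M) (i : 'I_k) (u : M) : k.-tuple M :=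
  [tuple if j == i then u else tnth s j | j < k].

Definition tpow_rel (w : FM) : Prop :=
  exists (s : k.-tuple M) (i : 'I_k) (c : R) (u v : M),
    w = << tupd s i (c *: u + v) >> - (c *: << tupd s i u >> + << tupd s i v >>).

Definition gen_submod (V : lmodType R) (S : V -> Prop) (v : V) : Prop :=
  forall P : V -> Prop, P 0 -> (forall c u w, P u -> P w -> P (c *: u + w)) ->
    (forall s, S s -> P s) -> P v.

Definition tpow_ker : {pred FM} := [pred w | `[< gen_submod tpow_rel w >]].

Lemma tpow_kerP w : reflect (gen_submod tpow_rel w) (w \in tpow_ker).
Proof. exact: asboolP. Qed.

Lemma tpow_ker_submod : submod_closed tpow_ker.
Proof.
split=> [|c u w /tpow_kerP hu /tpow_kerP hw]; apply/tpow_kerP => P P0 PD PS //.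
by apply: (PD); [exact: (hu P)|exact: (hw P)].
Qed.
HB.instance Definition _ := GRing.isSubmodClosed.Build R FM tpow_ker tpow_ker_submod.

Definition tpow := {ideal_quot tpow_ker}.
HB.instance Definition _ := GRing.Zmodule.on tpow.
HB.instance Definition _ := EqQuotient.on tpow.

Definition tpow_scale (c : R) (t : tpow) : tpow := \pi_tpow (c *: repr t).

Lemma tpow_piP (u v : FM) : \pi_tpow u = \pi_tpow v <-> u - v \in tpow_ker.
Proof. by rewrite (@Quotient.idealrBE _ tpow_ker); split=> [->|/eqP]. Qed.

Lemma tpow_piZ c u : tpow_scale c (\pi_tpow u) = \pi_tpow (c *: u).
Proof.
by apply/tpow_piP; rewrite -scalerBr rpredZ //; apply/tpow_piP; rewrite reprK.
Qed.
Lemma tpow_piD (u v : FM) : \pi_tpow (u + v) = \pi_tpow u + \pi_tpow v :> tpow.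
Proof. exact: raddfD. Qed.
Lemma tpow_scaleA c d t : tpow_scale c (tpow_scale d t) = tpow_scale (c * d) t.
Proof. by elim/quotW: t => t; rewrite (tpow_piZ d t) !tpow_piZ scalerA. Qed.
Lemma tpow_scale1 : left_id 1 tpow_scale.
Proof. by elim/quotW => t; rewrite tpow_piZ scale1r. Qed.
Lemma tpow_scaleDr : right_distributive tpow_scale +%R.
Proof.
move=> c; elim/quotW => t; elim/quotW => u.
by rewrite -tpow_piD !tpow_piZ scalerDr tpow_piD.
Qed.
Lemma tpow_scaleDl t : {morph tpow_scale^~ t : c d / c + d}.
Proof. by elim/quotW: t => t c d; rewrite !tpow_piZ scalerDl tpow_piD. Qed.
HB.instance Definition _ := GRing.Zmodule_isLmodule.Build R tpow
  tpow_scaleA tpow_scale1 tpow_scaleDr tpow_scaleDl.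

Lemma tpow_scaleE c (u : FM) : c *: (\pi_tpow u : tpow) = \pi_tpow (c *: u).
Proof. exact: tpow_piZ. Qed.

Definition tpure (s : k.-tuple M) : tpow := \pi_tpow << s >>.

End TensorPower.

Section TensorLift.
Context (R : comNzRingType) (M : lmodType R) (k : nat) (V : lmodType R).
Local Notation FM := {malg R[k.-tuple M]}.

Definition multilinear (g : k.-tuple M -> V) :=
  forall s i c u v, g (tupd s i (c *: u + v)) = c *: g (tupd s i u) + g (tupd s i v).

Variable g : k.-tuple M -> V.

Definition flift (w : FM) : V := \sum_(s <- msupp w) w@_s *: g s.

(* The linear map induced by a multilinear map; see tlift_pure, tlift_linear. *)
Definition tlift (t : tpow M k) : V := flift (repr t).

Lemma flift_linear : linear flift.
Proof.
have Ew (D : {fset k.-tuple M}) w : (msupp w `<=` D)%fset ->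
    flift w = \sum_(s <- D) w@_s *: g s.
  move=> le; apply: (big_fset_incl _ le) => s _ /mcoeff_outdom ->.
  exact: scale0r.
move=> c u v; pose D := (msupp u `|` msupp v)%fset.
have le_uD : (msupp u `<=` D)%fset by exact: fsubsetUl.
have le_vD : (msupp v `<=` D)%fset by exact: fsubsetUr.
have leD : (msupp (c *: u + v) `<=` D)%fset.
  apply: fsubset_trans (msuppD_le _ _) _; apply: fsetSU; exact: msuppZ_le.
rewrite (Ew _ _ le_uD) (Ew _ _ le_vD) (Ew _ _ leD) scaler_sumr -big_split /=.
by apply: eq_bigr => s _; rewrite mcoeffD mcoeffZ scalerDl scalerA.
Qed.
HB.instance Definition _ := GRing.isLinear.Build R FM V *:%R flift flift_linear.

Lemma flift_pure s : flift << s >> = g s.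
Proof. by rewrite /flift msuppU oner_eq0 big_seq_fset1 mcoeffUU scale1r. Qed.

Hypothesis g_ml : multilinear g.

Lemma tlift_pi w : tlift (\pi_(tpow M k) w) = flift w.
Proof.
apply/eqP; rewrite -subr_eq0 -[_ - _](linearB flift); apply/eqP.
have /tpow_piP/tpow_kerP : \pi_(tpow M k) (repr (\pi_(tpow M k) w)) = \pi_(tpow M k) w.
  by rewrite reprK.
move=> /(_ (fun w => flift w = 0)); apply.
- exact: linear0.
- by move=> c u v; rewrite flift_linear => -> ->; rewrite scaler0 addr0.
move=> _ [s [i [c [u [v ->]]]]].
by rewrite linearB linearP /= !flift_pure g_ml subrr.
Qed.

Lemma tlift_pure s : tlift (tpure s) = g s.
Proof. by rewrite tlift_pi flift_pure. Qed.

Lemma tlift_linear : linear tlift.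
Proof.
move=> c; elim/quotW => u; elim/quotW => v.
by rewrite tpow_scaleE -tpow_piD !tlift_pi flift_linear.
Qed.

End TensorLift.

Section TensorTheory.
Context (R : comNzRingType) (M : lmodType R).

Lemma tpure_multilinear k : multilinear (@tpure R M k).
Proof.
move=> s i c u v; rewrite /tpure tpow_scaleE -tpow_piD; apply/tpow_piP/tpow_kerP.
by move=> P _ _; apply; exists s, i, c, u, v.
Qed.

Lemma tlift_fun_linear k (V : lmodType R) (g g1 g2 : k.-tuple M -> V) c t :
  (forall s, g s = c *: g1 s + g2 s) -> tlift g t = c *: tlift g1 t + tlift g2 t.
Proof.
move=> gE; rewrite /tlift /flift scaler_sumr -big_split /=; apply: eq_bigr => s _.
by rewrite gE scalerDr !scalerA mulrC.
Qed.

Definition tpair (a b : M) : tpow M 2 := tpure [tuple a; b].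

Lemma tpair_linearl b : linear (tpair^~ b).
Proof.
have e (a x : M) : [tuple a; b] = tupd [tuple x; b] ord0 a.
  by apply: eq_from_tnth => j; rewrite tnth_mktuple; case: j => [[|[]]].
by move=> c u v; rewrite /tpair (e (c *: u + v) 0) (e u 0) (e v 0) tpure_multilinear.
Qed.
Lemma tpair_linearr a : linear (tpair a).
Proof.
have e (b x : M) : [tuple a; b] = tupd [tuple a; x] (lift ord0 ord0) b.
  by apply: eq_from_tnth => j; rewrite tnth_mktuple; case: j => [[|[]]].
by move=> c u v; rewrite /tpair (e (c *: u + v) 0) (e u 0) (e v 0) tpure_multilinear.
Qed.

Definition bilin (V : lmodType R) (g : M -> M -> V) (s : 2.-tuple M) : V :=
  g (tnth s ord0) (tnth s ord_max).

Lemma bilin_multilinear (V : lmodType R) (g : M -> M -> V) :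
  (forall b, linear (g^~ b)) -> (forall a, linear (g a)) -> multilinear (bilin g).
Proof.
move=> gl gr s i c u v; rewrite /bilin !tnth_mktuple.
by case: i => [[|[|//]]] ? /=; rewrite ?gl ?gr.
Qed.

Definition tmul k l (t : tpow M k) (u : tpow M l) : tpow M (k + l) :=
  tlift (fun r => tlift (fun s => tpure (cat_tuple r s)) u) t.

Lemma tmul_pure k l (r : k.-tuple M) (s : l.-tuple M) :
  tmul (tpure r) (tpure s) = tpure (cat_tuple r s).
Proof.
have el i u (q : k.-tuple M) (q' : l.-tuple M) :
    cat_tuple (tupd q i u) q' = tupd (cat_tuple q q') (lshift l i) u.
  apply: eq_from_tnth => j; rewrite tnth_mktuple.
  case: (split_ordP j) => j' ->; rewrite ?tnth_lshift ?tnth_rshift ?tnth_mktuple.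
    by rewrite (inj_eq (@lshift_inj _ _)).
  by rewrite eq_rlshift.
have er i u (q : k.-tuple M) (q' : l.-tuple M) :
    cat_tuple q (tupd q' i u) = tupd (cat_tuple q q') (rshift k i) u.
  apply: eq_from_tnth => j; rewrite tnth_mktuple.
  case: (split_ordP j) => j' ->; rewrite ?tnth_lshift ?tnth_rshift ?tnth_mktuple.
    by rewrite eq_lrshift.
  by rewrite (inj_eq (@rshift_inj _ _)).
rewrite /tmul tlift_pure ?tlift_pure //.
- by move=> s' i c u v; rewrite !er tpure_multilinear.
- move=> s' i c u v; apply: tlift_fun_linear => q.
  by rewrite !el tpure_multilinear.
Qed.

End TensorTheory.

Section FreeBinomial.
Context (b : base) (X : choiceType).

Definition TR (k : nat) : lmodType (coef b) := tpow (aug b X) k.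

Definition tdeg1 (a : aug b X) : TR 1 := tpure [tuple a].

Lemma augM_linearl (q : aug b X) : linear (fun a => augM a q).
Proof. by move=> c u v; apply: val_inj; rewrite /= mulrDl scalerAl. Qed.
Lemma augM_linearr (q : aug b X) : linear (augM q).
Proof. by move=> c u v; apply: val_inj; rewrite /= mulrDr scalerAr. Qed.

Definition cup1 (t : TR 2) (c : aug b X) : TR 2 :=
  tlift (bilin (fun a1 a2 => tpair (augM a1 c) a2 + tpair a1 (augM a2 c))) t.

Lemma cup1_pure a1 a2 c :
  cup1 (tpair a1 a2) c = tpair (augM a1 c) a2 + tpair a1 (augM a2 c).
Proof.
rewrite /cup1 tlift_pure //; apply: bilin_multilinear => q d u v /=.
  by rewrite augM_linearl !tpair_linearl addrACA scalerDr.
by rewrite augM_linearl !tpair_linearr addrACA scalerDr.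
Qed.

Definition circ (t u : TR 2) : TR 2 :=
  tlift (bilin (fun a1 a2 =>
    tlift (bilin (fun b1 b2 => tpair (augM a1 b1) (augM a2 b2))) u)) t.

Lemma circ_pure a1 a2 b1 b2 :
  circ (tpair a1 a2) (tpair b1 b2) = tpair (augM a1 b1) (augM a2 b2).
Proof.
rewrite /circ tlift_pure; last first.
  apply: bilin_multilinear => q d u v /=; apply: tlift_fun_linear => s.
    by rewrite /bilin augM_linearl tpair_linearl.
  by rewrite /bilin augM_linearl tpair_linearr.
rewrite [LHS]/bilin tlift_pure //.
apply: bilin_multilinear => q d u v /=; rewrite !(tnth0, tnthS) /=.
  by rewrite augM_linearr tpair_linearl.
by rewrite augM_linearr tpair_linearr.
Qed.

Definition psi k (t : TR k) (a : k.-tuple (X -> coef b)) : coef b :=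
  tlift (V := (coef b)^o)
    (fun q : k.-tuple (aug b X) => \prod_(i < k) ev (tnth a i) (tnth q i)) t.

Lemma psi_multilinear k (a : k.-tuple (X -> coef b)) :
  multilinear (V := (coef b)^o)
    (fun q : k.-tuple (aug b X) => \prod_(i < k) ev (tnth a i) (tnth q i)).
Proof.
move=> s i c u v.
have D w : \prod_(j < k) ev (tnth a j) (tnth (tupd s i w) j) =
    ev (tnth a i) (val w) * \prod_(j < k | j != i) ev (tnth a j) (tnth s j).
  rewrite (bigD1 i) //= tnth_mktuple eqxx; congr (_ * _).
  by apply: eq_bigr => j /negPf ji; rewrite tnth_mktuple ji.
by rewrite !D /= ev_linear mulrDl -mulrA.
Qed.

Lemma psi_pure k (q : k.-tuple (aug b X)) a :
  psi (tpure q) a = \prod_(i < k) ev (tnth a i) (tnth q i).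
Proof. by rewrite /psi tlift_pure //; exact: psi_multilinear. Qed.

(* In the Leibniz rule the cast identifies T^(k + l.+1) with T^((k + l).+1). *)
Record fbdga := FBDGA {
  fbd :> forall k, {linear TR k -> TR k.+1};
  fbd_sq : forall k (t : TR k), fbd k.+1 (fbd k t) = 0;
  fbd_leibniz : forall k l (t : TR k) (u : TR l),
    fbd (k + l)%N (tmul t u) =
      tmul (fbd k t) u + (-1) ^+ k *: ecast n (TR n) (addnS k l) (tmul t (fbd l u));
  fbd_cup1 : forall p q : aug b X,
    fbd 1 (tdeg1 (augM p q)) =
      - tpair p q - tpair q p
      + cup1 (fbd 1 (tdeg1 p)) q + cup1 (fbd 1 (tdeg1 q)) p
      - circ (fbd 1 (tdeg1 p)) (fbd 1 (tdeg1 q)) }.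

(* Only the product and the unit are recorded; the group laws follow from the
   axioms of [fbdga] and the filtration by Hirsch extensions. *)
Definition GT of fbdga := X -> coef b.

(* psi of the degree 2 element d(x) = sum_i p_i (x) q_i is sum_i p_i(a) q_i(a'). *)
Definition GT_mul (D : fbdga) (a a' : GT D) : GT D :=
  fun x => a x + a' x - psi (D 1%N (tdeg1 (augX b x))) [tuple a; a'].
Definition GT_one (D : fbdga) : GT D := fun=> 0.
HB.instance Definition _ D := hasMul.Build (GT D) (@GT_mul D).
HB.instance Definition _ D := hasOne.Build (GT D) (@GT_one D).

End FreeBinomial.

Section TRMap.
Context (b : base) (X X' : choiceType) (f : X -> X').
Definition TR_map k (t : TR b X k) : TR b X' k :=
  tlift (fun q => tpure (map_tuple (aug_map f) q)) t.

Lemma TR_map_pure k (q : k.-tuple (aug b X)) :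
  TR_map (tpure q) = tpure (map_tuple (aug_map f) q).
Proof.
have e i u (s : k.-tuple (aug b X)) :
    map_tuple (aug_map f) (tupd s i u) = tupd (map_tuple (aug_map f) s) i (aug_map f u).
  apply: eq_from_tnth => j; rewrite !(tnth_map, tnth_mktuple).
  by case: eqP.
rewrite /TR_map tlift_pure // => s i c u v.
by rewrite !e linearP tpure_multilinear.
Qed.
End TRMap.

Section Bar.
Context (G : magmaType) (R : comNzRingType).

(* The i-th face of [g_1|...|g_(k+1)]: drop g_1 if i = 0, drop g_(k+1) if
   i = k+1, and multiply g_i and g_(i+1) otherwise. *)
Definition bar_face k (i : 'I_k.+2) (s : k.+1.-tuple G) : k.-tuple G :=
  [tuple let g := tnth s (widen_ord (leqnSn k) j) in
         let h := tnth s (lift ord0 j) in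
         if (j.+1 < i)%N then g else if (j.+1 == i)%N then (g * h)%g else h
  | j < k].

Definition bar_cochain (k : nat) : lmodType R := (k.-tuple G -> R^o).

Definition bar_diff k (c : bar_cochain k) : bar_cochain k.+1 :=
  fun s => \sum_(i < k.+2) (-1) ^+ i * c (bar_face i s).

End Bar.

Definition bar_pull (G G' : magmaType) (R : comNzRingType) (f : G -> G') k
    (c : bar_cochain G' R k) : bar_cochain G R k :=
  fun s => c (map_tuple f s).

Definition diffT (b : base) (X : choiceType) (D : fbdga b X) k :
    TR b X k -> TR b X k.+1 :=
  D k.

Definition psiT (b : base) (X : choiceType) (D : fbdga b X) k (t : TR b X k) :
    bar_cochain (GT D) (coef b) k :=
  fun s => psi t s.

Arguments bar_diff G R {k} c.
Arguments diffT {b X} D {k} t.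
Arguments psiT {b X} D {k} t.

Section QuasiIso.
Context (R : comNzRingType) (C C' : nat -> lmodType R).
Context (d : forall k, C k -> C k.+1) (d' : forall k, C' k -> C' k.+1).

Definition coboundary (A : nat -> lmodType R) (dA : forall k, A k -> A k.+1) k :
    A k -> Prop :=
  match k with
  | 0 => fun c => c = 0
  | k'.+1 => fun c => exists e : A k', c = dA k' e
  end.

Definition cohomologous (A : nat -> lmodType R) (dA : forall k, A k -> A k.+1)
    k (c c' : A k) := coboundary dA (c - c').

Definition cochain_map (f : forall k, C k -> C' k) : Prop :=
  forall k, linear (f k) /\ forall c, f k.+1 (d c) = d' (f k c).

(* A cochain map inducing a bijection on the cohomology in each degree. *)
Definition quasi_iso (f : forall k, C k -> C' k) : Prop :=
  cochain_map f /\
  forall k,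
    (forall c1 c2 : C k, d c1 = 0 -> d c2 = 0 ->
       cohomologous d' (f k c1) (f k c2) -> cohomologous d c1 c2) /\
    (forall c' : C' k, d' c' = 0 ->
       exists c : C k, d c = 0 /\ cohomologous d' (f k c) c').
End QuasiIso.

Section Hirsch.
Context (b : base).

Definition dga_inclusion (X X' : choiceType) (f : X -> X')
    (D : fbdga b X) (D' : fbdga b X') : Prop :=
  injective f /\
  forall k (t : TR b X k), D' k (TR_map f t) = TR_map f (D k t).

(* The new variables are those outside the image of f. *)
Definition hirsch_ext (X X' : choiceType) (f : X -> X')
    (D : fbdga b X) (D' : fbdga b X') : Prop :=
  dga_inclusion f D D' /\
  forall y : X', (forall x, y <> f x) ->
    exists c : TR b X 2, D 2%N c = 0 /\ D' 1%N (tdeg1 (augX b y)) = TR_map f c.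

Definition stage (X : choiceType) (Xs : nat -> {fset X}) (n : nat) : {fset X} :=
  (\bigcup_(i <- iota 0 n.+1) Xs i)%fset.

Lemma stage_sub (X : choiceType) (Xs : nat -> {fset X}) n :
  (stage Xs n `<=` stage Xs n.+1)%fset.
Proof.
apply/bigfcupsP => i i_in _.
have j_in : i \in iota 0 n.+2.
  by move: i_in; rewrite !mem_iota /= !add0n => lei; exact: leqW.
exact: (bigfcup_sup _ j_in).
Qed.

(* Indices are shifted by one: Xs n is X_(n+1) and stage Xs n is X^(n+1). *)
Definition colimit_hirsch (X : choiceType) (D : fbdga b X) : Prop :=
  exists Xs : nat -> {fset X},
  [/\ forall x, exists n, x \in Xs n,
      Xs 0%N <> fset0 &
      exists Dn : forall n, fbdga b (stage Xs n),
      [/\ forall n, dga_inclusion val (Dn n) D,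
          forall n, hirsch_ext (fincl (stage_sub Xs n)) (Dn n) (Dn n.+1) &
          forall x : stage Xs 0, Dn 0%N 1%N (tdeg1 (augX b x)) = 0]].

End Hirsch.

Record central_ext (F : zmodType) (E : groupType) (G : baseUMagmaType)
    (iota : F -> E) (pi : E -> G) : Prop := CentralExt {
  ce_iotaD : forall u v, iota (u + v) = (iota u * iota v)%g;
  ce_iota_inj : injective iota;
  ce_central : forall u g, (iota u * g = g * iota u)%g;
  ce_piM : forall g h, pi (g * h)%g = (pi g * pi h)%g;
  ce_pi_surj : forall h, exists g, pi g = h;
  ce_exact : forall g, pi g = 1%g <-> exists u, g = iota u }.

(* Phi is an isomorphism from the central extension (iota, pi) of GT D to the
   restriction of functions GT D' -> GT D, whose kernel, the functions vanishing
   on X, is identified with the R-module Y -> R. *)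
Record ext_iso (b : base) (X Y : choiceType) (D : fbdga b X)
    (D' : fbdga b (X + Y)%type) (F : lmodType (coef b)) (E : groupType)
    (iota : F -> E) (pi : E -> GT D) (Phi : E -> GT D') : Prop := ExtIso {
  ei_bij : bijective Phi;
  ei_mul : forall g h, Phi (g * h)%g = (Phi g * Phi h)%g;
  ei_res : forall g, (fun x => Phi g (inl x)) = pi g;
  ei_ker : exists phi : F -> (Y -> (coef b)^o),
    [/\ linear phi, bijective phi &
        forall u, Phi (iota u) =
          (fun z => match z with inl _ => 0 | inr y => phi u y end)] }.

(* Main.v *)
(* Through psi, the tensor algebra T_R(X) is the subcomplex P of normalized polynomial
   cochains in the bar complex C of the group R^X: psi is injective with image P because
   products of binomials are triangular at the points of N^X. A free binomial
   cup_1-dga on X can therefore be transported from a polynomial group law on R^X.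
   Since psi is onto in degree 2, the extension cocycle is cohomologous to one in P,
   which gives polynomial coordinates on E, hence Tbar.

   It remains to show that C/P is acyclic for E when it is for G. The Cech complexes
   of E -> G, formed of cochains on the fibre products E x_G ... x_G E = F^m x E, are
   contracted by a polynomial section of E -> G. A zigzag in the resulting double
   complex, by induction on the degree, reduces the claim to a comparison of F x H with
   H below a given degree, and there F can be taken to be R. By Shapiro's lemma, R x H
   with coefficients in Fun(R) behaves as H with constant coefficients; one descends to
   constant coefficients by the exact sequence
     0 -> R -> Fun(R) -> Fun(R) -> 0 for R = Z,
     0 -> R -> Fun(R) -> Fun(R) -> R -> 0 for R = F_p,
   in which the middle map is the forward difference and the last one the sum. *)

Require Import Defs.
From HB Require Import structures.
From mathcomp Require Import all_boot all_order all_algebra all_field.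
From mathcomp Require Import finmap boolp functions.
From mathcomp.multinomials Require Import monalg.
From mathcomp Require Import ring.

Set Implicit Arguments.
Unset Strict Implicit.
Unset Printing Implicit Defensive.

Import GRing.Theory.
Local Open Scope ring_scope.

(** * Polynomial functions *)

(** Once [psi] is injective, being a quasi-isomorphism means that C/P has no cohomology, a statement
    about the polynomial group alone. The obstacle is that E -> G need not have a homomorphic
    section, so E cannot be compared directly with F x G. Pulled back to E the extension splits: two
    points of a fibre differ by an element of F, and in the difference the cocycle cancels. This is
    the reason for the fibre products. In the degree being treated the acyclicity of E is still
    unknown, so that of E x_G E cannot be used; but the two pullbacks of a cochain of E agree on the
    diagonal, and there injectivity of a restriction is enough. Hence the Kunneth statements assert
    injectivity in degree k from acyclicity below k. The choice of Z and F_p enters through the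
    forward difference: its kernel is the constants because 1 generates R additively, and summation
    preserves polynomials, over Z thanks to binomials, over F_p by interpolation. Over F_p a
    function can be summed around the cycle only if its total is 0, whence the extra term of the
    sequence. *)

Lemma coef_mulf_eq0 (b : base) (x y : coef b) : x * y = 0 -> x = 0 \/ y = 0.
Proof.
by case: b x y => [|p pr_p] /= x y /eqP; rewrite mulf_eq0 => /orP[] /eqP; [left|right|left|right].
Qed.

Section Polynomial.
Context (b : base).
Local Notation R := (coef b).

(** Coordinates form a predicate instead of an indexed family, so that the line, vectors, points of
    an infinite R^X and products of these are treated alike. *)
Record cspace := CSpace { csort :> Type; is_coord : (csort -> R) -> Prop }.

(** Products are built one coordinate at a time, so that inductions such as [alg_antidiff] and
    [alg_pspan] only meet multiplication by a variable; closure under products is [algM]. *)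
Inductive alg (S : cspace) : (S -> R) -> Prop :=
| alg_const c : alg (fun=> c)
| alg_coordM f g : is_coord f -> alg g -> alg (fun s => f s * g s)
| alg_add f g : alg f -> alg g -> alg (fun s => f s + g s).

(* Saturating by [N] adds the integer-valued rational polynomials when R = Z, and
   nothing when R = F_p. *)
Definition pol (S : cspace) (f : S -> R) : Prop :=
  exists N : nat, N%:R <> 0 :> R /\ alg (fun s => N%:R * f s).

Definition polmap (S S' : cspace) (phi : S -> S') : Prop :=
  forall f, @is_coord S' f -> pol (fun s => f (phi s)).

Lemma eq_alg (S : cspace) (f g : S -> R) : f =1 g -> alg f -> alg g.
Proof. by move=> /funext ->. Qed.

Lemma eq_pol (S : cspace) (f g : S -> R) : f =1 g -> pol f -> pol g.
Proof. by move=> /funext ->. Qed.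

Section OneSpace.
Variable S : cspace.
Implicit Types f g : S -> R.

Lemma algM f g : alg f -> alg g -> alg (fun s => f s * g s).
Proof.
move=> af ag; elim: af => [c|h k ch _ IH|h k _ IH1 _ IH2].
- elim: ag => [d|h k ch _ IH|h k _ IH1 _ IH2]; first exact: alg_const.
    by apply: eq_alg (alg_coordM ch IH) => s /=; ring.
  by apply: eq_alg (alg_add IH1 IH2) => s /=; ring.
- by apply: eq_alg (alg_coordM ch IH) => s /=; ring.
by apply: eq_alg (alg_add IH1 IH2) => s /=; ring.
Qed.

Lemma alg_pol f : alg f -> pol f.
Proof.
move=> af; exists 1%N; split; first by move=> /eqP; rewrite oner_eq0.
by apply: eq_alg af => s; rewrite mul1r.
Qed.

Lemma pol_const c : pol (fun _ : S => c).
Proof. exact/alg_pol/alg_const. Qed.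

Lemma pol_coord f : is_coord f -> pol f.
Proof.
move=> cf; apply: alg_pol; apply: eq_alg (alg_coordM cf (alg_const _ 1)) => s.
by rewrite mulr1.
Qed.

Lemma natr_neq0M (M N : nat) : M%:R <> 0 :> R -> N%:R <> 0 :> R -> (M * N)%:R <> 0 :> R.
Proof. by move=> M0 N0; rewrite natrM => /coef_mulf_eq0[]. Qed.

Lemma polD f g : pol f -> pol g -> pol (fun s => f s + g s).
Proof.
move=> [M [M0 af]] [N [N0 ag]]; exists (M * N)%N; split; first exact: natr_neq0M.
apply: eq_alg (alg_add (algM (alg_const _ N%:R) af) (algM (alg_const _ M%:R) ag)) => s.
by rewrite natrM /=; ring.
Qed.

Lemma polM f g : pol f -> pol g -> pol (fun s => f s * g s).
Proof.
move=> [M [M0 af]] [N [N0 ag]]; exists (M * N)%N; split; first exact: natr_neq0M.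
by apply: eq_alg (algM af ag) => s; rewrite natrM /=; ring.
Qed.

Lemma polN f : pol f -> pol (fun s => - f s).
Proof. by move=> pf; apply: eq_pol (polM (pol_const (-1)) pf) => s; ring. Qed.

Lemma polB f g : pol f -> pol g -> pol (fun s => f s - g s).
Proof. by move=> pf pg; exact: polD pf (polN pg). Qed.

Lemma polX f n : pol f -> pol (fun s => f s ^+ n).
Proof.
move=> pf; elim: n => [|n IH]; first exact: pol_const.
by apply: eq_pol (polM pf IH) => s; rewrite exprS.
Qed.

Lemma pol_sum I (r : seq I) (F : I -> S -> R) :
  (forall i, pol (F i)) -> pol (fun s => \sum_(i <- r) F i s).
Proof.
move=> pF; elim: r => [|i r IH]; first by apply: eq_pol (pol_const 0) => s; rewrite big_nil.
by apply: eq_pol (polD (pF i) IH) => s; rewrite big_cons.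
Qed.

Lemma pol_prod I (r : seq I) (F : I -> S -> R) :
  (forall i, pol (F i)) -> pol (fun s => \prod_(i <- r) F i s).
Proof.
move=> pF; elim: r => [|i r IH]; first by apply: eq_pol (pol_const 1) => s; rewrite big_nil.
by apply: eq_pol (polM (pF i) IH) => s; rewrite big_cons.
Qed.

Lemma pol_sat (N : nat) f : N%:R <> 0 :> R -> pol (fun s => N%:R * f s) -> pol f.
Proof.
move=> N0 [M [M0 af]]; exists (M * N)%N; split; first exact: natr_neq0M.
by apply: eq_alg af => s; rewrite natrM /=; ring.
Qed.

End OneSpace.

Lemma pol_comp (S S' : cspace) (phi : S -> S') (f : S' -> R) :
  polmap phi -> pol f -> pol (fun s => f (phi s)).
Proof.
move=> pphi [N [N0 af]]; apply: (pol_sat (f := fun s => f (phi s)) N0); move: af.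
suff : forall g, alg g -> pol (fun s => g (phi s)).
  by move=> H af; exact: (H _ af).
move=> g; elim=> [c|h k ch _ IH|h k _ IH1 _ IH2]; first exact: pol_const.
  by apply: polM IH; exact: pphi.
exact: polD.
Qed.

Definition cunit : cspace := @CSpace unit (fun=> False).
Definition cprod (S S' : cspace) : cspace :=
  @CSpace (S * S')%type (fun f =>
    (exists2 g, @is_coord S g & f = fun s => g s.1) \/
    (exists2 g, @is_coord S' g & f = fun s => g s.2)).
Definition cline : cspace := @CSpace R (fun f => f = id).

Lemma polmap_id (S : cspace) : polmap (fun s : S => s).
Proof. by move=> f cf; exact: pol_coord. Qed.

Lemma polmap_comp (S S' S'' : cspace) (psi : S' -> S'') (phi : S -> S') :
  polmap psi -> polmap phi -> polmap (fun s => psi (phi s)).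
Proof. by move=> ppsi pphi f cf; exact: (pol_comp pphi (ppsi _ cf)). Qed.

Lemma polmap_const (S S' : cspace) (x : S') : polmap (fun _ : S => x).
Proof. by move=> f cf; exact: pol_const. Qed.

Lemma polmap_pair (S A B : cspace) (phi : S -> A) (psi : S -> B) :
  polmap phi -> polmap psi -> polmap (S' := cprod A B) (fun s => (phi s, psi s)).
Proof. by move=> pphi ppsi _ [[g cg ->]|[g cg ->]]; [exact: pphi|exact: ppsi]. Qed.

Lemma polmap_fst (S A B : cspace) (phi : S -> cprod A B) :
  polmap phi -> polmap (S' := A) (fun s => (phi s).1).
Proof. by move=> pphi f cf; apply: (pphi (fun s => f s.1)); left; exists f. Qed.

Lemma polmap_snd (S A B : cspace) (phi : S -> cprod A B) :
  polmap phi -> polmap (S' := B) (fun s => (phi s).2).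
Proof. by move=> pphi f cf; apply: (pphi (fun s => f s.2)); right; exists f. Qed.

Lemma polmap_unit (S : cspace) (phi : S -> cunit) : polmap phi.
Proof. by []. Qed.

Lemma polmap_line (S : cspace) (f : S -> R) : pol f -> polmap (S' := cline) f.
Proof. by move=> pf _ ->. Qed.

Lemma pol_line (S : cspace) (f : S -> R) : polmap (S' := cline) f -> pol f.
Proof. by move=> /(_ id erefl). Qed.

(** Nested pairs rather than tuples: fixing the first entry of a cochain is application to [(e, t)],
    which drives the recursions on the degree. *)
Fixpoint cpw (S : cspace) (k : nat) : cspace :=
  if k is k'.+1 then cprod S (cpw S k') else cunit.

End Polynomial.

(** * Bar cochains on a polynomial monoid *)

Record pmon (b : base) := PMon {
  pm_space :> cspace b;
  pmul : pm_space -> pm_space -> pm_space;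
  pone : pm_space;
  pmulA : associative pmul;
  pmul1 : right_id pone pmul;
  p1mul : left_id pone pmul;
  pmul_polmap : polmap (S := cprod pm_space pm_space) (fun s => pmul s.1 s.2) }.

Lemma polmapM (b : base) (S : cspace b) (M : pmon b) (phi psi : S -> M) :
  polmap phi -> polmap psi -> polmap (S' := M) (fun s => pmul (phi s) (psi s)).
Proof.
move=> pphi ppsi; exact: (polmap_comp (@pmul_polmap b M) (polmap_pair pphi ppsi)).
Qed.

Ltac pm := repeat first
  [ exact: polmap_unit | exact: polmap_const | exact: polmap_id | apply: polmap_pair
  | apply: polmapM | apply: polmap_fst | apply: polmap_snd | assumption ].

Section Bar.
Context (b : base) (M : pmon b).
Local Notation R := (coef b).

(* The alternating sum of the faces d_1 - d_2 + ... other than d_0. *)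
Fixpoint inner k : (cpw M k -> R) -> cpw M k.+1 -> R :=
  match k return (cpw M k -> R) -> cpw M k.+1 -> R with
  | 0 => fun f s => f tt
  | k'.+1 => fun f s =>
      f (pmul s.1 s.2.1, s.2.2) - inner (fun t => f (s.1, t)) s.2
  end.

Lemma innerS k (f : cpw M k.+1 -> R) e e' s :
  inner f (e, (e', s)) = f (pmul e e', s) - inner (fun t => f (e, t)) (e', s).
Proof. by []. Qed.

Lemma inner_linear k c (f g : cpw M k -> R) s :
  inner (fun t => c * f t + g t) s = c * inner f s + inner g s.
Proof.
elim: k f g s => [|k IH] f g [e s] //=.
by rewrite (IH (fun t => f (e, t)) (fun t => g (e, t))); ring.
Qed.

Lemma innerB k (f g : cpw M k -> R) s :
  inner (fun t => f t - g t) s = inner f s - inner g s.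
Proof.
have -> : (fun t => f t - g t) = (fun t => (-1) * g t + f t).
  by apply: funext => t; ring.
by rewrite inner_linear; ring.
Qed.

Lemma innerD k (f g : cpw M k -> R) s :
  inner (fun t => f t + g t) s = inner f s + inner g s.
Proof.
have -> : (fun t => f t + g t) = (fun t => 1 * f t + g t).
  by apply: funext => t; ring.
by rewrite inner_linear; ring.
Qed.

Lemma inner0 k s : inner (fun _ : cpw M k => 0) s = 0.
Proof. by have := innerB (fun _ : cpw M k => 0) (fun=> 0) s; rewrite !subrr. Qed.

Lemma inner_sum k n (F : 'I_n -> cpw M k -> R) s :
  inner (fun t => \sum_(i < n) F i t) s = \sum_(i < n) inner (F i) s.
Proof.
elim: n F => [|n IH] F.
  by rewrite big_ord0 -[RHS](inner0 s); congr (inner _ s); apply: funext => t; rewrite big_ord0.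
rewrite big_ord_recl -IH -innerD; congr (inner _ s); apply: funext => t.
by rewrite big_ord_recl.
Qed.

(** By [innerS] this says that [inner] squares to zero: the faces other than d_0 form a differential
    by themselves. It packs all simplicial identities needed for d^2 = 0, whatever the
    coefficients. *)
Lemma inner_inner k (f : cpw M k -> R) e e' s :
  inner (fun t => inner f (e, t)) (e', s) = inner f (pmul e e', s).
Proof.
elim: k f e e' s => [|k IH] f e e' s //; case: s => e'' s.
rewrite !innerS pmulA.
rewrite (_ : (fun t => inner f (e, (e', t))) = fun t =>
    f (pmul e e', t) - inner (fun u => f (e, u)) (e', t)); last exact: funext.
by rewrite innerB IH; ring.
Qed.

Fixpoint nrm k : (cpw M k -> R) -> Prop :=
  match k return (cpw M k -> R) -> Prop with
  | 0 => fun=> True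
  | k'.+1 => fun f => (forall s, f (pone M, s) = 0) /\ forall e, nrm (fun s => f (e, s))
  end.

Lemma nrm_linear k c (f g : cpw M k -> R) :
  nrm f -> nrm g -> nrm (fun s => c * f s + g s).
Proof.
elim: k f g => [|k IH] f g //= [f1 nf] [g1 ng]; split=> [s|e].
  by rewrite f1 g1 mulr0 addr0.
exact: (IH (fun s => f (e, s)) (fun s => g (e, s)) (nf e) (ng e)).
Qed.

Lemma nrm0 k : nrm (fun _ : cpw M k => 0).
Proof. by elim: k => [|k IH] //=; split. Qed.

Lemma nrmD k (f g : cpw M k -> R) : nrm f -> nrm g -> nrm (fun s => f s + g s).
Proof.
move=> nf ng; have := nrm_linear 1 nf ng; congr (nrm _).
by apply: funext => s; rewrite mul1r.
Qed.

Lemma nrmZ k c (f : cpw M k -> R) : nrm f -> nrm (fun s => c * f s).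
Proof.
move=> nf; have := nrm_linear c nf (nrm0 k); congr (nrm _).
by apply: funext => s; rewrite addr0.
Qed.

Lemma nrmB k (f g : cpw M k -> R) : nrm f -> nrm g -> nrm (fun s => f s - g s).
Proof.
move=> nf ng; have := nrm_linear (-1) ng nf; congr (nrm _).
by apply: funext => s; ring.
Qed.

Lemma nrm_sum k I (r : seq I) (F : I -> cpw M k -> R) :
  (forall i, nrm (F i)) -> nrm (fun s => \sum_(i <- r) F i s).
Proof.
move=> nF; elim: r => [|i r IH].
  by have := nrm0 k; congr (nrm _); apply: funext => s; rewrite big_nil.
by have := nrmD (nF i) IH; congr (nrm _); apply: funext => s; rewrite big_cons.
Qed.

Lemma inner_one k (f : cpw M k.+1 -> R) s : nrm f -> inner f (pone M, s) = f s.
Proof.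
case: s => e s [f1 _]; rewrite innerS p1mul (_ : (fun _ => _) = fun=> 0) ?inner0 ?subr0 //.
by apply: funext => t; rewrite f1.
Qed.

(** The function is [bdiff f] with its first entry fixed. When a later entry is the unit, the two
    faces merging it with its neighbours cancel and the others vanish; fixing one more entry leaves
    a function of the same shape, which closes the induction. *)
Lemma nrm_inner k (f : cpw M k -> R) e : nrm f -> nrm (fun s => f s - inner f (e, s)).
Proof.
elim: k f e => [|k IH] f e; first by move=> _; exact: I.
move=> [f1 nf]; split=> [s|e'].
  rewrite f1 innerS pmul1; case: k {IH} f f1 nf s => [|k] f f1 nf s.
    by case: s; rewrite /= subrr subrr.
  by rewrite (inner_one _ (nf e)); ring.
have := nrmB (nf e') (nrmB (nf (pmul e e')) (nrmB (nf e) (IH _ e' (nf e)))).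
congr (nrm _); apply: funext => s /=; ring.
Qed.
End Bar.

Section Cochains.
Context (b : base) (M : pmon b).
Local Notation R := (coef b).

(** The parameter space [W] absorbs the first entry at each step of the recursion. *)
Lemma pol_inner k (W : cspace b) (f : W -> cpw M k -> R) :
  pol (S := cprod W (cpw M k)) (fun w => f w.1 w.2) ->
  pol (S := cprod W (cpw M k.+1)) (fun w => inner (f w.1) w.2).
Proof.
elim: k W f => [|k IH] W f pf.
  apply: (pol_comp (phi := fun w : cprod W (cpw M 1) => (w.1, tt) : cprod W (cpw M 0)) _ pf).
  by pm.
apply: polB.
  apply: (pol_comp (phi := fun w : cprod W (cpw M k.+2) =>
    (w.1, (pmul w.2.1 w.2.2.1, w.2.2.2)) : cprod W (cpw M k.+1)) _ pf).
  by pm.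
have pf' : pol (S := cprod (cprod W M) (cpw M k)) (fun w => f w.1.1 (w.1.2, w.2)).
  apply: (pol_comp (phi := fun w : cprod (cprod W M) (cpw M k) =>
    (w.1.1, (w.1.2, w.2)) : cprod W (cpw M k.+1)) _ pf).
  by pm.
refine (pol_comp (phi := fun w : cprod W (cpw M k.+2) =>
    ((w.1, w.2.1), w.2.2) : cprod (cprod W M) (cpw M k.+1)) _
    (IH (cprod W M) (fun w s => f w.1 (w.2, s)) pf')).
by pm.
Qed.

Definition bdiff k (f : cpw M k -> R) : cpw M k.+1 -> R := fun s => f s.2 - inner f s.

Definition npol k (f : cpw M k -> R) : Prop := pol f /\ nrm f.

(** The quotient C/P is never formed: its cocycles are cochains with [bdiff] in P, and [ncob] is
    being a coboundary modulo P. In degree 0 nothing bounds, which leaves membership in P. *)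
Definition ncob k : (cpw M k -> R) -> Prop :=
  match k return (cpw M k -> R) -> Prop with
  | 0 => @npol 0
  | k'.+1 => fun f => exists e : cpw M k' -> R, npol (fun s => f s - bdiff e s)
  end.

(* The quotient of the bar complex by the normalized polynomial cochains has no
   cohomology in degree k. *)
Definition acyc k : Prop := forall f : cpw M k -> R, npol (bdiff f) -> ncob f.

(** * Coefficients in functions on a right M-space *)

Section Action.
Context (V : cspace b) (act : V -> M -> V).
Hypothesis actA : forall x e e', act (act x e) e' = act x (pmul e e').
Hypothesis act1 : forall x, act x (pone M) = x.
Hypothesis act_polmap : polmap (S := cprod V M) (fun w => act w.1 w.2).

(** Only the face d_0 sees the action. The one-point space gives back [bdiff], so d^2 = 0 and the
    stability of P are proved once for both. *)
Definition cdiff k (c : V -> cpw M k -> R) : V -> cpw M k.+1 -> R :=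
  fun x s => c (act x s.1) s.2 - inner (c x) s.

Lemma cdiffB k (c d : V -> cpw M k -> R) x s :
  cdiff (fun x s => c x s - d x s) x s = cdiff c x s - cdiff d x s.
Proof. by rewrite /cdiff innerB; ring. Qed.

Lemma cdiffD k (c d : V -> cpw M k -> R) x s :
  cdiff (fun x s => c x s + d x s) x s = cdiff c x s + cdiff d x s.
Proof. by rewrite /cdiff innerD; ring. Qed.

Lemma dco_cdiff k (c : V -> cpw M k -> R) x s : cdiff (cdiff c) x s = 0.
Proof.
case: s => e [e' s]; rewrite /cdiff /= innerB.
have /= -> := inner_inner (c x) e e' s; rewrite actA.
by ring.
Qed.

Definition npolV k (c : V -> cpw M k -> R) : Prop :=
  pol (S := cprod V (cpw M k)) (fun w => c w.1 w.2) /\ forall x, nrm (c x).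

Definition ncobV k : (V -> cpw M k -> R) -> Prop :=
  match k return (V -> cpw M k -> R) -> Prop with
  | 0 => @npolV 0
  | k'.+1 => fun c => exists e : V -> cpw M k' -> R, npolV (fun x s => c x s - cdiff e x s)
  end.

Lemma npolV_cdiff k (c : V -> cpw M k -> R) : npolV c -> npolV (cdiff c).
Proof.
move=> [pc nc]; split.
  apply: polB; last exact: pol_inner.
  apply: (pol_comp (phi := fun w : cprod V (cpw M k.+1) =>
    (act w.1 w.2.1, w.2.2) : cprod V (cpw M k)) _ pc).
  apply: polmap_pair; last by pm.
  apply: (polmap_comp (phi := fun w : cprod V (cpw M k.+1) => (w.1, w.2.1) : cprod V M) act_polmap).
  by pm.
move=> x; split=> [s|e].
  rewrite /cdiff /= act1.
  case: k c {pc} nc s => [|k] c nc s; first by case: s; rewrite /= subrr.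
  by rewrite (inner_one _ (nc x)) subrr.
(* Adding and subtracting [c x s] separates the effect of the action from the constant-coefficient
   differential of [c x], which is [nrm_inner]. *)
have := nrmD (nrmB (nc (act x e)) (nc x)) (nrm_inner e (nc x)).
by congr (nrm _); apply: funext => s; rewrite /cdiff /=; ring.
Qed.

Lemma npolVD k (c d : V -> cpw M k -> R) :
  npolV c -> npolV d -> npolV (fun x s => c x s + d x s).
Proof. by move=> [pc nc] [pd nd]; split; [exact: polD|move=> x; exact: nrmD]. Qed.

Lemma npolVB k (c d : V -> cpw M k -> R) :
  npolV c -> npolV d -> npolV (fun x s => c x s - d x s).
Proof. by move=> [pc nc] [pd nd]; split; [exact: polB|move=> x; exact: nrmB]. Qed.

Lemma npolV0 k : npolV (fun (_ : V) (_ : cpw M k) => 0).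
Proof. by split; [exact: pol_const|move=> _; exact: nrm0]. Qed.

Lemma eq_npolV k (c d : V -> cpw M k -> R) :
  (forall x s, c x s = d x s) -> npolV c -> npolV d.
Proof. by move=> e; congr (npolV _); apply: funext => x; apply: funext => s. Qed.

End Action.

Lemma npolE k (f : cpw M k -> R) : npol f <-> npolV (V := cunit b) (fun=> f).
Proof.
split=> [[pf nf]|[pf nf]]; split=> //; last exact: nf tt.
  by apply: (pol_comp (phi := fun w : cprod (cunit b) (cpw M k) => w.2) _ pf); pm.
by apply: (pol_comp (phi := fun s : cpw M k => (tt, s) : cprod (cunit b) (cpw M k)) _ pf); pm.
Qed.

Lemma eq_npol k (f g : cpw M k -> R) : f =1 g -> npol f -> npol g.
Proof. by move=> /funext ->. Qed.

Lemma npolD k (f g : cpw M k -> R) : npol f -> npol g -> npol (fun s => f s + g s).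
Proof. by move=> [pf nf] [pg ng]; split; [exact: polD|exact: nrmD]. Qed.

Lemma npolB k (f g : cpw M k -> R) : npol f -> npol g -> npol (fun s => f s - g s).
Proof. by move=> [pf nf] [pg ng]; split; [exact: polB|exact: nrmB]. Qed.

Lemma npol0 k : npol (fun _ : cpw M k => 0).
Proof. by split; [exact: pol_const|exact: nrm0]. Qed.

Lemma npolZ k a (f : cpw M k -> R) : npol f -> npol (fun s => a * f s).
Proof.
by move=> [pf nf]; split; [apply: polM pf; exact: pol_const|exact: nrmZ].
Qed.

Lemma npol_sum k I (r : seq I) (F : I -> cpw M k -> R) :
  (forall i, npol (F i)) -> npol (fun s => \sum_(i <- r) F i s).
Proof.
move=> nF; split; first by apply: pol_sum => i; have [] := nF i.
by apply: nrm_sum => i; have [] := nF i.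
Qed.

Let tact (x : cunit b) (e : M) := tt.

Lemma npol_bdiff k (f : cpw M k -> R) : npol f -> npol (bdiff f).
Proof. by rewrite !npolE; apply: (@npolV_cdiff _ tact) => // -[]. Qed.

Lemma dlt_bdiff k (f : cpw M k -> R) s : bdiff (bdiff f) s = 0.
Proof. exact: (@dco_cdiff (cunit b) tact (fun _ _ _ => erefl) k (fun=> f) tt s). Qed.

Lemma bdiffD k (f g : cpw M k -> R) s : bdiff (fun t => f t + g t) s = bdiff f s + bdiff g s.
Proof. by rewrite /bdiff innerD; ring. Qed.

Lemma bdiffB k (f g : cpw M k -> R) s : bdiff (fun t => f t - g t) s = bdiff f s - bdiff g s.
Proof. by rewrite /bdiff innerB; ring. Qed.

Lemma bdiff0 k s : bdiff (fun _ : cpw M k => 0) s = 0.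
Proof. by rewrite /bdiff inner0 subr0. Qed.

Lemma bdiff_sum k n (F : 'I_n -> cpw M k -> R) s :
  bdiff (fun t => \sum_(i < n) F i t) s = \sum_(i < n) bdiff (F i) s.
Proof. by rewrite /bdiff inner_sum sumrB. Qed.

Lemma bdiffZ k a (f : cpw M k -> R) s : bdiff (fun t => a * f t) s = a * bdiff f s.
Proof.
rewrite /bdiff (_ : (fun t => a * f t) = fun t => a * f t + 0).
  by rewrite inner_linear inner0; ring.
by apply: funext => t; rewrite addr0.
Qed.

Lemma npol_ncob k (f : cpw M k -> R) : npol f -> ncob f.
Proof.
case: k f => [|k] f nf //; exists (fun=> 0).
by apply: eq_npol nf => s; rewrite bdiff0 subr0.
Qed.

Lemma eq_ncob k (f g : cpw M k -> R) : f =1 g -> ncob f -> ncob g.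
Proof. by move=> /funext ->. Qed.

Lemma ncobD k (f g : cpw M k -> R) : ncob f -> ncob g -> ncob (fun s => f s + g s).
Proof.
case: k f g => [|k] f g; first exact: npolD.
move=> [e ne] [e' ne']; exists (fun s => e s + e' s).
by apply: eq_npol (npolD ne ne') => s; rewrite bdiffD; ring.
Qed.

Lemma ncob_npol_bdiff k (f : cpw M k -> R) : ncob f -> npol (bdiff f).
Proof.
case: k f => [|k] f; first exact: npol_bdiff.
move=> [e /npol_bdiff]; apply: eq_npol => s.
by rewrite bdiffB dlt_bdiff subr0.
Qed.

End Cochains.

Section Functoriality.
Context (b : base) (M M' : pmon b) (phi : M -> M').
Local Notation R := (coef b).

Fixpoint pwmap k : cpw M k -> cpw M' k :=
  match k return cpw M k -> cpw M' k with
  | 0 => fun=> tt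
  | k'.+1 => fun s => (phi s.1, pwmap s.2)
  end.

Lemma pwmap_polmap k : polmap phi -> polmap (@pwmap k).
Proof.
move=> pphi; elim: k => [|k IH]; first by pm.
apply: polmap_pair; first by apply: (polmap_comp pphi); pm.
by apply: (polmap_comp IH); pm.
Qed.

Lemma nrm_pwmap k (f : cpw M' k -> R) :
  phi (pone M) = pone M' -> nrm f -> nrm (fun s => f (pwmap s)).
Proof.
move=> phi1; elim: k f => [|k IH] f //= [f1 nf]; split=> [s|e].
  by rewrite phi1.
exact: (IH (fun s => f (phi e, s))).
Qed.

Lemma npol_pwmap k (f : cpw M' k -> R) :
  polmap phi -> phi (pone M) = pone M' -> npol f -> npol (fun s => f (pwmap s)).
Proof.
move=> pphi phi1 [pf nf]; split; last exact: nrm_pwmap.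
exact: (pol_comp (pwmap_polmap pphi)).
Qed.

Hypothesis phiM : forall e e', phi (pmul e e') = pmul (phi e) (phi e').

Lemma inner_pwmap k (f : cpw M' k -> R) s :
  inner (fun t => f (pwmap t)) s = inner f (pwmap s).
Proof.
elim: k f s => [|k IH] f s //; case: s => e [e' s].
rewrite [LHS]innerS [RHS]innerS /= phiM; congr (_ - _).
exact: (IH (fun t => f (phi e, t))).
Qed.

Lemma bdiff_pwmap k (f : cpw M' k -> R) s :
  bdiff (fun t => f (pwmap t)) s = bdiff f (pwmap s).
Proof. by rewrite /bdiff inner_pwmap. Qed.

Lemma ncob_pwmap k (f : cpw M' k -> R) :
  polmap phi -> phi (pone M) = pone M' -> ncob f -> ncob (fun s => f (pwmap s)).
Proof.
move=> pphi phi1; case: k f => [|k] f; first exact: npol_pwmap.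
move=> [e ne]; exists (fun s => e (pwmap s)).
have := npol_pwmap pphi phi1 ne; apply: eq_npol => s.
by rewrite (bdiff_pwmap e).
Qed.

End Functoriality.

Lemma pwmap_comp (b : base) (M M' M'' : pmon b) (phi : M -> M') (psi : M' -> M'') k (s : cpw M k) :
  pwmap psi (pwmap phi s) = pwmap (fun e => psi (phi e)) s.
Proof. by elim: k s => [|k IH] s //=; rewrite IH. Qed.

Lemma eq_pwmap (b : base) (M M' : pmon b) (phi psi : M -> M') k (s : cpw M k) :
  phi =1 psi -> pwmap phi s = pwmap psi s.
Proof. by move=> /funext ->. Qed.

Lemma pwmap_id (b : base) (M : pmon b) k (s : cpw M k) : pwmap (fun e : M => e) s = s.
Proof. by elim: k s => [[]|k IH [e s]] //=; rewrite IH. Qed.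

(** * Cochains with coefficients in functions on the line *)

Section Products.
Context (b : base).
Local Notation R := (coef b).

Lemma polmap_add (S : cspace b) (f g : S -> cline b) :
  polmap f -> polmap g -> polmap (S' := cline b) (fun s => f s + g s : R).
Proof.
by move=> pf pg; apply: polmap_line; apply: polD; exact: pol_line.
Qed.

Lemma pline_polmap :
  polmap (S := cprod (cline b) (cline b)) (S' := cline b) (fun s => s.1 + s.2 : R).
Proof. by apply: polmap_add; pm. Qed.

Definition pline : pmon b :=
  @PMon b (cline b) (fun x y : R => x + y) (0 : R) (@addrA R) (@addr0 R) (@add0r R)
    pline_polmap.

Section Prod.
Variables M N : pmon b.

Let pm_mul (s t : cprod M N) : cprod M N := (pmul s.1 t.1, pmul s.2 t.2).

Lemma pprodA : associative pm_mul.
Proof. by move=> s t u; rewrite /pm_mul /= !pmulA. Qed.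
Lemma pprod1 : right_id ((pone M, pone N) : cprod M N) pm_mul.
Proof. by move=> [s t]; rewrite /pm_mul /= !pmul1. Qed.
Lemma p1prod : left_id ((pone M, pone N) : cprod M N) pm_mul.
Proof. by move=> [s t]; rewrite /pm_mul /= !p1mul. Qed.
Lemma pprod_polmap : polmap (S := cprod (cprod M N) (cprod M N)) (fun s => pm_mul s.1 s.2).
Proof. by pm. Qed.

Definition pprod : pmon b := PMon pprodA pprod1 p1prod pprod_polmap.
End Prod.
End Products.

Section Shapiro.
Context (b : base) (H : pmon b).
Local Notation R := (coef b).
Local Notation M := (pprod (pline b) H).

Definition lact (x : cline b) (e : M) : cline b := (x + e.1 : R).

Lemma lactA x e e' : lact (lact x e) e' = lact x (pmul e e').
Proof. by rewrite /lact /= -addrA. Qed.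
Lemma lact1 x : lact x (pone M) = x.
Proof. exact: addr0. Qed.
Lemma lact_polmap : polmap (S := cprod (cline b) M) (fun w => lact w.1 w.2).
Proof. by apply: polmap_add; pm. Qed.

Definition inH (h : H) : M := ((0 : R), h).
Definition outH (e : M) : H := e.2.
Definition lineH (x : R) : M := (x, pone H).

Lemma inHM h h' : inH (pmul h h') = pmul (inH h) (inH h').
Proof. by rewrite /inH /= addr0. Qed.

(* The prism operator of the homotopy from (x; e_1, ..., e_k) to
   (0; h_1, ..., h_k), where e_i = (r_i, h_i). *)
Fixpoint prism k : (cpw M k.+1 -> R) -> R -> cpw M k -> R :=
  match k return (cpw M k.+1 -> R) -> R -> cpw M k -> R with
  | 0 => fun f x s => f (lineH x, s)
  | k'.+1 => fun f x s => f (lineH x, s)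
      - prism (fun t => f (inH (outH s.1), t)) (x + s.1.1 : R) s.2
  end.

Lemma prismS k (f : cpw M k.+2 -> R) x e s :
  prism f x ((e, s) : cpw M k.+1) = f (lineH x, (e, s))
      - prism (fun t => f (inH (outH e), t)) (x + e.1 : R) s.
Proof. by []. Qed.

Lemma prismB k (f g : cpw M k.+1 -> R) x s :
  prism (fun t => f t - g t) x s = prism f x s - prism g x s.
Proof.
elim: k f g x s => [|k IH] f g x s //; case: s => e s.
rewrite !prismS (IH (fun t => f (inH (outH e), t)) (fun t => g (inH (outH e), t))).
ring.
Qed.

Lemma prism0 k x s : prism (fun _ : cpw M k.+1 => 0) x s = 0.
Proof. by have := prismB (fun _ : cpw M k.+1 => 0) (fun=> 0) x s; rewrite !subrr. Qed.

Lemma prism_inner k (g : cpw M k.+1 -> R) x (s : cpw M k.+1) :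
  prism (inner g) x s + inner (prism g x) s = g (pwmap (fun e => inH (outH e)) s).
Proof.
(* The commuting square (y, 1)(r, h) = (0, h)(y + r, 1), along which neighbouring prisms share a
   face. *)
have mE (e : M) y : pmul (lineH y) e = pmul (inH (outH e)) (lineH (y + e.1)).
  by case: e => r h; rewrite /inH /outH /lineH /= add0r pmul1 p1mul.
elim: k g x s => [|k IH] g x [e s].
  case: s; rewrite prismS.
  have -> : inner g (lineH x, (e, tt)) = g (pmul (lineH x) e, tt) - g (lineH x, tt) by [].
  have -> : inner (prism g x) (e, tt) = g (lineH x, tt) by [].
  rewrite mE -[prism _ _ _]/(g (pmul (inH (outH e)) (lineH (x + e.1)), tt) - g (inH (outH e), tt)).
  rewrite -[g (pwmap _ _)]/(g (inH (outH e), tt)); ring.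
case: s => e' s; rewrite prismS innerS [inner (prism g x) _]innerS.
set x' := x + e.1.
have -> : prism (fun t : cpw M k.+2 => inner g (inH (outH e), t)) x' (e', s) =
    prism (fun t : cpw M k.+2 => g (pmul (inH (outH e)) t.1, t.2)) x' (e', s)
    - prism (inner (fun t : cpw M k.+1 => g (inH (outH e), t))) x' (e', s).
  by rewrite -prismB.
rewrite (_ : (fun t => prism g x (e, t)) = fun t =>
  g (lineH x, (e, t)) - prism (fun u => g (inH (outH e), u)) x' t) //.
rewrite innerB.
have := IH (fun u => g (inH (outH e), u)) x' (e', s).
set I1 := inner (prism _ _) _; set I2 := prism (inner _) _ _ => E.
have {E} -> : I2 = g (inH (outH e), pwmap (fun e => inH (outH e)) ((e', s) : cpw M k.+1)) - I1.
  by rewrite -E addrK.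
rewrite !prismS innerS.
have -> : pmul (inH (outH e)) (lineH x', (e', s)).1 =
  pmul (lineH x) e by rewrite mE.
have -> : inH (outH (pmul e e')) = pmul (inH (outH e)) (inH (outH e')).
  by rewrite -inHM.
have -> : x + (pmul e e').1 = x' + e'.1 by rewrite /x' -addrA.
rewrite /=; ring.
Qed.

(** The entry [lineH x] of the prism moves 0 to x, so the face d_0 of [cdiff u 0] recovers [u x s].
    The action of the entries [inH] fixes 0, so the remaining d_0 terms cancel against that of
    [cdiff (prism (u 0))]; the inner faces are [prism_inner]. *)
Lemma prism_cdiff k (u : cline b -> cpw M k.+1 -> R) x s :
  u x s = prism (cdiff lact u 0) x s + cdiff lact (prism (u 0)) x s
          + u 0 (pwmap (fun e => inH (outH e)) s).
Proof.
rewrite -(prism_inner (u 0) x s) /cdiff prismB.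
case: s => e s; rewrite prismS.
have -> : (fun t => u (lact 0 (inH (outH e), t).1) (inH (outH e), t).2) = u 0.
  by rewrite /lact /= addr0.
rewrite /lact [(lineH x, _).1]/= [(lineH x, _).2]/= [(lineH x).1]/= add0r.
rewrite [(e, s).1]/= [(e, s).2]/=; ring.
Qed.

Lemma pol_prism k (W : cspace b) (f : W -> cpw M k.+1 -> R) :
  pol (S := cprod W (cpw M k.+1)) (fun w => f w.1 w.2) ->
  pol (S := cprod (cprod W (cline b)) (cpw M k)) (fun w => prism (f w.1.1) w.1.2 w.2).
Proof.
elim: k W f => [|k IH] W f pf.
  apply: (pol_comp (phi := fun w : cprod (cprod W (cline b)) (cpw M 0) =>
    (w.1.1, (lineH w.1.2, w.2)) : cprod W (cpw M 1)) _ pf).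
  by pm.
apply: polB.
  apply: (pol_comp (phi := fun w : cprod (cprod W (cline b)) (cpw M k.+1) =>
    (w.1.1, (lineH w.1.2, w.2)) : cprod W (cpw M k.+2)) _ pf).
  by pm.
have pf' : pol (S := cprod (cprod W H) (cpw M k.+1)) (fun w => f w.1.1 (inH w.1.2, w.2)).
  apply: (pol_comp (phi := fun w : cprod (cprod W H) (cpw M k.+1) =>
    (w.1.1, (inH w.1.2, w.2)) : cprod W (cpw M k.+2)) _ pf).
  by pm.
refine (pol_comp (phi := fun w : cprod (cprod W (cline b)) (cpw M k.+1) =>
    (((w.1.1, w.2.1.2), (w.1.2 + w.2.1.1 : R)), w.2.2) : cprod (cprod (cprod W H) (cline b)) (cpw M k)) _
    (IH (cprod W H) (fun w s => f w.1 (inH w.2, s)) pf')).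
pm.
by apply: polmap_add; pm.
Qed.

Lemma nrm_prism k (f : cpw M k.+1 -> R) x : nrm f -> nrm (prism f x).
Proof.
elim: k f x => [|k IH] f x nf; first exact: I.
have [f1 nf'] := nf; split=> [s|e].
  rewrite prismS (nf' _).1 /inH /outH (_ : (fun _ => _) = fun=> 0) ?prism0 ?subr0 //.
  by apply: funext => t; exact: f1.
exact: nrmB ((nf' (lineH x)).2 e) (IH (fun t => f (inH (outH e), t)) (x + e.1) (nf' _)).
Qed.

Lemma npolV_prism k (u : cline b -> cpw M k.+1 -> R) :
  npolV u -> npolV (prism (u 0) : cline b -> cpw M k -> R).
Proof.
move=> [pu nu]; split; last by move=> x; exact: nrm_prism.
have pu0 : pol (S := cprod (cunit b) (cpw M k.+1)) (fun w => u 0 w.2).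
  apply: (pol_comp (phi := fun w : cprod (cunit b) (cpw M k.+1) =>
    ((0 : cline b), w.2) : cprod (cline b) (cpw M k.+1)) _ pu).
  by pm.
refine (pol_comp (phi := fun w : cprod (cline b) (cpw M k) =>
    ((tt, w.1), w.2) : cprod (cprod (cunit b) (cline b)) (cpw M k)) _
    (pol_prism (f := fun=> u 0) pu0)).
by pm.
Qed.

Lemma npolV_const (V : cspace b) (N : pmon b) k (f : cpw N k -> R) :
  npol f -> npolV (fun _ : V => f).
Proof.
move=> [pf nf]; split=> //.
by apply: (pol_comp (phi := fun w : cprod V (cpw N k) => w.2) _ pf); pm.
Qed.

Lemma outH_polmap : polmap (S := M) outH.
Proof. by rewrite /outH; pm. Qed.
Lemma inH_polmap : polmap (S' := M) inH.
Proof. by rewrite /inH; pm. Qed.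

(** In positive degree, the three terms of [prism_cdiff] are respectively in P, a coboundary, and
    pulled back from [H], where the hypothesis applies. In degree 0 the difference between [u x] and
    [u 0] is itself a prism of [cdiff u 0]. *)
Lemma shapiro k (u : cline b -> cpw M k -> R) :
  npolV (cdiff lact u) -> ncob (fun s : cpw H k => u 0 (pwmap inH s)) -> ncobV lact u.
Proof.
move=> ndu; have nK := npolV_prism ndu.
have nout n (f : cpw H n -> R) : npol f -> npolV (fun (_ : cline b) (s : cpw M n) => f (pwmap outH s)).
  move=> nf; apply: npolV_const; apply: npol_pwmap nf => //; exact: outH_polmap.
case: k u ndu nK => [|k] u ndu nK.
  move=> nv; apply: eq_npolV (npolVD nK (nout _ _ nv)) => x [] /=.
  by rewrite /cdiff /= /lact add0r subrK.
move=> [e ne]; exists (fun x s => prism (u 0) x s + e (pwmap outH s)).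
apply: eq_npolV (npolVD nK (nout _ _ ne)) => x s.
rewrite cdiffD [in RHS]prism_cdiff (pwmap_comp outH inH) -(bdiff_pwmap (phi := outH)) //.
have -> : cdiff lact (fun=> fun t => e (pwmap outH t)) x s = bdiff (fun t => e (pwmap outH t)) s by [].
ring.
Qed.

End Shapiro.

(** * Dimension shifting along the line *)

Section Descent.
Context (b : base) (H : pmon b).
Local Notation R := (coef b).
Local Notation M := (pprod (pline b) H).

(* An abstract exact sequence 0 -> R -> Fun(R) -> Fun(R) -N-> R, whose middle map
   is the forward difference, with indefinite summation S and a section d of N
   (N is 0 for R = Z, and the sum over all points for R = F_p). *)
Variables (S : (R -> R) -> R -> R) (N : (R -> R) -> R) (d : R -> R).
Hypothesis S_diff : forall g x, N g = 0 -> S g (x + 1) - S g x = g x.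
Hypothesis S0 : forall x, S (fun=> 0) x = 0.
Hypothesis pol_S : forall (W : cspace b) (f : R -> W -> R),
  pol (S := cprod (cline b) W) (fun w => f w.1 w.2) ->
  pol (S := cprod (cline b) W) (fun w => S (f ^~ w.2) w.1).
Hypothesis N_linear : forall a f g, N (fun x => a * f x + g x) = a * N f + N g.
Hypothesis N_shift : forall f a, N (fun x => f (x + a)) = N f.
Hypothesis pol_N : forall (W : cspace b) (f : R -> W -> R),
  pol (S := cprod (cline b) W) (fun w => f w.1 w.2) -> pol (fun w : W => N (f ^~ w)).
Hypothesis pol_d : pol (S := cline b) d.
Hypothesis Nd : (forall g, N g = 0) \/ (forall c, N (fun x => c * d x) = c).
Hypothesis periodic : forall g : R -> R, (forall x, g (x + 1) = g x) -> forall x, g x = g 0.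

Lemma N0 : N (fun=> 0) = 0.
Proof.
have := N_linear (-1) (fun=> 0) (fun=> 0).
rewrite (_ : (fun _ : R => -1 * 0 + 0) = fun=> 0) ?mulN1r ?addNr //.
Qed.

Lemma NB f g : N (fun x => f x - g x) = N f - N g.
Proof.
rewrite (_ : (fun _ => _) = fun x => -1 * g x + f x) ?N_linear; first by ring.
by apply: funext => x; ring.
Qed.

Lemma N_inner k (c : R -> cpw M k -> R) s :
  inner (fun t => N (c ^~ t)) s = N (fun x => inner (c x) s).
Proof.
elim: k c s => [|k IH] c s //; case: s => e [e' s].
by rewrite innerS (IH (fun x t => c x (e, t))) -NB.
Qed.

Lemma bdiff_N k (c : cline b -> cpw M k -> R) s :
  bdiff (fun t => N (c ^~ t)) s = N (fun x => cdiff (@lact b H) c x s).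
Proof. by rewrite /bdiff N_inner /cdiff NB /lact (N_shift (c ^~ s.2)). Qed.

Lemma nrm_N k (c : R -> cpw M k -> R) :
  (forall x, nrm (c x)) -> nrm (fun t => N (c ^~ t)).
Proof.
elim: k c => [|k IH] c nc; first exact: I.
split=> [s|e]; last by apply: (IH (fun x s => c x (e, s))) => x; exact: (nc x).2.
by rewrite -[RHS]N0; congr N; apply: funext => x; exact: (nc x).1.
Qed.

Lemma npol_N k (c : cline b -> cpw M k -> R) : npolV c -> npol (fun t => N (c ^~ t)).
Proof. by move=> [pc nc]; split; [exact: pol_N|exact: nrm_N]. Qed.

Lemma npolV_S k (c : cline b -> cpw M k -> R) :
  npolV c -> npolV ((fun x t => S (c ^~ t) x) : cline b -> cpw M k -> R).
Proof.
move=> [pc nc]; split; first exact: pol_S.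
move=> x; elim: k c {pc} nc => [|k IH] c nc; first exact: I.
split=> [s|e]; last by apply: (IH (fun x s => c x (e, s))) => y; exact: (nc y).2.
by rewrite -[RHS](S0 x); congr S; apply: funext => y; exact: (nc y).1.
Qed.

Definition fdiff k (c : cline b -> cpw M k -> R) : cline b -> cpw M k -> R :=
  fun x s => c (x + 1 : R) s - c x s.

Lemma cdiff_fdiff k (c : cline b -> cpw M k -> R) x s :
  cdiff (@lact b H) (fdiff c) x s = fdiff (cdiff (@lact b H) c) x s.
Proof. by rewrite /fdiff cdiffB /cdiff /lact -!addrA (addrC 1). Qed.

Lemma N_fdiff k (c : cline b -> cpw M k -> R) s : N (fun x => fdiff c x s) = 0.
Proof. by rewrite NB (N_shift (c ^~ s)) subrr. Qed.

Lemma fdiff_S k (c : cline b -> cpw M k -> R) x s :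
  N (c ^~ s) = 0 -> fdiff (fun x t => S (c ^~ t) x) x s = c x s.
Proof. by move=> Nc; rewrite /fdiff S_diff. Qed.

Lemma fdiff_eq0 k (c : cline b -> cpw M k -> R) :
  (forall x s, fdiff c x s = 0) -> forall x s, c x s = c 0 s.
Proof.
by move=> c0 x s; apply: (periodic (g := c ^~ s)) => y; apply/eqP; rewrite -subr_eq0; exact/eqP/(c0 y s).
Qed.

Lemma npolV_d k (p : cpw M k -> R) :
  npol p -> npolV ((fun x t => p t * d x) : cline b -> cpw M k -> R).
Proof.
move=> [pp np]; split.
  apply: polM.
    by apply: (pol_comp (phi := fun w : cprod (cline b) (cpw M k) => w.2) _ pp); pm.
  by apply: (pol_comp (phi := fun w : cprod (cline b) (cpw M k) => w.1) _ pol_d); pm.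
move=> x; have := nrmZ (d x) np; congr (nrm _).
by apply: funext => t; rewrite mulrC.
Qed.

(** In positive degree write [fdiff u] = dw + p with p in P. If w were [fdiff W], the forward
    difference of u - dW would be in P, and u - dW would be in P up to a function of s alone. The
    obstruction to summing w is N w, a cocycle modulo P in a lower degree, which acyclicity of [M]
    removes. *)
Lemma fdiff_descent k (u : cline b -> cpw M k -> R) :
  (forall j, (j < k)%N -> acyc M j) -> ncobV (@lact b H) (fdiff u) ->
  exists u' : cpw M k -> R, ncobV (@lact b H) (fun x s => u x s - u' s).
Proof.
case: k u => [|k] u acM.
  (* In degree 0 the forward difference is itself in P, and so is its indefinite sum. *)
  move=> npu; pose q x s := S ((fdiff u) ^~ s) x.
  have nq : npolV (q : cline b -> cpw M 0 -> R) by exact: npolV_S npu.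
  exists (fun s => u 0 s - q 0 s); apply: eq_npolV nq => x s.
  have E := @fdiff_eq0 _ (fun x s => u x s - q x s) _ x s.
  rewrite -E => [|y t]; first by ring.
  have := @fdiff_S _ (fdiff u) y t (N_fdiff _ _); rewrite -/q /fdiff /q => e.
  rewrite [X in X = _](_ : _ = (u (y + 1) t - u y t)
    - (S (fun x0 => u (x0 + 1) t - u x0 t) (y + 1) - S (fun x0 => u (x0 + 1) t - u x0 t) y)); last by ring.
  by rewrite e subrr.
move=> [w nw].
pose p x s := fdiff u x s - cdiff (@lact b H) w x s.
have dNw s : bdiff (fun t => N (w ^~ t)) s = - N (p ^~ s).
  by rewrite bdiff_N /p (NB (fdiff u ^~ s) (cdiff (@lact b H) w ^~ s)) N_fdiff sub0r opprK.
(* When N is nonzero and N w = dv + r with r in P, take w' = d(v . [d]) and q = r . [d], where [d]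
   is the section of N: then N (w' + q) = N w, w' is closed and q is in P. If N w has degree 0,
   there is no v, and w' = 0. *)
have [w' [q [nq Nw']]] : exists w' q : cline b -> cpw M k -> R, npolV q /\
    (forall s, N (fun x => w x s - q x s - w' x s) = 0) /\
    (forall x s, cdiff (@lact b H) w' x s = 0).
  case: Nd => [N00|Nd1].
    exists (fun _ _ => 0), (fun _ _ => 0); split; first exact: npolV0.
    by split=> // x s; rewrite /cdiff inner0 subrr.
  have ac : ncob (fun t => N (w ^~ t)).
    apply: (acM k (leqnn _)); apply: eq_npol (npolB (@npol0 _ _ _) (npol_N nw)) => s.
    by rewrite dNw sub0r.
  case: k u acM w nw p dNw ac => [|k] u acM w nw p dNw ac.
    exists (fun _ _ => 0), (fun x s => N (w ^~ s) * d x); split; first exact: npolV_d.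
    split=> [s|x s]; last by rewrite /cdiff inner0 subrr.
    by rewrite (NB (fun x => w x s - N (w ^~ s) * d x) (fun=> 0)) N0 (NB (w ^~ s)) Nd1 subrr subrr.
  have [v nv] := ac.
  exists (cdiff (@lact b H) (fun x s => v s * d x)).
  exists (fun x s => (N (w ^~ s) - bdiff v s) * d x); split; first exact: npolV_d nv.
  split=> [s|x s]; last by rewrite dco_cdiff //; exact: lactA.
  rewrite (NB (fun x => w x s - (N (w ^~ s) - bdiff v s) * d x) (cdiff (@lact b H) (fun x s => v s * d x) ^~ s)).
  rewrite (NB (w ^~ s) (fun x => (N (w ^~ s) - bdiff v s) * d x)) Nd1 -bdiff_N.
  have -> : (fun t => N (fun x => v t * d x)) = v by apply: funext => t; rewrite Nd1.
  by ring.
case: Nw' => Nw1 dw'.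
pose w1 x s := w x s - q x s - w' x s.
pose W x s := S (w1 ^~ s) x.
have fW x s : fdiff W x s = w1 x s by apply: fdiff_S; exact: Nw1.
pose v x s := u x s - cdiff (@lact b H) W x s.
have fv x s : fdiff v x s = p x s + cdiff (@lact b H) q x s.
  have -> : fdiff v x s = fdiff u x s - fdiff (cdiff (@lact b H) W) x s.
    by rewrite /fdiff /v; ring.
  rewrite -cdiff_fdiff (_ : fdiff W = w1); last first.
    by apply: funext => y; apply: funext => t.
  by rewrite /w1 !cdiffB dw' /p; ring.
have nfv : npolV (fdiff v).
  apply: eq_npolV (npolVD nw (npolV_cdiff (@lact1 b H) (@lact_polmap b H) nq)) => x s.
  by rewrite fv.
pose Q x s := S (fdiff v ^~ s) x.
have nQ : npolV (Q : cline b -> cpw M k.+1 -> R) by exact: npolV_S.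
(* v - Q has zero forward difference, hence equals its value at 0; so u - u' = dW + Q. *)
exists (fun s => v 0 s - Q 0 s), W; apply: eq_npolV nQ => x s.
have E := @fdiff_eq0 _ (fun x s => v x s - Q x s) _ x s.
rewrite -E => [|y t]; first by rewrite /v; ring.
have := @fdiff_S _ (fdiff v) y t (N_fdiff _ _); rewrite -/Q => e.
have -> : fdiff (fun x s => v x s - Q x s) y t = fdiff v y t - fdiff Q y t.
  by rewrite /fdiff; ring.
by rewrite -e /Q subrr.
Qed.

End Descent.

(** * Indefinite summation over Z *)

Section IntegerSums.
Local Notation bZ := BaseZ.

Definition sumz (g : int -> int) (x : int) : int :=
  match x with
  | Posz n => \sum_(m < n) g m%:Z
  | Negz n => - \sum_(m < n.+1) g (- m.+1%:Z)
  end.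

Lemma sumz_diff g x : sumz g (x + 1) - sumz g x = g x.
Proof.
case: x => n.
  rewrite [n%:Z + 1](_ : _ = n.+1%:Z); last by rewrite -addn1 PoszD.
  by rewrite /= big_ord_recr /= addrAC subrr add0r.
case: n => [|n].
  rewrite [Negz 0 + 1](_ : _ = 0%:Z) // /= big_ord0 big_ord_recr big_ord0 /=.
  by rewrite sub0r opprK add0r.
rewrite [Negz n.+1 + 1](_ : _ = Negz n); last by rewrite !NegzE; ring.
rewrite /= [X in - - X]big_ord_recr /= !NegzE.
set A := \sum_(_ < _) _; ring.
Qed.

Lemma sumz0 x : sumz (fun=> 0) x = 0.
Proof. by case: x => n /=; rewrite big1_eq ?oppr0. Qed.

Lemma int_periodic (g : int -> int) : (forall x, g (x + 1) = g x) -> forall x, g x = g 0.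
Proof.
move=> gP; elim/int_rec => [|n IH|n IH] //.
  by rewrite -IH -[RHS]gP -addn1 PoszD.
by rewrite -IH -[LHS]gP; congr g; rewrite -addn1 PoszD; ring.
Qed.

Lemma sumz_uniq (F g : int -> int) :
  (forall x, F (x + 1) - F x = g x) -> forall x, F x - F 0 = sumz g x.
Proof.
move=> Fg x; have := @int_periodic (fun x => F x - sumz g x) _ x.
rewrite /= big_ord0 subr0 => <-; first by ring.
move=> y; apply/eqP; rewrite -subr_eq0; apply/eqP.
transitivity ((F (y + 1) - F y) - (sumz g (y + 1) - sumz g y)); first by ring.
by rewrite Fg sumz_diff subrr.
Qed.

(** The binomial coefficient x over k as an iterated indefinite sum of 1, which is integral at every
    x without any division. *)
Fixpoint binz k : int -> int := if k is k'.+1 then sumz (binz k') else fun=> 1.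

Lemma binz_diff k x : binz k.+1 (x + 1) - binz k.+1 x = binz k x.
Proof. exact: sumz_diff. Qed.

Lemma binz_at0 k : binz k.+1 0 = 0.
Proof. by rewrite /= big_ord0. Qed.

Lemma binzS k x : k.+1%:R * binz k.+1 x = (x - k%:R) * binz k x.
Proof.
elim: k x => [|k IH] x.
  rewrite mulr1 mul1r subr0 -[binz 1 x]/(sumz (fun=> 1) x) -(sumz_uniq (F := id)) ?subr0 // => y.
  by rewrite addrAC subrr add0r.
pose g x := k.+2%:R * binz k.+2 x - (x - k.+1%:R) * binz k.+1 x.
apply/eqP; rewrite -subr_eq0 -/(g x) (@int_periodic g) => [|y].
  by rewrite /g !binz_at0 !mulr0 subrr.
rewrite /g.
have := binz_diff k.+1 y; have := binz_diff k y; have := IH y.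
rewrite -!natr1.
set a := binz k.+2 (y + 1); set a' := binz k.+2 y; set c := binz k.+1 (y + 1); set c' := binz k.+1 y; set e := binz k y.
move=> E0 /eqP; rewrite subr_eq => /eqP E1 /eqP; rewrite subr_eq => /eqP E2.
rewrite E2 E1; apply/eqP; rewrite -subr_eq0; apply/eqP.
transitivity ((k%:R + 1) * c' - (y - k%:R) * e); first by ring.
by rewrite E0 subrr.
Qed.

Lemma pol_binz k : pol (S := cline bZ) (binz k).
Proof.
elim: k => [|k IH]; first exact: pol_const.
apply: (@pol_sat bZ _ k.+1); first by move=> /eqP; rewrite Num.Theory.pnatr_eq0.
have pid : pol (S := cline bZ) id by exact: pol_coord.
apply: eq_pol (polM (polB pid (pol_const _ k%:R)) IH) => x.
by rewrite (binzS k x).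
Qed.

(** The weight [binz k] makes the induction go through: a factor x is absorbed by x binz_k = (k + 1)
    binz_(k+1) + k binz_k, and a constant is summed by raising k. The case k = 0 is the summation
    wanted. *)
Lemma alg_antidiff (W : cspace bZ) (f : cprod (cline bZ) W -> int) : alg f ->
  forall k, exists2 F : cprod (cline bZ) W -> int, pol F &
    forall x w, F ((x + 1 : int), w) - F (x, w) = binz k x * f (x, w).
Proof.
have pbinz k : pol (S := cprod (cline bZ) W) (fun w => binz k w.1).
  by apply: (pol_comp (phi := fun w : cprod (cline bZ) W => w.1) _ (pol_binz k)); pm.
elim=> [c|f' g cf ag IH|f' g _ IH1 _ IH2] k.
- exists (fun w => c * binz k.+1 w.1) => [|x w /=].
    by apply: polM; [exact: pol_const|exact: pbinz].
  by rewrite -mulrBr -binz_diff mulrC.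
- case: cf => [[_ -> ->]|[h ch ->]] /=.
    have [F1 pF1 E1] := IH k.+1; have [F2 pF2 E2] := IH k.
    exists (fun w => k.+1%:R * F1 w + k%:R * F2 w) => [|x w].
      by apply: polD; apply: polM => //; exact: pol_const.
    transitivity (k.+1%:R * (F1 ((x + 1 : int), w) - F1 (x, w)) + k%:R * (F2 ((x + 1 : int), w) - F2 (x, w))).
      by ring.
    by rewrite E1 E2 mulrA binzS; ring.
  have [F pF E] := IH k.
  exists (fun w => h w.2 * F w) => [|x w /=]; last by rewrite -mulrBr E; ring.
  by apply: polM pF; apply: pol_coord; right; exists h.
have [F1 pF1 E1] := IH1 k; have [F2 pF2 E2] := IH2 k.
exists (fun w => F1 w + F2 w) => [|x w]; first exact: polD.
by rewrite mulrDr -E1 -E2; ring.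
Qed.

Lemma pol_sumz (W : cspace bZ) (f : int -> W -> int) :
  pol (S := cprod (cline bZ) W) (fun w => f w.1 w.2) ->
  pol (S := cprod (cline bZ) W) (fun w => sumz (f ^~ w.2) w.1).
Proof.
move=> [N [N0 af]]; have [F pF FE] := alg_antidiff af 0.
apply: (@pol_sat bZ _ N) => //.
have pF0 : pol (S := cprod (cline bZ) W) (fun w => F ((0 : int), w.2)).
  by apply: (pol_comp (phi := fun w : cprod (cline bZ) W => (((0 : int) : cline bZ), w.2) : cprod (cline bZ) W) _ pF); pm.
apply: eq_pol (polB pF pF0) => -[x w] /=.
rewrite (@sumz_uniq (fun x => F (x, w)) (fun x => N%:R * f x w)) => [|y].
  have sumzM g y : sumz (fun x => N%:R * g x) y = N%:R * sumz g y.
    by case: y => n /=; rewrite ?mulrN mulr_sumr.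
  exact: sumzM.
by rewrite FE /= mul1r.
Qed.
End IntegerSums.

(** * Summation over F_p *)

Section FiniteSums.
Variables (p : nat) (pr_p : prime p).
Local Notation bF := (BaseF pr_p).

Definition sumf (g : 'F_p -> 'F_p) (x : 'F_p) : 'F_p := \sum_(m < (x : nat)) g m%:R.
Definition trf (g : 'F_p -> 'F_p) : 'F_p := \sum_(m < p) g m%:R.
(** By Fermat's little theorem, the indicator function of 0. It serves as the section of the trace
    and for interpolation. *)
Definition indf (x : 'F_p) : 'F_p := 1 - x ^+ p.-1.

Lemma ltn_Fp (x : 'F_p) : (x < p)%N.
Proof. by rewrite -[X in (_ < X)%N](Fp_cast pr_p) ltn_ord. Qed.

Lemma indfE x : indf x = (x == 0)%:R.
Proof.
rewrite /indf; have [->|x0] := eqVneq x 0.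
  by rewrite expr0n eqn0Ngt -subn1 subn_gt0 prime_gt1 //= subr0.
apply/eqP; rewrite subr_eq0; apply/eqP.
apply: (mulfI x0); rewrite -exprS prednK ?prime_gt0 // mulr1.
by rewrite -[X in _ ^+ X](card_Fp pr_p) expf_card.
Qed.

Lemma pol_indf : pol (S := cline bF) indf.
Proof. by apply: polB; [exact: pol_const|apply: polX; exact: pol_coord]. Qed.

(** The sum runs over the representatives below that of x. From p - 1 the next point is 0, with the
    empty sum, and the formula survives there exactly because the total is 0. *)
Lemma sumf_diff g x : trf g = 0 -> sumf g (x + 1) - sumf g x = g x.
Proof.
move=> g0; have xE : x = (x : nat)%:R by rewrite natr_Zp.
have x1 : nat_of_ord (x + 1)%R = (x.+1 %% p)%N.
  by rewrite -(val_Fp_nat pr_p) -natr1 -xE.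
rewrite /sumf x1; have := ltn_Fp x; rewrite leq_eqVlt => /orP[/eqP xp|xp].
  have : \sum_(m < x.+1) g m%:R = 0 by rewrite xp.
  rewrite big_ord_recr /= -xE xp modnn big_ord0 sub0r => /eqP.
  by rewrite addrC addr_eq0 => /eqP.
by rewrite modn_small // big_ord_recr /= addrAC subrr add0r -xE.
Qed.

Lemma sumf0 x : sumf (fun=> 0) x = 0.
Proof. by rewrite /sumf big1_eq. Qed.

Lemma trf_linear a f g : trf (fun x => a * f x + g x) = a * trf f + trf g.
Proof. by rewrite /trf mulr_sumr -big_split. Qed.

Lemma trf_shift f a : trf (fun x => f (x + a)) = trf f.
Proof.
have shift1 h : trf (fun x => h (x + 1)) = trf h.
  apply: (addrI (h 0)); transitivity (\sum_(m < p.+1) h m%:R).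
    by rewrite big_ord_recl /=; congr (_ + _); apply: eq_bigr => i _; rewrite -natr1.
  by rewrite big_ord_recr /= (pchar_Fp_0 pr_p) addrC.
rewrite -[a]natr_Zp; elim: (nat_of_ord a) f => [|n IH] f.
  by congr trf; apply: funext => x; rewrite addr0.
rewrite -[RHS]shift1 -[RHS](IH (fun x => f (x + 1))); congr trf.
by apply: funext => x; rewrite -natr1 addrA addrAC.
Qed.

Lemma pol_trf (W : cspace bF) (f : 'F_p -> W -> 'F_p) :
  pol (S := cprod (cline bF) W) (fun w => f w.1 w.2) -> pol (b := bF) (fun w : W => trf (f ^~ w)).
Proof.
move=> pf; apply: (@pol_sum bF W) => i.
by apply: (pol_comp (phi := fun w : W => ((i%:R : 'F_p) : cline bF, w) : cprod (cline bF) W) _ pf); pm.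
Qed.

Lemma trf_indf c : trf (fun x => c * indf x) = c.
Proof.
rewrite /trf (bigD1 (Ordinal (prime_gt0 pr_p))) //= indfE eqxx mulr1.
rewrite big1 ?addr0 // => i i0; rewrite indfE.
suff /negPf -> : i%:R != 0 :> 'F_p by rewrite mulr0.
apply: contra i0 => /eqP /(congr1 (@nat_of_ord _)).
by rewrite val_Fp_nat // modn_small // => e; apply/eqP/val_inj.
Qed.

(** Interpolation in the line variable: at each residue a the number of summands is fixed, and
    [indf] selects the residue. *)
Lemma pol_sumf (W : cspace bF) (f : 'F_p -> W -> 'F_p) :
  pol (S := cprod (cline bF) W) (fun w => f w.1 w.2) ->
  pol (S := cprod (cline bF) W) (fun w => sumf (f ^~ w.2) w.1 : coef bF).
Proof.
move=> pf.
have pE (w : cprod (cline bF) W) : sumf (f ^~ w.2) w.1 =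
    \sum_(a < p) \sum_(m < a) indf (w.1 - a%:R) * f m%:R w.2.
  rewrite (bigD1 (Ordinal (ltn_Fp w.1))) //= [X in _ + X]big1 => [|i ia].
    rewrite addr0; apply: eq_bigr => m _.
    by rewrite natr_Zp subrr indfE eqxx mul1r.
  rewrite big1 // => m _; rewrite indfE.
  suff /negPf -> : w.1 - i%:R != 0 :> 'F_p by rewrite mul0r.
  apply: contra ia; rewrite subr_eq0 => /eqP /(congr1 (@nat_of_ord _)).
  by rewrite val_Fp_nat // modn_small // => e; apply/eqP/val_inj.
apply: eq_pol (fun w => esym (pE w)) _.
apply: (@pol_sum bF) => a; apply: (@pol_sum bF) => m; apply: (@polM bF).
  apply: (pol_comp (b := bF) (S' := cline bF) (phi := fun w : cprod (cline bF) W => w.1 - a%:R : 'F_p) _ pol_indf).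
  by apply: (@polmap_line bF); apply: (@polB bF); [apply: (@pol_line bF); pm|exact: (@pol_const bF)].
by apply: (pol_comp (phi := fun w : cprod (cline bF) W => ((m%:R : 'F_p) : cline bF, w.2) : cprod (cline bF) W) _ pf); pm.
Qed.

Lemma Fp_periodic (g : 'F_p -> 'F_p) : (forall x, g (x + 1) = g x) -> forall x, g x = g 0.
Proof.
move=> gP x; rewrite -[x]natr_Zp; elim: (nat_of_ord x) => [//|n IH].
by rewrite -natr1 gP.
Qed.
End FiniteSums.

Lemma descent (b : base) (H : pmon b) k (u : cline b -> cpw (pprod (pline b) H) k -> coef b) :
  (forall j, (j < k)%N -> acyc (pprod (pline b) H) j) ->
  ncobV (@lact b H) (fdiff u) ->
  exists u' : cpw (pprod (pline b) H) k -> coef b, ncobV (@lact b H) (fun x s => u x s - u' s).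
Proof.
case: b H u => [|p pr_p] H u acM nu.
  (* Over Z every function has an indefinite sum, so N and its section are 0. *)
  apply: (@fdiff_descent BaseZ H sumz (fun=> 0) (fun=> 0)) acM nu.
  - by move=> g x _; exact: sumz_diff.
  - exact: sumz0.
  - exact: pol_sumz.
  - by move=> a f g; rewrite mulr0 addr0.
  - by [].
  - by move=> W f _; exact: pol_const.
  - exact: pol_const.
  - by left.
  - exact: int_periodic.
apply: (@fdiff_descent (BaseF pr_p) H (@sumf p) (@trf p) (@indf p)) acM nu.
- exact: (sumf_diff pr_p).
- exact: sumf0.
- exact: pol_sumf.
- exact: trf_linear.
- exact: (trf_shift pr_p).
- exact: pol_trf.
- exact: pol_indf.
- by right; exact: (trf_indf pr_p).
- exact: Fp_periodic.
Qed.

(** * Kunneth comparison for products *)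

Section LineKunneth.
Context (b : base) (H : pmon b).
Local Notation R := (coef b).
Local Notation M := (pprod (pline b) H).

Lemma npolV_at (V : cspace b) (N : pmon b) k (c : V -> cpw N k -> R) x : npolV c -> npol (c x).
Proof.
move=> [pc nc]; split; last exact: nc.
by apply: (pol_comp (phi := fun s : cpw N k => (x, s) : cprod V (cpw N k)) _ pc); pm.
Qed.

Lemma npolV_fdiff k (c : cline b -> cpw M k -> R) : npolV c -> npolV (fdiff c).
Proof.
move=> [pc nc]; split; last by move=> x; exact: nrmB.
refine (polB _ pc).
apply: (pol_comp (phi := fun w : cprod (cline b) (cpw M k) =>
  (w.1 + 1 : R, w.2) : cprod (cline b) (cpw M k)) _ pc).
apply: polmap_pair; last by pm.
by apply: polmap_add; pm.
Qed.

Lemma cdiff_inH k (c : cline b -> cpw M k -> R) (s : cpw H k.+1) :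
  cdiff (@lact b H) c 0 (pwmap (@inH b H) s) = bdiff (fun t => c 0 (pwmap (@inH b H) t)) s.
Proof.
rewrite (bdiff_pwmap (@inHM b H) (c 0)) /bdiff /cdiff.
by case: s => e s; rewrite /lact /= addr0.
Qed.

(** View c as a cochain with coefficients in functions on the line, constant in x. By Shapiro's
    lemma c = du + p there; descent replaces u by a cochain u' independent of x, and c - du' is in
    P. The outer induction supplies the acyclicity of [M] below k that descent uses. *)
Lemma kunneth_line k :
  (forall j, (j < k)%N -> acyc H j) ->
  forall c : cpw M k -> R, npol (bdiff c) ->
    ncob (fun s => c (pwmap (@inH b H) s)) -> ncob c.
Proof.
have nin n (f : cpw M n -> R) : npol f -> npol (fun s => f (pwmap (@inH b H) s)).
  by apply: npol_pwmap => //; exact: inH_polmap.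
elim/ltn_ind: k => k IHk acH c ndc nc.
have acM j : (j < k)%N -> acyc M j.
  move=> ltjk f nf; apply: IHk => // [i ltij|]; first by apply: acH; exact: ltn_trans ltjk.
  apply: acH => //; apply: eq_npol (nin _ _ nf) => s.
  by rewrite (bdiff_pwmap (@inHM b H)).
case: k IHk acH c ndc nc acM => [|k] IHk acH c ndc nc acM.
  split; last exact: I.
  by apply: eq_pol (pol_const _ (c tt)) => -[].
have [u nu] : ncobV (@lact b H) (fun _ : cline b => c).
  by apply: shapiro nc; exact: npolV_const ndc.
pose p x s := c s - cdiff (@lact b H) u x s.
(* c does not depend on x, so its forward difference vanishes and d([fdiff u]) = - [fdiff p]. *)
have ndu : npolV (cdiff (@lact b H) (fdiff u)).
  apply: eq_npolV (npolVB (npolV0 _ _ _) (npolV_fdiff nu)) => x s.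
  by rewrite cdiff_fdiff /fdiff; ring.
have [|u' nu'] := @descent b H k u (fun j ltj => acM j (leqW ltj)).
  apply: shapiro (ndu) _; apply: acH => //.
  refine (eq_npol _ (nin _ _ (npolV_at ((0 : R) : cline b) ndu))) => s.
  exact: cdiff_inH.
(* u - u' is a coboundary plus q, and the coboundary disappears under the differential; evaluating
   at x = 0 then gives c - du' = p + dq. *)
have [q nq dq] : exists2 q : cline b -> cpw M k -> R, npolV q &
    forall x s, cdiff (@lact b H) q x s = cdiff (@lact b H) u x s - bdiff u' s.
  case: k IHk acH c ndc nc acM u nu {p} ndu u' nu' => [|k] IHk acH c ndc nc acM u nu ndu u' nu'.
    by exists (fun x s => u x s - u' s) => // x s; rewrite cdiffB.
  have [e ne] := nu'; exists (fun x s => u x s - u' s - cdiff (@lact b H) e x s) => // x s.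
  rewrite (cdiffB _ (fun x s => u x s - u' s) (cdiff (@lact b H) e)).
  rewrite (cdiffB _ u (fun _ => u')) dco_cdiff ?subr0 //; exact: lactA.
exists u'; have := npolD (npolV_at ((0 : R) : cline b) nu) (npolV_at ((0 : R) : cline b) (npolV_cdiff (@lact1 b H) (@lact_polmap b H) nq)).
by apply: eq_npol => s; rewrite dq; ring.
Qed.
End LineKunneth.

Section VectorKunneth.
Context (b : base).
Local Notation R := (coef b).

Definition cvec (n : nat) : cspace b :=
  @CSpace b ('I_n -> R) (fun f => exists i, f = fun v => v i).

Lemma polmap_vec (S : cspace b) n (phi : S -> cvec n) :
  (forall i, pol (fun s => phi s i)) -> polmap phi.
Proof. by move=> pphi _ [i ->]. Qed.

Lemma pol_vec (S : cspace b) n (phi : S -> cvec n) i : polmap phi -> pol (fun s => phi s i).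
Proof. by move=> pphi; apply: (pphi (fun v => v i)); exists i. Qed.

Definition vadd n (u v : cvec n) : cvec n := fun i => u i + v i.
Definition vzero n : cvec n := fun=> 0.

Lemma vaddA n : associative (@vadd n).
Proof. by move=> u v w; apply: funext => i; rewrite /vadd addrA. Qed.
Lemma vadd0 n : right_id (@vzero n) (@vadd n).
Proof. by move=> u; apply: funext => i; rewrite /vadd addr0. Qed.
Lemma v0add n : left_id (@vzero n) (@vadd n).
Proof. by move=> u; apply: funext => i; rewrite /vadd add0r. Qed.

Lemma polmap_vadd (S : cspace b) n (f g : S -> cvec n) :
  polmap f -> polmap g -> polmap (fun s => vadd (f s) (g s)).
Proof.
by move=> pf pg; apply: polmap_vec => i; apply: polD; exact: pol_vec.
Qed.

Lemma vadd_polmap n : polmap (S := cprod (cvec n) (cvec n)) (fun s => vadd s.1 s.2).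
Proof. by apply: polmap_vadd; pm. Qed.

Definition pvec n : pmon b := PMon (@vaddA n) (@vadd0 n) (@v0add n) (@vadd_polmap n).

(** Injectivity of the restriction along [i] on the degree k cohomology of C/P. Acyclicity is
    assumed only below k, which is all that the induction of [acyc_tower1] has at its disposal. *)
Definition kunneth (H M : pmon b) (i : H -> M) (k : nat) : Prop :=
  (forall j, (j < k)%N -> acyc H j) ->
  forall c : cpw M k -> R, npol (bdiff c) -> ncob (fun s => c (pwmap i s)) -> ncob c.

Lemma kunneth_acyc (H M : pmon b) (i : H -> M) :
  (forall e e', i (pmul e e') = pmul (i e) (i e')) -> i (pone H) = pone M -> polmap i ->
  (forall k, kunneth i k) ->
  forall k, (forall j, (j < k)%N -> acyc H j) -> forall j, (j < k)%N -> acyc M j.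
Proof.
move=> iM i1 pi K k acH j ltjk f nf; apply: K => // [l ltlj|].
  by apply: acH; exact: ltn_trans ltjk.
apply: acH => //; apply: eq_npol (npol_pwmap pi i1 nf) => s.
by rewrite (bdiff_pwmap iM).
Qed.

Lemma kunneth_iso (H M M' : pmon b) (i : H -> M) (i' : H -> M') (phi : M -> M') (psi : M' -> M) k :
  (forall e, psi (phi e) = e) -> (forall h, psi (i' h) = i h) ->
  (forall e e', phi (pmul e e') = pmul (phi e) (phi e')) -> phi (pone M) = pone M' -> polmap phi ->
  (forall e e', psi (pmul e e') = pmul (psi e) (psi e')) -> psi (pone M') = pone M -> polmap psi ->
  kunneth i' k -> kunneth i k.
Proof.
move=> phiK psi_i phiM phi1 pphi psiM psi1 ppsi K acH c ndc nc.
have /(ncob_pwmap phiM pphi phi1) : ncob (fun s => c (pwmap psi s)).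
  apply: K => //.
    by apply: eq_npol (npol_pwmap ppsi psi1 ndc) => s; rewrite (bdiff_pwmap psiM).
  apply: eq_ncob nc => s; rewrite pwmap_comp; congr c.
  exact: eq_pwmap.
apply: eq_ncob => s; rewrite pwmap_comp -[in RHS](pwmap_id s); congr c.
exact: eq_pwmap.
Qed.

Definition inV n (H : pmon b) (h : H) : pprod (pvec n) H := (@vzero n, h).

Lemma inVM n (H : pmon b) (e e' : H) : inV n (pmul e e') = pmul (inV n e) (inV n e').
Proof. by rewrite /inV /= vadd0. Qed.
Lemma inV_polmap n (H : pmon b) : polmap (@inV n H).
Proof. by rewrite /inV; pm. Qed.

Lemma kunneth_vec n (H : pmon b) k : kunneth (@inV n H) k.
Proof.
elim: n H k => [|n IH] H k.
  move=> acH c ndc nc.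
  have p2 : polmap (fun e : pprod (pvec 0) H => e.2) by pm.
  apply: eq_ncob (ncob_pwmap (phi := fun e : pprod (pvec 0) H => e.2) _ p2 _ nc) => // s.
  rewrite pwmap_comp -[in RHS](pwmap_id s); congr c.
  apply: eq_pwmap => -[v h]; congr (_, _).
  by apply: funext => -[].
(* R^(n+1) x H is regrouped as R x (R^n x H), to which the case of the line applies. *)
pose M' := pprod (pline b) (pprod (pvec n) H).
pose phi (e : pprod (pvec n.+1) H) : M' := (e.1 ord0, ((fun i => e.1 (lift ord0 i)) : cvec n, e.2)).
pose psi (e : M') : pprod (pvec n.+1) H :=
  ((fun i => if unlift ord0 i is Some j then e.2.1 j else e.1) : cvec n.+1, e.2.2).
apply: (@kunneth_iso _ _ M' _ (fun h => inH (inV n h)) phi psi).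
- move=> [v h]; congr (_, _); apply: funext => i /=.
  by case: unliftP => [j|] ->.
- move=> h; congr (_, _); apply: funext => i /=.
  by case: unliftP.
- by [].
- by [].
- apply: polmap_pair; first by apply: polmap_line; apply: (@pol_vec _ _ (fun s : pprod (pvec n.+1) H => s.1)); pm.
  apply: polmap_pair; last by pm.
  by apply: polmap_vec => i; apply: (@pol_vec _ _ (fun s : pprod (pvec n.+1) H => s.1)); pm.
- move=> e e'; congr (_, _); apply: funext => i /=; rewrite /vadd.
  by case: unliftP.
- congr (_, _); apply: funext => i /=; rewrite /vzero.
  by case: unliftP.
- apply: polmap_pair; last by pm.
  apply: polmap_vec => i; case: (unlift ord0 i) => [j|].
    by apply: (@pol_vec _ _ (fun s : M' => s.2.1)); pm.
  by apply: pol_line; pm.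
move=> acH c ndc nc; apply: kunneth_line => //.
  apply: kunneth_acyc acH.
  - exact: inVM.
  - by [].
  - exact: inV_polmap.
  - exact: IH.
apply: IH => //.
  apply: eq_npol (npol_pwmap (@inH_polmap _ _) _ ndc) => // s.
  by rewrite (bdiff_pwmap (@inHM b _)).
apply: eq_ncob nc => s; rewrite pwmap_comp; congr c.
Qed.
End VectorKunneth.

(** * The Cech complex of a central extension *)

Section Tower.
Context (b : base) (G : pmon b) (n : nat) (kappa : G -> G -> cvec b n).
Local Notation R := (coef b).
Hypothesis kappa_cocycle : forall g h l i,
  kappa g h i + kappa (pmul g h) l i = kappa h l i + kappa g (pmul h l) i.
Hypothesis kappa1 : forall g i, kappa g (pone G) i = 0.
Hypothesis kappa_1 : forall g i, kappa (pone G) g i = 0.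
Hypothesis kappa_polmap : polmap (S := cprod G G) (fun w => kappa w.1 w.2).

(** The projection to [G] is kept with the monoid, so that the same cocycle can be pulled back at
    each stage of the tower. *)
Record over := Over {
  ov :> pmon b;
  bs : ov -> G;
  bsM : forall e e', bs (pmul e e') = pmul (bs e) (bs e');
  bs1 : bs (pone ov) = pone G;
  bs_polmap : polmap bs }.

Section Twist.
Variable M : over.

Let tmul (s t : cprod (cvec b n) M) : cprod (cvec b n) M :=
  (vadd (vadd s.1 t.1) (kappa (bs s.2) (bs t.2)), pmul s.2 t.2).

Lemma twistA : associative tmul.
Proof.
move=> s t u; rewrite /tmul /= pmulA; congr (_, _); apply: funext => i.
rewrite /vadd !bsM; have := kappa_cocycle (bs s.2) (bs t.2) (bs u.2) i.
move=> /(congr1 (fun x => x + (s.1 i + t.1 i + u.1 i))) E.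
transitivity (kappa (bs t.2) (bs u.2) i + kappa (bs s.2) (pmul (bs t.2) (bs u.2)) i + (s.1 i + t.1 i + u.1 i)).
  by ring.
by rewrite -E; ring.
Qed.

Lemma twist1 : right_id ((@vzero b n, pone M) : cprod (cvec b n) M) tmul.
Proof.
move=> [u e]; rewrite /tmul /= pmul1; congr (_, _); apply: funext => i.
by rewrite /vadd /vzero bs1 kappa1 !addr0.
Qed.

Lemma t1wist : left_id ((@vzero b n, pone M) : cprod (cvec b n) M) tmul.
Proof.
move=> [u e]; rewrite /tmul /= p1mul; congr (_, _); apply: funext => i.
by rewrite /vadd /vzero bs1 kappa_1 add0r addr0.
Qed.

Lemma polmap_kappa (S : cspace b) (f g : S -> M) :
  polmap f -> polmap g -> polmap (fun s => kappa (bs (f s)) (bs (g s))).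
Proof.
move=> pf pg.
apply: (polmap_comp (phi := fun s => (bs (f s), bs (g s)) : cprod G G) kappa_polmap).
by apply: polmap_pair; apply: (polmap_comp (@bs_polmap M)).
Qed.

Lemma twist_polmap : polmap (S := cprod (cprod (cvec b n) M) (cprod (cvec b n) M))
  (fun s => tmul s.1 s.2).
Proof.
apply: polmap_pair; last by pm.
apply: polmap_vadd; first by apply: polmap_vadd; pm.
by apply: polmap_kappa; pm.
Qed.

Definition twist : pmon b := PMon twistA twist1 t1wist twist_polmap.

Lemma twist_bsM (e e' : twist) : bs (pmul e e').2 = pmul (bs e.2) (bs e'.2).
Proof. exact: bsM. Qed.

Lemma twist_bs_polmap : polmap (fun e : twist => bs e.2).
Proof. by apply: (polmap_comp (@bs_polmap M)); pm. Qed.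

Definition twist_over : over := @Over twist (fun e => bs e.2) twist_bsM (bs1 M) twist_bs_polmap.
End Twist.

(* For the extension E of G with cocycle kappa, tower m is the m-fold fibre product
   of E over G. *)
Fixpoint tower m : over :=
  if m is m'.+1 then twist_over (tower m')
  else @Over G id (fun _ _ => erefl) erefl (@polmap_id _ _).

(** The last clause also gives a value for m = 0 and a > 0, which never occurs in [cech], where a <=
    m. *)
Fixpoint face m (a : nat) : tower m.+1 -> tower m :=
  match m, a return tower m.+1 -> tower m with
  | m'.+1, a'.+1 => fun z => (z.1, face a' z.2)
  | _, _ => fun z => z.2
  end.

Lemma bs_face m a (z : tower m.+1) : bs (face a z) = bs z.
Proof. by elim: m a z => [|m IH] [|a] z //=; rewrite IH. Qed.

Lemma faceM m a (z z' : tower m.+1) : face a (pmul z z') = pmul (face a z) (face a z').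
Proof.
elim: m a z z' => [|m IH] [|a] z z' //=.
by rewrite !bs_face; congr (_, _); apply: IH.
Qed.

Lemma face1 m a : face a (pone (tower m.+1)) = pone (tower m).
Proof. by elim: m a => [|m IH] [|a] //=; rewrite (IH a). Qed.

Lemma face_polmap m a : polmap (@face m a).
Proof.
have psnd l : polmap (S := tower l.+1) (S' := tower l) (fun z => z.2).
  exact: (@polmap_snd b (tower l.+1) (cvec b n) (tower l) _ (@polmap_id b _)).
elim: m a => [|m IH] [|a]; try exact: psnd.
refine (polmap_pair (A := cvec b n) (B := tower m) _ (polmap_comp (IH a) (psnd _))).
exact: (@polmap_fst b (tower m.+2) (cvec b n) (tower m.+1) _ (@polmap_id b _)).
Qed.

(* The differential of the Cech complex of E -> G; at level j of the bar complex it
   omits one of the m points of the fibre, which is a homomorphism. *)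
Definition cech m j (c : cpw (tower m) j -> R) : cpw (tower m.+1) j -> R :=
  fun z => \sum_(a < m.+1) (-1) ^+ a * c (pwmap (@face m a) z).

Definition zcons m (z : tower m) : tower m.+1 := (@vzero b n, z).

(* A contraction of the Cech complex, given by a section of E -> G that is not a
   homomorphism and hence does not commute with the bar differential. *)
Definition csection m j (c : cpw (tower m.+1) j -> R) : cpw (tower m) j -> R :=
  fun z => c (pwmap (@zcons m) z).

Lemma zcons_polmap m : polmap (@zcons m).
Proof. by rewrite /zcons; pm. Qed.

Lemma npol_section m j (c : cpw (tower m.+1) j -> R) : npol c -> npol (csection c).
Proof. by apply: npol_pwmap => //; exact: zcons_polmap. Qed.

Lemma npol_cech m j (c : cpw (tower m) j -> R) : npol c -> npol (cech c).
Proof.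
move=> nc; apply: npol_sum => a; apply: npolZ; apply: npol_pwmap nc.
  exact: face_polmap.
exact: face1.
Qed.

Lemma cechB m j (c d : cpw (tower m) j -> R) z : cech (fun t => c t - d t) z = cech c z - cech d z.
Proof. by rewrite /cech -sumrB; apply: eq_bigr => a _; ring. Qed.

Lemma cech_bdiff m j (c : cpw (tower m) j -> R) z : cech (bdiff c) z = bdiff (cech c) z.
Proof.
rewrite /cech bdiff_sum; apply: eq_bigr => a _; rewrite bdiffZ; congr (_ * _).
by rewrite -(bdiff_pwmap (phi := @face m a)) //; exact: faceM.
Qed.

Fixpoint pwzip m j : cpw (cvec b n) j -> cpw (tower m) j -> cpw (tower m.+1) j :=
  match j return cpw (cvec b n) j -> cpw (tower m) j -> cpw (tower m.+1) j with
  | 0 => fun _ _ => tt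
  | j'.+1 => fun u z => ((u.1, z.1), pwzip u.2 z.2)
  end.

Definition tl m j (z : cpw (tower m.+1) j) : cpw (tower m) j := pwmap (@face m 0) z.
Fixpoint hd m j : cpw (tower m.+1) j -> cpw (cvec b n) j :=
  match j return cpw (tower m.+1) j -> cpw (cvec b n) j with
  | 0 => fun=> tt
  | j'.+1 => fun z => (z.1.1, hd z.2)
  end.

Lemma face0 m (z : tower m.+1) : face 0 z = z.2.
Proof. by case: m z. Qed.

Lemma tl_zip m j u (z : cpw (tower m) j) : tl (pwzip u z) = z.
Proof.
elim: j u z => [|j IH] u z; first by case: z.
by case: z => e z; rewrite /tl /= face0 /=; congr (_, _); exact: IH.
Qed.

Lemma hd_zip m j u (z : cpw (tower m) j) : hd (pwzip u z) = u.
Proof.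
elim: j u z => [|j IH] u z; first by case: u.
by case: u => e u /=; rewrite IH.
Qed.

Lemma pwmap_face_succ m j a (z : cpw (tower m.+2) j) :
  pwmap (@face m.+1 a.+1) z = pwzip (hd z) (pwmap (@face m a) (tl z)).
Proof.
elim: j z => [//|j IH] [e z]; rewrite /tl /=; congr (_, _).
exact: IH.
Qed.

Lemma cech0E j (c : cpw (tower 0) j -> R) z : cech c z = c (tl z).
Proof. by rewrite /cech big_ord_recl big_ord0 expr0 mul1r addr0. Qed.

(** The face forgetting the first fibre coordinate is split off, and that coordinate becomes a
    parameter of the others. [cech_cech] and [cech_section] are deduced from this recursion. *)
Lemma cechSE m j (c : cpw (tower m.+1) j -> R) z :
  cech c z = c (tl z) - cech (fun y => c (pwzip (hd z) y)) (tl z).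
Proof.
rewrite /cech big_ord_recl expr0 mul1r; congr (_ + _).
rewrite -[RHS]mulN1r mulr_sumr; apply: eq_bigr => a _.
by rewrite exprS mulrA; congr (_ * c _); rewrite pwmap_face_succ.
Qed.

Lemma cech_cech m j (c : cpw (tower m) j -> R) z : cech (cech c) z = 0.
Proof.
elim: m c z => [|m IH] c z; rewrite cechSE.
  rewrite !cech0E tl_zip; exact: subrr.
rewrite (_ : (fun y => cech c (pwzip (hd z) y)) =
    fun y => c y - cech (fun x => c (pwzip (hd z) x)) y); last first.
  by apply: funext => y; rewrite cechSE tl_zip hd_zip.
by rewrite cechB IH; ring.
Qed.

Lemma zcons_zip m j (z : cpw (tower m) j) :
  pwmap (@zcons m) z = pwzip (hd (pwmap (@zcons m) z)) z.
Proof. by elim: j z => [//|j IH] [e z] /=; rewrite -IH. Qed.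

Lemma hd_zcons m m' j (z : cpw (tower m) j) (z' : cpw (tower m') j) :
  hd (pwmap (@zcons m) z) = hd (pwmap (@zcons m') z').
Proof. by elim: j z z' => [//|j IH] [e z] [e' z'] /=; rewrite (IH _ z'). Qed.

Lemma section_cech0 j (c : cpw (tower 0) j -> R) z : csection (cech c) z = c z.
Proof. by rewrite /csection cech0E zcons_zip tl_zip. Qed.

Lemma cech_section m j (c : cpw (tower m.+1) j -> R) z : c z = cech (csection c) z + csection (cech c) z.
Proof.
rewrite {2}/csection cechSE zcons_zip tl_zip hd_zip.
rewrite (_ : (fun y => c (pwzip (hd (pwmap (@zcons m.+1) z)) y)) = csection c); first by ring.
by apply: funext => y; rewrite /csection [in RHS]zcons_zip (hd_zcons _ z).
Qed.

(** Unlike [zcons], repeating a fibre point is a homomorphism. *)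
Definition diag m (z : tower m.+1) : tower m.+2 := (z.1, z).

Lemma diagM m (e e' : tower m.+1) : diag (pmul e e') = pmul (diag e) (diag e').
Proof. by []. Qed.

Lemma diag_polmap m : polmap (@diag m).
Proof. by rewrite /diag; pm. Qed.

(** The first two fibre coordinates are twisted by the same cocycle, so their difference is
    additive. It splits the tower as a product with F, in which [diag] is the inclusion at 0. *)
Lemma kunneth_tower m k : kunneth (@diag m) k.
Proof.
pose M' := pprod (pvec b n) (tower m.+1).
pose phi (e : tower m.+2) : M' := ((fun i => e.1 i - e.2.1 i) : cvec b n, e.2).
pose psi (e : M') : tower m.+2 := (vadd e.1 e.2.1, e.2).
apply: (@kunneth_iso _ _ (tower m.+2) M' _ (@inV b n (tower m.+1)) phi psi).
- move=> [u [v e]]; congr (_, _); apply: funext => i.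
  by rewrite /vadd /= subrK.
- by move=> [v e]; congr (_, _); rewrite /= v0add.
- move=> [u [v e]] [u' [v' e']]; congr (_, _); apply: funext => i.
  by rewrite /= /vadd; ring.
- by congr (_, _); apply: funext => i; rewrite /= subrr.
- apply: polmap_pair; last by pm.
  apply: polmap_vec => i; apply: polB.
    by apply: (@pol_vec _ _ _ (fun s : tower m.+2 => s.1)); pm.
  by apply: (@pol_vec _ _ _ (fun s : tower m.+2 => s.2.1)); pm.
- move=> [u [v e]] [u' [v' e']]; congr (_, _); apply: funext => i.
  by rewrite /= /vadd; ring.
- by congr (_, _); rewrite /= vadd0.
- by apply: polmap_pair; [apply: polmap_vadd|]; pm.
exact: kunneth_vec.
Qed.

Lemma tower_acyc m k :
  (forall j, (j < k)%N -> acyc (tower 1) j) -> forall j, (j < k)%N -> acyc (tower m.+1) j.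
Proof.
move=> ac1; elim: m => [//|m IH]; apply: kunneth_acyc IH.
- exact: diagM.
- by [].
- exact: diag_polmap.
- exact: kunneth_tower.
Qed.

(** Let [cech x] = dc modulo P. As [cech] squares to zero, [cech c] is closed modulo P one degree
    lower, where c is already known to be some [cech e] up to a relative coboundary. Subtracting de
    from x puts [cech] of the result in P, and the contraction, which preserves P, concludes. *)
Lemma cech_zigzag_step m k (x : cpw (tower m.+1) k -> R) :
  (forall j, (j < k)%N -> forall m (y : cpw (tower m.+1) j -> R), npol (bdiff (cech y)) ->
     exists e : cpw (tower m) j -> R, ncob (fun s => y s - cech e s)) ->
  ncob (cech x) -> exists e : cpw (tower m) k -> R, ncob (fun s => x s - cech e s).
Proof.
case: k x => [|k] x cech_zigzag nx.
  exists (csection x); apply: eq_npol (npol_section nx) => s.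
  by rewrite [in RHS](cech_section x s) addrC addKr.
have [c nc] := nx.
have [|e ne] := cech_zigzag k (leqnn _) _ c.
  apply: eq_npol (npolB (npol0 _ _) (npol_cech nc)) => s.
  by rewrite cechB cech_cech cech_bdiff; ring.
pose x' s := x s - bdiff e s.
have nx' : npol (cech x').
  apply: eq_npol (npolD nc (ncob_npol_bdiff ne)) => s.
  by rewrite bdiffB /x' cechB cech_bdiff; ring.
exists (csection x'), e; apply: eq_npol (npol_section nx') => s.
by apply: (addrI (cech (csection x') s)); rewrite -cech_section /x'; ring.
Qed.

Lemma cech_zigzag k (ac1 : forall j, (j < k)%N -> acyc (tower 1) j) j :
  (j < k)%N -> forall m (x : cpw (tower m.+1) j -> R), npol (bdiff (cech x)) ->
  exists e : cpw (tower m) j -> R, ncob (fun s => x s - cech e s).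
Proof.
elim/ltn_ind: j => j IH ltjk m x nx; apply: cech_zigzag_step => [l ltlj|].
  by apply: IH => //; exact: ltn_trans ltjk.
exact: (tower_acyc (m := m.+1) ac1 ltjk).
Qed.

(** The zigzag moves a class of E down to a cochain e of [G], to which the hypothesis applies. *)
Lemma acyc_tower1 : (forall k, acyc G k) -> forall k, acyc (tower 1) k.
Proof.
move=> acG; elim/ltn_ind => k ac1 c ndc.
have [|e ne] := @cech_zigzag_step 0 k c (cech_zigzag ac1).
  (* Both projections of the double fibre product agree on the diagonal, so [cech c] restricts to 0
     there. *)
  apply: (kunneth_tower (m := 0)) => //.
    apply: eq_npol (npol_cech ndc) => s; exact: cech_bdiff.
  apply: eq_ncob (npol_ncob (npol0 _ _)) => s.
  rewrite cechSE cech0E -[LHS](subrr (c s)); congr (c _ - c _).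
    by rewrite /tl pwmap_comp -[LHS]pwmap_id; exact: eq_pwmap.
  elim: {c ndc ac1} k s => [[]//|k IH] [[v g] s] /=; congr (_, _); exact: IH.
(* [cech] of [bdiff e] is in P, and on [tower 0] the section is a left inverse of [cech] preserving
   P. *)
have nde : npol (bdiff e).
  have nd : npol (cech (bdiff e)).
    apply: eq_npol (npolB ndc (ncob_npol_bdiff ne)) => s.
    by rewrite bdiffB cech_bdiff; ring.
  by apply: eq_npol (npol_section nd) => s; rewrite section_cech0.
suff : ncob (cech e).
  by move=> /(ncobD ne); apply: eq_ncob => s; rewrite subrK.
have := acG k e nde; case: k {c ndc ac1 ne} e {nde} => [|k] e; first exact: (@npol_cech 0 0 e).
move=> [w nw]; exists (@cech 0 k w); apply: eq_npol (@npol_cech 0 k.+1 _ nw) => s.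
by rewrite (@cechB 0) (@cech_bdiff 0).
Qed.
End Tower.

(** * Integer-valued polynomials and binomials *)

Lemma malgU_scale (J : choiceType) (A : comNzRingType) (c : A) (m : J) :
  << c *g m >> = c *: << m >> :> {malg A[J]}.
Proof.
apply malgP => l.
rewrite [RHS]mcoeffZ mcoeffU [X in _ = _ * X]mcoeffU.
by rewrite mulr_natr.
Qed.

Section LinearExtension.
Context (A : comNzRingType) (V : lmodType A) (J : choiceType).
Implicit Types (g : J -> V) (Q : J -> Prop).

Definition lext g (w : {malg A[J]}) : V := \sum_(s <- msupp w) w@_s *: g s.

Lemma lext_linear g c u v : lext g (c *: u + v) = c *: lext g u + lext g v.
Proof.
have Ew (D : {fset J}) w : (msupp w `<=` D)%fset -> lext g w = \sum_(s <- D) w@_s *: g s.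
  by move=> le; apply: (big_fset_incl _ le) => s _ /mcoeff_outdom ->; exact: scale0r.
pose D := (msupp u `|` msupp v)%fset.
rewrite (Ew D u (fsubsetUl _ _)) (Ew D v (fsubsetUr _ _)) (Ew D); last first.
  by apply: fsubset_trans (msuppD_le _ _) _; apply: fsetSU; exact: msuppZ_le.
rewrite scaler_sumr -big_split /=.
by apply: eq_bigr => s _; rewrite mcoeffD mcoeffZ scalerDl scalerA.
Qed.

Lemma lextU g s : lext g << s >> = g s.
Proof. by rewrite /lext msuppU oner_eq0 big_seq_fset1 mcoeffUU scale1r. Qed.

Definition spanned g Q (v : V) : Prop :=
  exists2 w : {malg A[J]}, (forall s, s \in msupp w -> Q s) & v = lext g w.

Lemma spanned_gen g Q s : Q s -> spanned g Q (g s).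
Proof.
move=> Qs; exists << s >>; last by rewrite lextU.
by move=> t; rewrite msuppU oner_eq0 inE => /eqP ->.
Qed.

Lemma spanned_lin g Q c u v : spanned g Q u -> spanned g Q v -> spanned g Q (c *: u + v).
Proof.
move=> [w Qw ->] [w' Qw' ->]; exists (c *: w + w'); last by rewrite lext_linear.
move=> s /(fsubsetP (msuppD_le _ _)); rewrite inE => /orP[/(fsubsetP (msuppZ_le _ _))|]; first exact: Qw.
exact: Qw'.
Qed.

Lemma spanned0 g Q : spanned g Q 0.
Proof.
exists 0; last by rewrite /lext msupp0 big_seq_fset0.
by move=> s; rewrite msupp0 inE.
Qed.

Lemma spannedZ g Q c u : spanned g Q u -> spanned g Q (c *: u).
Proof. by move=> su; have := spanned_lin c su (spanned0 g Q); rewrite addr0. Qed.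

Lemma spannedD g Q u v : spanned g Q u -> spanned g Q v -> spanned g Q (u + v).
Proof. by move=> su sv; have := spanned_lin 1 su sv; rewrite scale1r. Qed.

Lemma spanned_sum g Q (I : eqType) (r : seq I) (F : I -> V) :
  (forall i, i \in r -> spanned g Q (F i)) -> spanned g Q (\sum_(i <- r) F i).
Proof.
elim: r => [|i r IH] sF; first by rewrite big_nil; exact: spanned0.
rewrite big_cons; apply: spannedD; first by apply: sF; rewrite mem_head.
by apply: IH => j jr; apply: sF; rewrite inE jr orbT.
Qed.
End LinearExtension.

(** Entries are expanded one at a time: in the induction, those of index at least n are already
    generators. *)
Lemma spanned_multilinear (A : comNzRingType) (M V : lmodType A) (k : nat)
    (g : k.-tuple M -> V) (J : choiceType) (B : J -> M) (Q : J -> Prop) :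
  multilinear g -> (forall q, spanned B Q q) ->
  forall s, spanned (fun js : k.-tuple J => g (map_tuple B js))
                    (fun js => forall i, Q (tnth js i)) (g s).
Proof.
move=> g_ml Bq; set S := spanned _ _.
suff H n : (n <= k)%N -> forall s : k.-tuple M,
    (forall i : 'I_k, (n <= i)%N -> exists2 j, Q j & tnth s i = B j) -> S (g s).
  by move=> s; apply: (H k) => // i; rewrite leqNgt ltn_ord.
elim: n => [|n IH] le_nk s sB.
  have /choice[js jsP] (i : 'I_k) : exists j, Q j /\ tnth s i = B j.
    by have [j Qj e] := sB i (leq0n _); exists j.
  have -> : s = map_tuple B [tuple js i | i < k].
    by apply: eq_from_tnth => i; rewrite tnth_map tnth_mktuple (jsP i).2.
  apply: (@spanned_gen _ _ _ (fun js : k.-tuple J => g (map_tuple B js))).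
  by move=> i; rewrite tnth_mktuple; exact: (jsP i).1.
pose i0 := Ordinal le_nk.
have -> : s = tupd s i0 (tnth s i0).
  by apply: eq_from_tnth => j; rewrite tnth_mktuple; case: eqP => [->|].
have [w Qw ->] := Bq (tnth s i0).
have lin c u v := g_ml s i0 c u v.
have sum0 : g (tupd s i0 0) = 0.
  by have := lin (-1) 0 0; rewrite scaleN1r oppr0 addr0 scaleN1r addNr.
rewrite /lext.
have : {subset (msupp w : seq J) <= [pred j | `[< Q j >]]}.
  by move=> j /Qw Qj; rewrite inE; exact/asboolP.
elim: (msupp w : seq J) => [|j r IHr] rQ.
  by rewrite big_nil sum0; exact: spanned0.
rewrite big_cons lin; apply: spanned_lin; last first.
  by apply: IHr => l lr; apply: rQ; rewrite inE lr orbT.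
apply: IH => [|i le_ni]; first exact: ltnW.
rewrite tnth_mktuple; have [_|ne] := eqVneq i i0.
  by exists j => //; apply/asboolP; exact: (rQ j (mem_head _ _)).
apply: sB; rewrite ltn_neqAle le_ni andbT; apply: contra ne => /eqP e.
by apply/eqP/val_inj.
Qed.

Section Triangular.
Context (A : zmodType) (J : choiceType) (deg : J -> nat) (bn : J -> J -> nat).
Hypothesis bn_diag : forall s, bn s s = 1%N.
Hypothesis bn_deg : forall a s, bn a s != 0%N -> s != a -> (deg s < deg a)%N.

(** A unitriangular system is solved by induction on the degree, staying in the subgroup Z: the
    coefficient at s is the value at s minus multiples of coefficients of lower degree. Z will be
    the integers among rationals, then 0, then the multiples of N. *)
Lemma triangular (w : {malg A[J]}) (Z : A -> Prop) :
  Z 0 -> (forall u v, Z u -> Z v -> Z (u - v)) ->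
  (forall a, a \in msupp w -> Z (\sum_(s <- msupp w) w@_s *+ bn a s)) ->
  forall s, s \in msupp w -> Z w@_s.
Proof.
move=> Z0 ZB Zw s; have [n] := ubnP (deg s); elim: n s => // n IH s lt_sn sw.
have ZN u : Z u -> Z (- u) by move=> Zu; rewrite -sub0r; exact: ZB.
have ZD u v : Z u -> Z v -> Z (u + v) by move=> Zu Zv; rewrite -[v]opprK; apply: ZB => //; exact: ZN.
have ZM u l : Z u -> Z (u *+ l).
  by move=> Zu; elim: l => [|l IHl]; rewrite ?mulr0n ?mulrS //; exact: ZD.
have := Zw s sw; rewrite (big_fsetD1 s) //= bn_diag mulr1n => Zs.
rewrite -[w@_s](addrK (\sum_(i <- (msupp w `\ s)%fset) w@_i *+ bn s i)); apply: ZB => //.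
rewrite big_seq; elim/big_ind: _ => // i; rewrite !inE => /andP[ne iw].
have [->|bn0] := eqVneq (bn s i) 0%N; first by rewrite mulr0n.
apply: ZM; apply: IH => //; rewrite (leq_trans (bn_deg bn0 ne)) //.
Qed.
End Triangular.

Section Binomials.
Context (X : choiceType).
Local Notation Mon := {cmonom X}.

(** The value at the point a of N^X of the product of binomials with exponents s. *)
Definition mbin (a s : Mon) : nat := \prod_(x <- finsupp s) 'C(a x, s x).
Definition mfact (s : Mon) : nat := \prod_(x <- finsupp s) (s x)`!.

Lemma mbin_diag s : mbin s s = 1%N.
Proof. by rewrite /mbin big1_seq // => x _; exact: binn. Qed.

Lemma mbin_le a s : mbin a s != 0%N -> forall x, (s x <= a x)%N.
Proof.
move=> bn0 x; have [xs|] := boolP (x \in finsupp s); last by rewrite -cmE_eq0 => /eqP ->.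
rewrite -bin_gt0 lt0n; apply: contra bn0 => /eqP b0.
by rewrite /mbin (big_fsetD1 x) //= b0 mul0n.
Qed.

Lemma mbin_div a s : mbin a s != 0%N -> a = mulcm s (divcm a s).
Proof.
move=> /mbin_le le; apply/eqP/cmP => x.
by rewrite mulcmE divcmE subnKC.
Qed.

Definition tbin k (a s : k.-tuple Mon) : nat := \prod_(i < k) mbin (tnth a i) (tnth s i).
Definition tdeg k (s : k.-tuple Mon) : nat := \sum_(i < k) mdeg (tnth s i).

Lemma tbin_diag k (s : k.-tuple Mon) : tbin s s = 1%N.
Proof. by rewrite /tbin big1 // => i _; exact: mbin_diag. Qed.

Lemma tbin_deg k (a s : k.-tuple Mon) : tbin a s != 0%N -> s != a -> (tdeg s < tdeg a)%N.
Proof.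
move=> bn0 ne.
have E i : tnth a i = mulcm (tnth s i) (divcm (tnth a i) (tnth s i)).
  apply: mbin_div; apply: contra bn0 => /eqP b0.
  by rewrite /tbin (bigD1 i) //= b0 mul0n.
have -> : tdeg a = (tdeg s + \sum_(i < k) mdeg (divcm (tnth a i) (tnth s i)))%N.
  rewrite /tdeg -big_split; apply: eq_bigr => i _ /=.
  by rewrite {1}E; exact: mdegM.
rewrite -[X in (X < _)%N]addn0 ltn_add2l lt0n; apply: contra ne.
rewrite sum_nat_eq0 => /forallP /= z; apply/eqP/eq_from_tnth => i.
have := z i; rewrite mdeg_eq0 => /eqP e1; rewrite [RHS]E e1.
by apply/eqP/cmP => x; rewrite mulcmE cm1 addn0.
Qed.

Lemma prod_natB (R : comNzRingType) (n m : nat) :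
  \prod_(i < m) (n%:R - i%:R : R) = (n ^_ m)%:R.
Proof.
elim: m => [|m IH]; first by rewrite big_ord0 ffactn0.
rewrite big_ord_recr /= IH ffactnSr natrM.
have [le_mn|lt_nm] := leqP m n; first by rewrite natrB.
by rewrite ffact_small // !mul0r.
Qed.

Lemma fact_binz n (x : int) : n`!%:R * binz n x = \prod_(i < n) (x - i%:R).
Proof.
elim: n => [|n IH]; first by rewrite big_ord0 mulr1.
rewrite big_ord_recr /= -IH factS natrM [_.+1%:R * _]mulrC -!mulrA binzS.
by rewrite [binz n x * _]mulrC.
Qed.

Local Notation QX := {malg rat[Mon]}.

Lemma fact_pbinom (x : X) n : n`!%:R * pbinom x n = \prod_(i < n) (pvar rat x - i%:R).
Proof.
rewrite /pbinom mulr_natl -scaler_nat scalerA divff ?scale1r //.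
by rewrite Num.Theory.pnatr_eq0 -lt0n fact_gt0.
Qed.

Lemma pbinomS (x : X) n :
  pbinom x n * pvar rat x = n.+1%:R *: pbinom x n.+1 + n%:R *: pbinom x n.
Proof.
rewrite /pbinom big_ord_recr /= scalerA factS natrM invfM mulrA divff ?mul1r; last first.
  by rewrite Num.Theory.pnatr_eq0.
rewrite -[_ *: _ * pvar rat x]scalerAl scalerA [n%:R * _]mulrC -scalerA -scalerDr.
congr (_ *: _); rewrite mulrBr [_ * n%:R]mulrC mulr_natl scaler_nat.
by rewrite subrK.
Qed.

Lemma peval_pbinom (a : X -> int) x n : peval a (pbinom x n) = (binz n (a x))%:~R.
Proof.
have f0 : (n`!%:R : rat) != 0 by rewrite Num.Theory.pnatr_eq0 -lt0n fact_gt0.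
apply: (mulfI f0).
have -> : n`!%:R * (binz n (a x))%:~R = \prod_(i < n) ((a x)%:~R - i%:R) :> rat.
  have -> : n`!%:R = (n`!%:R : int)%:~R :> rat by rewrite mulrz_nat.
  rewrite -intrM fact_binz rmorph_prod; apply: eq_bigr => i _.
  by rewrite rmorphB /= mulrz_nat.
rewrite -[n`!%:R](rmorph_nat (peval a)) -[LHS](rmorphM (peval a)) fact_pbinom.
rewrite [LHS](rmorph_prod (peval a)); apply: eq_bigr => i _.
rewrite [LHS](rmorphB (peval a)) rmorph_nat; congr (_ - _).
exact: psubst_var.
Qed.

Lemma int_valued_pbinom x n : pbinom x n \in @int_valued X.
Proof. by apply/int_valuedP => a; rewrite peval_pbinom Num.Theory.intr_int. Qed.

Definition pbinomZ x n : IntZ X := MkIntZ (int_valued_pbinom x n).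
Definition mbinomQ (m : Mon) : QX := \prod_(x <- finsupp m) pbinom x (m x).
Definition mbinomZ (m : Mon) : IntZ X := \prod_(x <- finsupp m) pbinomZ x (m x).

Lemma val_mbinomZ m : val (mbinomZ m) = mbinomQ m.
Proof. by rewrite /mbinomZ rmorph_prod. Qed.

Lemma pbinom0 (x : X) : pbinom x 0 = 1.
Proof. by rewrite /pbinom big_ord0 fact0 invr1 scale1r. Qed.

Lemma mbinomQ_w (m : Mon) (D : {fset X}) :
  (finsupp m `<=` D)%fset -> mbinomQ m = \prod_(x <- D) pbinom x (m x).
Proof.
move=> le; apply: (big_fset_incl _ le) => x _ /fsfun_dflt ->; exact: pbinom0.
Qed.

Lemma prod_fsetD1 (S : comNzRingType) (D : {fset X}) (x : X) (F : X -> S) :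
  x \in D -> \prod_(y <- D) F y = F x * \prod_(y <- (D `\ x)%fset) F y.
Proof. by move=> xD; rewrite (big_fsetD1 x xD). Qed.

(* [P] is a variable, since unification may otherwise compute binomials. *)
Lemma prod_var (P : X -> nat -> QX) (v : QX) (D : {fset X}) (f g : X -> nat) x :
  (forall n, P x n * v = n.+1%:R *: P x n.+1 + n%:R *: P x n) ->
  x \in D -> g x = (f x).+1 -> (forall y, y != x -> g y = f y) ->
  (\prod_(y <- D) P y (f y)) * v =
  (f x).+1%:R *: \prod_(y <- D) P y (g y) + (f x)%:R *: \prod_(y <- D) P y (f y).
Proof.
move=> PS xD gx gf.
rewrite (@prod_fsetD1 QX D x (fun y => P y (f y)) xD).
rewrite (@prod_fsetD1 QX D x (fun y => P y (g y)) xD).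
have -> : \prod_(y <- (D `\ x)%fset) P y (g y) = \prod_(y <- (D `\ x)%fset) P y (f y).
  rewrite big_seq [RHS]big_seq; apply: eq_bigr => y; rewrite !inE => /andP[ne _].
  by rewrite gf.
rewrite gx [LHS]mulrAC PS [LHS]mulrDl.
by rewrite -[X in X + _ = _]scalerAl -[X in _ + X = _]scalerAl.
Qed.

Lemma mbinomQ_var m x : mbinomQ m * pvar rat x =
  (m x).+1%:R *: mbinomQ (mulcm m (ucm x)) + (m x)%:R *: mbinomQ m.
Proof.
pose D := (finsupp m `|` [fset x])%fset.
have xD : x \in D by rewrite !inE eqxx orbT.
have mD : (finsupp m `<=` D)%fset by exact: fsubsetUl.
have m'D : (finsupp (mulcm m (ucm x)) `<=` D)%fset.
  by rewrite [finsupp _](mdomD m (ucm x)) mdomU.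
rewrite (mbinomQ_w mD) (mbinomQ_w m'D); apply: (@prod_var (@pbinom X)) => //; first exact: pbinomS.
  by rewrite mulcmE ucmE eqxx addn1.
by move=> y ne; rewrite mulcmE ucmE eq_sym (negPf ne) addn0.
Qed.

Lemma spanned_monomQ (m : Mon) : spanned mbinomQ (fun=> True) (<< m >> : QX).
Proof.
have mulX q x : spanned mbinomQ (fun=> True) q -> spanned mbinomQ (fun=> True) (q * pvar rat x).
  move=> [w _ ->]; rewrite /lext mulr_suml; apply: spanned_sum => s _.
  rewrite -scalerAl mbinomQ_var; apply: spannedZ.
  by apply: spannedD; apply: spannedZ; exact: spanned_gen.
have [n] := ubnP (mdeg m); elim: n m => // n IH m lt_mn.
have [->|m1] := eqVneq m (onecm X).
  have -> : << onecm X >> = mbinomQ (onecm X) :> QX.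
    by rewrite /mbinomQ [finsupp _]mdom1 big_seq_fset0.
  exact: spanned_gen.
have [x mx] : exists x, m x != 0%N.
  apply: contrapT => no; move/eqP: m1; apply; apply/eqP/cmP => x.
  rewrite onecmE; apply/eqP; apply: contrapT => /negP mx.
  by apply: no; exists x.
have mE : m = mulcm (divcm m (ucm x)) (ucm x).
  apply/eqP/cmP => y; rewrite mulcmE divcmE subnK // ucmE.
  by case: eqVneq => // <-; rewrite lt0n.
have -> : << m >> = << divcm m (ucm x) >> * pvar rat x :> QX.
  by rewrite {1}mE [RHS]fgmulUU mulr1.
apply: mulX; apply: IH; rewrite -ltnS (leq_trans _ lt_mn) // ltnS.
by rewrite {2}mE [X in (_ < X)%N]mdegM mdegU addn1.
Qed.

Lemma spannedQ (q : QX) : spanned mbinomQ (fun=> True) q.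
Proof.
rewrite [q]monalgE; apply: spanned_sum => m _.
rewrite malgU_scale.
by apply: spannedZ; exact: spanned_monomQ.
Qed.

Lemma binz_nat n (a : nat) : binz n a%:Z = 'C(a, n)%:Z.
Proof.
have f0 : (n`!%:R : int) != 0 by rewrite Num.Theory.pnatr_eq0 -lt0n fact_gt0.
apply: (mulfI f0); rewrite fact_binz -[a%:Z]natz prod_natB.
by rewrite -bin_ffact natrM mulrC -[X in _ = _ * X]natz.
Qed.

Lemma peval_mbinomQ (a m : Mon) :
  peval (fun x => (a x)%:Z) (mbinomQ m) = (mbin a m)%:R.
Proof.
rewrite /mbinomQ [LHS](rmorph_prod (peval _)) /mbin natr_prod.
by apply: eq_bigr => x _; rewrite /= peval_pbinom binz_nat.
Qed.

(** Polya's theorem in several variables: the rational coefficients in the binomial basis are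
    integers, by [triangular] applied to the integral values on N^X. *)
Lemma spannedZ_binom (q : IntZ X) : spanned mbinomZ (fun=> True) q.
Proof.
have [w _ qw] := spannedQ (val q).
have wZ m : m \in msupp w -> w@_m \is a Num.int.
  apply: (@triangular _ _ (@mdeg X) mbin _ _ w (fun c => c \is a Num.int)).
  - exact: mbin_diag.
  - move=> a s; have := @tbin_deg 1 [tuple a] [tuple s].
    rewrite /tbin /tdeg !big_ord1 /= !tnth0 => H b0 ne; apply: H => //.
    by apply: contra ne => /eqP/(congr1 val) [->].
  - exact: rpred0.
  - by move=> u v; exact: rpredB.
  move=> a _; have /int_valuedP/(_ (fun x => (a x)%:Z)) : val q \in @int_valued X by case: q {qw}.
  rewrite qw /lext [peval _ _](raddf_sum (peval _)).
  congr (_ \is a Num.int); apply: eq_bigr => s _.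
  by rewrite -mul_malgC [LHS](rmorphM (peval _)) /= peval_mbinomQ /peval psubst_C mulr_natr.
have -> : q = \sum_(m <- msupp w) (Num.floor w@_m) *: mbinomZ m.
  apply: val_inj; rewrite qw raddf_sum /lext.
  rewrite big_seq [RHS]big_seq; apply: eq_bigr => m mw.
  transitivity (mbinomQ m *~ Num.floor w@_m).
    by rewrite -scaler_int Num.Theory.floorK //; exact: wZ.
  by rewrite -val_mbinomZ; apply/esym; exact: raddfMz.
by apply: spanned_sum => m _; apply: spannedZ; exact: spanned_gen.
Qed.
End Binomials.

Section IntRBasis.
Context (b : base) (X : choiceType).
Local Notation R := (coef b).
Local Notation Mon := {cmonom X}.

Definition mbinom (m : Mon) : IntR b X :=
  match b return IntR b X with
  | BaseZ => mbinomZ m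
  | BaseF p pr_p => IntF_pi pr_p (mbinomZ m)
  end.

(* Over F_p, the exponents of an admissible monomial are less than p. *)
Definition admissible (m : Mon) : Prop := (mfact m)%:R <> 0 :> R.

Definition falling (A : comNzRingType) (g : X -> A) (m : Mon) : A :=
  \prod_(x <- finsupp m) \prod_(i < m x) (g x - i%:R).

Lemma fact_mbinomZ (m : Mon) : (mfact m)%:R * mbinomZ m = falling (@IntZ_var X) m.
Proof.
rewrite /mfact natr_prod -big_split; apply: eq_bigr => x _ /=.
apply: val_inj; rewrite rmorphM rmorph_nat rmorph_prod.
transitivity (\prod_(i < m x) (pvar rat x - i%:R) : {malg rat[Mon]}); first exact: fact_pbinom.
by apply: eq_bigr => i _; rewrite rmorphB rmorph_nat.
Qed.

(** This holds in the algebra itself, also over F_p, where a binomial is not defined by dividing;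
    when the factorial is nonzero in [R] it can be cancelled after evaluation. *)
Lemma fact_mbinom (m : Mon) : (mfact m)%:R * mbinom m = falling (gen b (X := X)) m.
Proof.
rewrite /mbinom; case: b => [|p pr_p]; first exact: fact_mbinomZ.
have := congr1 (@IntF_pi p pr_p X) (fact_mbinomZ m).
rewrite rmorphM rmorph_nat /= => ->; rewrite /falling rmorph_prod.
apply: eq_bigr => x _; rewrite rmorph_prod; apply: eq_bigr => i _.
by rewrite rmorphB rmorph_nat.
Qed.

Lemma fact_ev_mbinom a (m : Mon) : (mfact m)%:R * ev a (mbinom m) = falling a m.
Proof.
rewrite -(rmorph_nat (@ev b X a)) -rmorphM fact_mbinom rmorph_prod.
apply: eq_bigr => x _; rewrite rmorph_prod; apply: eq_bigr => i _.
by rewrite rmorphB rmorph_nat; congr (_ - _); exact: ev_gen.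
Qed.

Lemma coef_mulfI (c u v : R) : c <> 0 -> c * u = c * v -> u = v.
Proof.
move=> c0 e; apply/eqP; rewrite -subr_eq0; apply/eqP.
have : c * (u - v) = 0 by rewrite mulrBr e subrr.
by move=> /coef_mulf_eq0[].
Qed.

Lemma ev_mbinom_nat (a m : Mon) :
  admissible m -> ev (fun x => (a x)%:R) (mbinom m) = (mbin a m)%:R.
Proof.
move=> am; apply: (coef_mulfI am); rewrite fact_ev_mbinom -natrM /mfact /mbin -big_split natr_prod.
by apply: eq_bigr => x _; rewrite prod_natB /= mulnC bin_ffact.
Qed.

Definition cpt : cspace b := @CSpace b (X -> R) (fun f => exists x, f = fun a => a x).

Lemma pol_ev_mbinom m : admissible m -> pol (S := cpt) (fun a => ev a (mbinom m)).
Proof.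
move=> am; apply: (pol_sat am).
apply: (@eq_pol b cpt (fun a => falling a m)) => [a|]; first by rewrite fact_ev_mbinom.
apply: pol_prod => x; apply: pol_prod => i; apply: polB (pol_const _ _).
by apply: pol_coord; exists x.
Qed.

(** A zero factorial forces R = F_p and an exponent at least p; the binomial of that variable is a
    generator of the ideal. *)
Lemma mbinom_nadm m : ~ admissible m -> mbinom m = 0.
Proof.
rewrite /admissible /mbinom; case: b => [|p pr_p] nam.
  case: nam; apply/eqP; rewrite Num.Theory.pnatr_eq0 -lt0n /mfact.
  by apply/prodn_gt0 => x; exact: fact_gt0.
have dvdp : (p %| mfact m)%N.
  rewrite (dvdn_pcharf (pchar_Fp pr_p)); apply/eqP; apply: contrapT => h; exact: nam h.
have [x xm le_px] : exists2 x, x \in finsupp m & (p <= m x)%N.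
  have : exists2 x, x \in (finsupp m : seq X) & (p %| (m x)`!)%N.
    move: dvdp; rewrite /mfact; elim: (finsupp m : seq X) => [|x r IH].
      by rewrite big_nil dvdn1 => /eqP p1; move: (prime_gt1 pr_p); rewrite p1.
    rewrite big_cons Euclid_dvdM // => /orP[d|/IH[y yr d]]; first by exists x; [exact: mem_head|].
    by exists y => //; rewrite inE yr orbT.
  move=> [x xm d]; exists x => //; elim: (m x) d => [|n IH].
    by rewrite fact0 dvdn1 => /eqP p1; move: (prime_gt1 pr_p); rewrite p1.
  rewrite factS Euclid_dvdM // => /orP[/dvdn_leq|/IH]; first exact.
  exact: leqW.
rewrite -(rmorph0 (@IntF_pi p pr_p X)); apply/IntF_piP; rewrite subr0.
apply/IntF_idealP => I idI IS; have [_ _ IM] := idI.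
rewrite /mbinomZ (@prod_fsetD1 _ _ _ x (fun x => pbinomZ x (m x)) xm) mulrC; apply: IM; apply: IS; right.
by exists x, (m x).
Qed.

Lemma spanned_mbinom (q : IntR b X) : spanned mbinom admissible q.
Proof.
have gen_all m : spanned mbinom admissible (mbinom m).
  have [am|nam] := pselect (admissible m); first exact: spanned_gen.
  by rewrite mbinom_nadm //; exact: spanned0.
move: q gen_all; rewrite /mbinom /admissible; case: b => [|p pr_p] q gen_all.
  have [w _ ->] := spannedZ_binom q.
  by apply: spanned_sum => m _; apply: spannedZ; exact: gen_all.
have [w _ e] := spannedZ_binom (IntF_repr q).
rewrite -[q]IntF_reprK e /lext rmorph_sum; apply: spanned_sum => m _.
rewrite [w@_m *: _](_ : _ = mbinomZ m *~ w@_m) // rmorphMz -scaler_int.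
by apply: spannedZ; exact: gen_all.
Qed.

Lemma pol_ev q : pol (S := cpt) (fun a => ev a q).
Proof.
have [w aw ->] := spanned_mbinom q.
have sumE (r : seq Mon) : {subset r <= msupp w} ->
    pol (S := cpt) (fun a => \sum_(m <- r) ev a (w@_m *: mbinom m)).
  elim: r => [|m r IH] rw; first by apply: eq_pol (pol_const _ 0) => a; rewrite big_nil.
  apply: eq_pol (polD (polM (pol_const cpt w@_m) (pol_ev_mbinom (aw m (rw m (mem_head _ _))))) (IH _)) => [a|l lr].
    by rewrite big_cons (linearZ_LR (@ev b X a)).
  by apply: rw; rewrite inE lr orbT.
by apply: eq_pol (sumE _ (fun x => id)) => a; rewrite /lext raddf_sum.
Qed.
End IntRBasis.

(** * The image of psi *)

Local Open Scope quotient_scope.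

Section TuplePower.
Context (b : base) (S : cspace b).

Fixpoint p2t k : cpw S k -> k.-tuple S :=
  match k return cpw S k -> k.-tuple S with
  | 0 => fun=> [tuple]
  | k'.+1 => fun s => cons_tuple s.1 (p2t s.2)
  end.

Fixpoint t2p k : k.-tuple S -> cpw S k :=
  match k return k.-tuple S -> cpw S k with
  | 0 => fun=> tt
  | k'.+1 => fun t => (thead t, t2p (behead_tuple t))
  end.

Lemma p2tK k (s : cpw S k) : t2p (p2t s) = s.
Proof.
elim: k s => [[]//|k IH] [e s] /=; congr (_, _).
by rewrite -[RHS]IH; congr t2p; apply: val_inj.
Qed.

Lemma t2pK k (t : k.-tuple S) : p2t (t2p t) = t.
Proof.
elim: k t => [|k IH] t; first by rewrite tuple0 [RHS]tuple0.
by rewrite /= IH [RHS]tuple_eta.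
Qed.

Lemma polmap_tnth k (i : 'I_k) : polmap (fun s : cpw S k => tnth (p2t s) i).
Proof.
elim: k i => [[]//|k IH] i.
have -> : (fun s : cpw S k.+1 => tnth (p2t s) i) =
    fun s => if unlift ord0 i is Some j then tnth (p2t s.2) j else s.1.
  apply: funext => s; case: unliftP => [j|] -> /=.
    by rewrite tnthS.
  by rewrite tnth0.
case: (unlift ord0 i) => [j|].
  by apply: (polmap_comp (IH j)); exact: (@polmap_snd _ (cpw S k.+1) S (cpw S k) _ (@polmap_id _ _)).
exact: (@polmap_fst _ (cpw S k.+1) S (cpw S k) _ (@polmap_id _ _)).
Qed.

Lemma coord_cpw k f : @is_coord b (cpw S k) f ->
  exists (i : 'I_k) h, @is_coord b S h /\ f = fun s => h (tnth (p2t s) i).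
Proof.
elim: k f => [//|k IH] f [[g cg ->]|[g cg ->]].
  by exists ord0, g; split.
have [i [h [ch ->]]] := IH g cg.
exists (lift ord0 i), h; split=> //; apply: funext => s.
by rewrite /= tnthS.
Qed.
End TuplePower.

Section PsiImage.
Context (b : base) (X : choiceType).
Local Notation R := (coef b).
Local Notation Mon := {cmonom X}.
Local Notation A := (aug b X).
Local Notation pt := (cpt b X).

Lemma tpow_ind (M : lmodType R) k (P : tpow M k -> Prop) :
  P 0 -> (forall c u v, P u -> P v -> P (c *: u + v)) -> (forall s, P (tpure s)) ->
  forall t, P t.
Proof.
move=> P0 Plin Ppure t; rewrite -[t]reprK; set w := repr t.
have piE : forall r : seq (k.-tuple M), P (\sum_(s <- r) w@_s *: tpure s).
  elim=> [|s r IH]; first by rewrite big_nil.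
  by rewrite big_cons; exact: Plin.
have -> : \pi_(tpow M k) w = \sum_(s <- msupp w) w@_s *: tpure s; last exact: piE.
rewrite {1}[w]monalgE raddf_sum; apply: eq_bigr => s _.
by rewrite /tpure tpow_scaleE malgU_scale.
Qed.

Lemma psi_linear k c (t u : TR b X k) a : psi (c *: t + u) a = c * psi t a + psi u a.
Proof. exact: (tlift_linear (psi_multilinear a) c t u). Qed.

Lemma psi0 k a : psi (0 : TR b X k) a = 0.
Proof. by have := psi_linear (-1) (0 : TR b X k) 0 a; rewrite scaler0 addr0 mulN1r addNr. Qed.

Lemma psiD k (t u : TR b X k) a : psi (t + u) a = psi t a + psi u a.
Proof. by have := psi_linear 1 t u a; rewrite scale1r mul1r. Qed.

Lemma psiZ k c (t : TR b X k) a : psi (c *: t) a = c * psi t a.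
Proof. by have := psi_linear c t 0 a; rewrite addr0 psi0 addr0. Qed.

Lemma psiN k (t : TR b X k) a : psi (- t) a = - psi t a.
Proof. by rewrite -scaleN1r psiZ mulN1r. Qed.

Lemma psi_sum k (I : Type) (r : seq I) (F : I -> TR b X k) a :
  psi (\sum_(i <- r) F i) a = \sum_(i <- r) psi (F i) a.
Proof.
elim: r => [|i r IH]; first by rewrite !big_nil psi0.
by rewrite !big_cons psiD IH.
Qed.

Lemma augP_subproof (q : IntR b X) : q - (ev (fun=> 0) q)%:A \in @aug_pred b X.
Proof. by rewrite inE raddfB /= (linearZ_LR (@ev b X _)) /= (ev_monoid _).1 mulr1 subrr. Qed.
Definition augP q : A := MkAug (augP_subproof q).

Lemma augP_linear : linear augP.
Proof.
move=> c u v; apply: val_inj; rewrite /= ev_linear scalerDl -scalerA.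
by rewrite scalerBr opprD addrACA.
Qed.

Lemma augP0 : augP 0 = 0.
Proof. by have := augP_linear (-1) 0 0; rewrite !scaleN1r oppr0 addr0 addNr. Qed.

Lemma augP_sum (I : Type) (r : seq I) (c : I -> R) (F : I -> IntR b X) :
  augP (\sum_(i <- r) c i *: F i) = \sum_(i <- r) c i *: augP (F i).
Proof.
elim: r => [|i r IH]; first by rewrite !big_nil augP0.
by rewrite !big_cons augP_linear IH.
Qed.

Lemma augP_val (q : A) : augP (val q) = q.
Proof. by apply: val_inj; rewrite /= aug0 scale0r subr0. Qed.

Lemma ev_augP a q : ev a (val (augP q)) = ev a q - ev (fun=> 0) q.
Proof. by rewrite /= raddfB /= (linearZ_LR (@ev b X _)) /= (ev_monoid _).1 mulr1. Qed.

Lemma mbinom1 : mbinom b (onecm X) = 1.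
Proof.
have s0 : finsupp (onecm X) = fset0 := @mdom1 X.
have mZ : mbinomZ (onecm X) = 1 by rewrite /mbinomZ s0 big_seq_fset0.
by rewrite /mbinom; case: b => [|p pr_p]; rewrite mZ // rmorph1.
Qed.

Lemma ev0_mbinom m : admissible b m -> m != onecm X -> ev (fun=> 0) (mbinom b m) = 0.
Proof.
move=> am m1; have := ev_mbinom_nat (onecm X) am.
have -> : (fun x => (onecm X x)%:R) = (fun=> 0) :> (X -> R).
  by apply: funext => x; rewrite onecmE.
move=> ->; have [x mx] : exists x, x \in finsupp m.
  apply/fset0Pn; apply: contra m1 => /eqP m0; apply/cmP => x.
  by apply/eqP; rewrite onecmE cmE_eq0 m0 inE.
rewrite /mbin (big_fsetD1 x) //= onecmE bin0n.
by move: mx; rewrite -cmE_neq0 => /negPf ->.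
Qed.

Definition good (m : Mon) : Prop := admissible b m /\ m != onecm X.
Definition augB (m : Mon) : A := augP (mbinom b m).

Lemma spanned_augB (q : A) : spanned augB good q.
Proof.
have [w aw e] := spanned_mbinom (val q).
rewrite -[q]augP_val e /lext augP_sum; apply: spanned_sum => m mw; apply: spannedZ.
have [->|m1] := eqVneq m (onecm X).
  have -> : augP (mbinom b (onecm X)) = 0.
    by apply: val_inj; rewrite /= mbinom1 (ev_monoid _).1 scale1r subrr.
  exact: spanned0.
by apply: (spanned_gen augB); split=> //; exact: aw.
Qed.

Definition natpt k (a : k.-tuple Mon) : k.-tuple (X -> R) :=
  map_tuple (fun (m : Mon) (x : X) => (m x)%:R : R) a.

Lemma psi_augB_nat k (a js : k.-tuple Mon) : (forall i, good (tnth js i)) ->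
  psi (tpure (map_tuple augB js)) (natpt a) = (tbin a js)%:R.
Proof.
move=> gjs; rewrite psi_pure /tbin natr_prod; apply: eq_bigr => i _.
have [am m1] := gjs i; rewrite !tnth_map ev_augP ev0_mbinom // subr0.
exact: ev_mbinom_nat.
Qed.

Lemma psi_inj k (t : TR b X k) : (forall a, psi t a = 0) -> t = 0.
Proof.
move=> t0; have {t0} : exists2 w : {malg R[k.-tuple Mon]},
    (forall s, s \in msupp w -> forall i, good (tnth s i)) &
    t = lext (fun js => tpure (map_tuple augB js)) w /\ (forall a, psi t a = 0).
  suff [w gw tw] : spanned (fun js => tpure (map_tuple augB js) : TR b X k)
    (fun js => forall i, good (tnth js i)) t by exists w.
  elim/tpow_ind: t {t0} => [|c u v su sv|s]; first exact: spanned0.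
    exact: spanned_lin.
  apply: (spanned_multilinear (g := @tpure R A k) (B := augB)); first exact: tpure_multilinear.
  exact: spanned_augB.
move=> [w gw [tw t0]].
have w0 s : s \in msupp w -> w@_s = 0.
  apply: (@triangular _ _ (@tdeg X k) (@tbin X k) _ _ w (fun c => c = 0)) => //.
  - exact: tbin_diag.
  - exact: tbin_deg.
  - by move=> u v -> ->; rewrite subrr.
  move=> a _; rewrite -[RHS](t0 (natpt a)) tw /lext psi_sum.
  rewrite big_seq [RHS]big_seq; apply: eq_bigr => js jsw.
  by rewrite psiZ psi_augB_nat ?mulr_natr //; exact: gw.
by rewrite tw /lext big_seq big1 // => s sw; rewrite w0 // scale0r.
Qed.

Lemma psi_eq k (t u : TR b X k) : (forall a, psi t a = psi u a) -> t = u.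
Proof.
move=> e; apply/eqP; rewrite -subr_eq0; apply/eqP/psi_inj => a.
by rewrite psiD psiN e subrr.
Qed.
End PsiImage.

Section PsiPolynomials.
Context (b : base) (X : choiceType).
Local Notation R := (coef b).
Local Notation Mon := {cmonom X}.
Local Notation A := (aug b X).
Local Notation pt := (cpt b X).
Local Notation t2pX := (@t2p b pt _).

(** The formula of [psi] without the condition on constant terms: binomial expansions of polynomial
    functions pass through non-normalized terms, which [nproj] removes afterwards. *)
Definition pfun k (q : k.-tuple (IntR b X)) (a : k.-tuple (X -> R)) : R :=
  \prod_(i < k) ev (tnth a i) (tnth q i).

Lemma pfun_cons k (q : k.+1.-tuple (IntR b X)) e (a : k.-tuple (X -> R)) :
  pfun q (cons_tuple e a) = ev e (thead q) * pfun (behead_tuple q) a.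
Proof.
rewrite /pfun big_ord_recl tnth0; congr (_ * _); apply: eq_bigr => i _.
by rewrite tnthS tnth_behead; congr (ev _ (tnth q _)); apply: val_inj; rewrite /= inordK // ltnS.
Qed.

Lemma pol_pfun k (q : k.-tuple (IntR b X)) : pol (fun s : cpw pt k => pfun q (p2t s)).
Proof.
apply: pol_prod => i.
exact: (pol_comp (@polmap_tnth b pt k i) (pol_ev (tnth q i))).
Qed.

Lemma pfun_multilinear k :
  multilinear (V := (k.-tuple (X -> R) -> R^o) : lmodType R) (@pfun k).
Proof.
move=> s i c u v; apply: funext => a.
have D w : pfun (tupd s i w) a = ev (tnth a i) w * \prod_(j < k | j != i) ev (tnth a j) (tnth s j).
  rewrite /pfun (bigD1 i) //= tnth_mktuple eqxx; congr (_ * _).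
  by apply: eq_bigr => j /negPf ji; rewrite tnth_mktuple ji.
by rewrite D /= [RHS]/(c * pfun _ a + pfun _ a) !D ev_linear mulrDl -mulrA.
Qed.

Definition pspan k (f : k.-tuple (X -> R) -> R^o) : Prop :=
  spanned (V := (k.-tuple (X -> R) -> R^o) : lmodType R)
    (fun js : k.-tuple Mon => pfun (map_tuple (mbinom b (X := X)) js))
    (fun js => forall i, admissible b (tnth js i)) f.

Lemma pspan_pfun k (q : k.-tuple (IntR b X)) : pspan (pfun q).
Proof.
apply: (spanned_multilinear (B := mbinom b (X := X)) (Q := @admissible b X)).
  exact: pfun_multilinear.
exact: spanned_mbinom.
Qed.

Lemma pfun_coord k (q : k.-tuple (IntR b X)) i x a :
  tnth a i x * pfun q a = pfun (tupd q i (gen b x * tnth q i)) a.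
Proof.
rewrite /pfun [in LHS](bigD1 i) //= [in RHS](bigD1 i) //= tnth_mktuple eqxx.
rewrite (ev_monoid _).2 ev_gen mulrA; congr (_ * _).
by apply: eq_bigr => j /negPf ji; rewrite tnth_mktuple ji.
Qed.

Lemma fct_sumE (T I : Type) (r : seq I) (F : I -> T -> R^o) a :
  (\sum_(i <- r) F i : T -> R^o) a = \sum_(i <- r) F i a.
Proof. by elim: r => [|i r IH]; rewrite ?big_nil // !big_cons -IH. Qed.

Lemma alg_pspan k (f : cpw pt k -> R) : alg f -> pspan (fun a => f (t2pX a)).
Proof.
elim=> [c|g h cg _ IH|g h _ IH1 _ IH2].
- have -> : (fun=> c) = c *: (pfun [tuple of nseq k 1] : k.-tuple (X -> R) -> R^o).
    apply: funext => a; rewrite -[RHS]/(c * pfun _ a) /pfun big1 ?mulr1 // => i _.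
    by rewrite tnth_nseq (ev_monoid _).1.
  by apply: spannedZ; exact: pspan_pfun.
- have [i [_ [[x ->] ->]]] := coord_cpw cg.
  have [w aw hw] := IH.
  have -> : (fun a => tnth (p2t (t2pX a)) i x * h (t2pX a)) =
      \sum_(js <- msupp w) w@_js *: (pfun (tupd (map_tuple (mbinom b (X := X)) js) i
        (gen b x * tnth (map_tuple (mbinom b (X := X)) js) i)) : k.-tuple (X -> R) -> R^o).
    apply: funext => a; rewrite t2pK -[h _]/((fun a => h (t2pX a)) a) hw /lext !fct_sumE mulr_sumr.
    apply: eq_bigr => js _.
    transitivity (tnth a i x * (w@_js * pfun (map_tuple (mbinom b (X := X)) js) a)) => //.
    by rewrite mulrCA pfun_coord.
  by apply: spanned_sum => js _; apply: spannedZ; exact: pspan_pfun.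
- exact: spannedD IH1 IH2.
Qed.

Lemma pfun_nat k (a js : k.-tuple Mon) : (forall i, admissible b (tnth js i)) ->
  pfun (map_tuple (mbinom b (X := X)) js) (natpt b a) = (tbin a js)%:R.
Proof.
move=> ajs; rewrite /pfun /tbin natr_prod; apply: eq_bigr => i _.
by rewrite !tnth_map; exact: ev_mbinom_nat.
Qed.

(** Saturation adds nothing beyond binomials: since f has values in [R] on natural points, those of
    N f are multiples of N, and by [triangular] so are its binomial coefficients, which can then be
    divided. *)
Lemma pol_pspan k (f : cpw pt k -> R) : pol f -> pspan (fun a => f (t2pX a)).
Proof.
move=> [N [N0 /alg_pspan[w aw Nf]]].
have NfE a : N%:R * f (t2pX a) = \sum_(js <- msupp w) w@_js * pfun (map_tuple (mbinom b (X := X)) js) a.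
  by rewrite -[LHS]/((fun a => N%:R * f (t2pX a)) a) Nf /lext fct_sumE.
have dvd s : s \in msupp w -> exists r, w@_s = N%:R * r.
  apply: (@triangular _ _ (@tdeg X k) (@tbin X k) _ _ w (fun c => exists r, c = N%:R * r)).
  - exact: tbin_diag.
  - exact: tbin_deg.
  - by exists 0; rewrite mulr0.
  - by move=> u v [r ->] [r' ->]; exists (r - r'); rewrite mulrBr.
  move=> a _; exists (f (t2pX (natpt b a))); rewrite NfE.
  rewrite big_seq [RHS]big_seq; apply: eq_bigr => js jsw.
  by rewrite pfun_nat ?mulr_natr //; exact: aw.
have [g [csection Ng]] : exists g, pspan g /\ forall a, N%:R * g a =
    \sum_(js <- msupp w) w@_js * pfun (map_tuple (mbinom b (X := X)) js) a.
  have : {subset (msupp w : seq _) <= msupp w} by [].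
  elim: (msupp w : seq _) => [|js r IH] rw.
    by exists 0; split=> [|a]; [exact: spanned0|rewrite big_nil mulr0].
  have [l lr|g [csection Ng]] := IH; first by apply: rw; rewrite inE lr orbT.
  have jsw := rw js (mem_head _ _); have [c wc] := dvd _ jsw.
  exists (c *: (pfun (map_tuple (mbinom b (X := X)) js) : k.-tuple (X -> R) -> R^o) + g).
  split=> [|a]; first by apply: spanned_lin => //; exact: pspan_pfun.
  rewrite big_cons -Ng wc -[X in N%:R * X]/(c * pfun _ a + g a); ring.
have -> : (fun a => f (t2pX a)) = g; last exact: csection.
by apply: funext => a; apply: (coef_mulfI N0); rewrite NfE Ng.
Qed.

Section Group.
Variables (mulG : pt -> pt -> pt).
Hypotheses (mulGA : associative mulG) (mulG1 : right_id (fun=> 0) mulG)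
  (mul1G : left_id (fun=> 0) mulG).
Hypothesis mulG_polmap : polmap (S := cprod pt pt) (S' := pt) (fun s => mulG s.1 s.2).

Definition ptmon : pmon b := @PMon b pt mulG (fun=> 0) mulGA mulG1 mul1G mulG_polmap.

Definition psip k (t : TR b X k) : cpw ptmon k -> R := fun s => psi t (p2t s).

Lemma psip_pure k (q : k.-tuple A) s :
  psip (tpure q) s = pfun (map_tuple val q) (p2t s).
Proof. by rewrite /psip psi_pure; apply: eq_bigr => i _; rewrite tnth_map. Qed.

Lemma npol_psip k (t : TR b X k) : npol (psip t).
Proof.
elim/tpow_ind: t => [|c u v pu pv|q].
- by apply: eq_npol (npol0 _ _) => s; rewrite /psip psi0.
- apply: eq_npol (npolD (npolZ c pu) pv) => s.
  by rewrite /psip psi_linear.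
split; first by apply: eq_pol (pol_pfun (map_tuple val q)) => s; rewrite psip_pure.
have -> : psip (tpure q) = fun s => pfun (map_tuple val q) (p2t s).
  by apply: funext => s; exact: psip_pure.
elim: k q => [|k IH] q; first exact: I.
split=> [s|e].
  rewrite [p2t _]/= pfun_cons.
  have -> : thead (map_tuple val q) = val (thead q) :> IntR b X by rewrite /thead tnth_map.
  by rewrite aug0 mul0r.
have := nrmZ (ev e (thead (map_tuple val q))) (IH (behead_tuple q)).
congr (nrm _); apply: funext => s.
rewrite -[RHS]/(pfun (map_tuple val q) (cons_tuple e (p2t s))) pfun_cons; congr (_ * pfun _ _).
by apply: val_inj; rewrite /= behead_map.
Qed.

(* The projection of the functions of k variables onto the normalized ones. *)
Fixpoint nproj k : (cpw ptmon k -> R) -> cpw ptmon k -> R :=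
  match k return (cpw ptmon k -> R) -> cpw ptmon k -> R with
  | 0 => fun f s => f s
  | k'.+1 => fun f s => nproj (fun t => f (s.1, t)) s.2 - nproj (fun t => f (pone ptmon, t)) s.2
  end.

Lemma nproj_linear k c (f g : cpw ptmon k -> R) s :
  nproj (fun t => c * f t + g t) s = c * nproj f s + nproj g s.
Proof.
elim: k f g s => [|k IH] f g s //=.
by rewrite (IH (fun t => f (s.1, t)) (fun t => g (s.1, t)))
  (IH (fun t => f (fun=> 0, t)) (fun t => g (fun=> 0, t))); ring.
Qed.

Lemma nproj0 k s : nproj (fun _ : cpw ptmon k => 0) s = 0.
Proof. by elim: k s => [|k IH] s //=; rewrite !IH subrr. Qed.

Lemma nproj_nrm k (f : cpw ptmon k -> R) s : nrm f -> nproj f s = f s.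
Proof.
elim: k f s => [|k IH] f s //= [f1 nf]; rewrite (IH (fun t => f (s.1, t))) //.
rewrite (_ : (fun t => f (_, t)) = fun=> 0) ?nproj0 ?subr0; first by case: s.
by apply: funext => t; exact: f1.
Qed.

Lemma nproj_pfun k (q : k.-tuple (IntR b X)) s :
  nproj (fun t => pfun q (p2t t)) s = psip (tpure (map_tuple (@augP b X) q)) s.
Proof.
rewrite psip_pure; elim: k q s => [|k IH] q s; first by rewrite /= /pfun !big_ord0.
case: s => e s; rewrite -[RHS]/(pfun _ (cons_tuple e (p2t s))) pfun_cons.
have nE e' : nproj (fun t => pfun q (p2t (((e', t)) : cpw ptmon k.+1))) s =
    ev e' (thead q) * pfun (map_tuple val (map_tuple (@augP b X) (behead_tuple q))) (p2t s).
  rewrite -IH -[RHS]addr0 -[X in _ + X](nproj0 s) -nproj_linear; congr (nproj _ s).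
  by apply: funext => t; rewrite -[LHS]/(pfun q (cons_tuple e' (p2t t))) pfun_cons addr0.
rewrite /= (nE e) (nE (fun=> 0)) -mulrBl; congr (_ * _).
  by rewrite /thead !tnth_map ev_augP.
by congr (pfun _ _); apply: val_inj; rewrite /= !behead_map.
Qed.

(** A normalized f is fixed by [nproj], and [nproj] turns each factor q of its binomial expansion
    into q - q(0), giving a tensor. *)
Lemma npol_psipP k (f : cpw ptmon k -> R) : npol f -> exists t, forall s, psip t s = f s.
Proof.
move=> [/pol_pspan[w _ fw] nf].
exists (\sum_(js <- msupp w) w@_js *: tpure (map_tuple (@augP b X) (map_tuple (mbinom b (X := X)) js))).
move=> s; rewrite -(nproj_nrm s nf).
have -> : f = fun t => \sum_(js <- msupp w) w@_js * pfun (map_tuple (mbinom b (X := X)) js) (p2t t).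
  apply: funext => t; rewrite -{1}[t]p2tK -[LHS]/((fun a => f (t2pX a)) (p2t t)) fw /lext.
  by rewrite fct_sumE.
rewrite /psip psi_sum; elim: (msupp w : seq _) => [|js r IH].
  rewrite big_nil -[LHS](nproj0 s); congr (nproj _ s).
  by apply: funext => t; rewrite big_nil.
rewrite big_cons IH psiZ -[psi _ _]/(psip _ s) -nproj_pfun -nproj_linear.
by congr (nproj _ s); apply: funext => t; rewrite big_cons.
Qed.
End Group.
End PsiPolynomials.

(** * The dga of a polynomial group *)

Section CupProducts.
Context (b : base) (M : pmon b).
Local Notation R := (coef b).

Fixpoint lpart k l : cpw M (k + l) -> cpw M k :=
  match k return cpw M (k + l) -> cpw M k with
  | 0 => fun=> tt
  | k'.+1 => fun s => (s.1, lpart s.2)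
  end.
Fixpoint rpart k l : cpw M (k + l) -> cpw M l :=
  match k return cpw M (k + l) -> cpw M l with
  | 0 => fun s => s
  | k'.+1 => fun s => rpart s.2
  end.
(* The same decomposition for (k + l).+1 = k + l.+1, without a cast. *)
Fixpoint lpartS k l : cpw M (k + l).+1 -> cpw M k :=
  match k return cpw M (k + l).+1 -> cpw M k with
  | 0 => fun=> tt
  | k'.+1 => fun s => (s.1, lpartS s.2)
  end.
Fixpoint rpartS k l : cpw M (k + l).+1 -> cpw M l.+1 :=
  match k return cpw M (k + l).+1 -> cpw M l.+1 with
  | 0 => fun s => s
  | k'.+1 => fun s => rpartS s.2
  end.

Definition cup k l (f : cpw M k -> R) (g : cpw M l -> R) : cpw M (k + l) -> R :=
  fun s => f (lpart s) * g (rpart s).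
Definition cupS k l (f : cpw M k -> R) (h : cpw M l.+1 -> R) : cpw M (k + l).+1 -> R :=
  fun s => f (lpartS s) * h (rpartS s).

Lemma val_parts k l (s : cpw M (k + l)) :
  p2t s = p2t (lpart s) ++ p2t (rpart s) :> seq M.
Proof. by elim: k s => [|k IH] s //=; rewrite IH. Qed.

Lemma val_partsS k l (s : cpw M (k + l).+1) :
  p2t s = p2t (lpartS s) ++ p2t (rpartS s) :> seq M.
Proof. by elim: k s => [|k IH] s //=; rewrite -IH. Qed.

(** The last face of f and the face d_0 of g give opposite terms; the other faces are those of the
    product. *)
Lemma inner_cup k l (f : cpw M k -> R) (g : cpw M l -> R) s :
  inner (cup f g) s =
  cup (k := k.+1) (inner f) g s + (-1) ^+ k.+1 * cupS f (bdiff g) s.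
Proof.
elim: k f s => [|k IH] f s.
  case: s => e s; rewrite /cup /cupS /bdiff /= expr1.
  have -> : inner (fun t => f tt * g t) (e, s) = f tt * inner g (e, s).
    rewrite -[RHS]addr0 -[X in _ + X](@inner0 b M l (e, s)) -inner_linear.
    by congr (inner _ _); apply: funext => t; rewrite addr0.
  by ring.
case: s => e [e' s]; rewrite innerS.
have := IH (fun t => f (e, t)) (e', s).
rewrite -[inner (cup (fun t => f (e, t)) g) _]/(inner (fun t => cup f g (e, t)) (e', s)) => ->.
rewrite /cup /cupS [(-1) ^+ k.+2]exprS /=; ring.
Qed.

Lemma bdiff_cup k l (f : cpw M k -> R) (g : cpw M l -> R) s :
  bdiff (cup f g) s = cup (k := k.+1) (bdiff f) g s + (-1) ^+ k * cupS f (bdiff g) s.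
Proof.
rewrite {1}/bdiff inner_cup exprS; case: s => e s.
rewrite {2}/cup {2}/bdiff /cup /=; ring.
Qed.
End CupProducts.

Section TensorEvaluation.
Context (b : base) (X : choiceType).
Local Notation R := (coef b).
Local Notation A := (aug b X).

Lemma cat_tupdl (M : lmodType R) k l i u (q : k.-tuple M) (q' : l.-tuple M) :
  cat_tuple (tupd q i u) q' = tupd (cat_tuple q q') (lshift l i) u.
Proof.
apply: eq_from_tnth => j; rewrite tnth_mktuple.
case: (split_ordP j) => j' ->; rewrite ?tnth_lshift ?tnth_rshift ?tnth_mktuple.
  by rewrite (inj_eq (@lshift_inj _ _)).
by rewrite eq_rlshift.
Qed.

Lemma cat_tupdr (M : lmodType R) k l i u (q : k.-tuple M) (q' : l.-tuple M) :
  cat_tuple q (tupd q' i u) = tupd (cat_tuple q q') (rshift k i) u.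
Proof.
apply: eq_from_tnth => j; rewrite tnth_mktuple.
case: (split_ordP j) => j' ->; rewrite ?tnth_lshift ?tnth_rshift ?tnth_mktuple.
  by rewrite eq_lrshift.
by rewrite (inj_eq (@rshift_inj _ _)).
Qed.

Lemma tmul_linearr k l (t : TR b X k) : linear (@tmul R A k l t).
Proof.
move=> c u v; apply: tlift_fun_linear => r; apply: tlift_linear => s i d x y.
by rewrite !cat_tupdr tpure_multilinear.
Qed.

Lemma tmul_linearl k l (u : TR b X l) : linear (fun t : TR b X k => tmul t u).
Proof.
move=> c t t'; apply: tlift_linear => s i d x y; apply: tlift_fun_linear => r.
by rewrite !cat_tupdl tpure_multilinear.
Qed.

Lemma linear_eq0 (U V : lmodType R) (f : U -> V) : linear f -> f 0 = 0.
Proof. by move=> lf; have := lf (-1) 0 0; rewrite scaler0 addr0 scaleN1r addNr. Qed.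

Lemma psi_tmul k l (t : TR b X k) (u : TR b X l) (a : (k + l).-tuple (X -> R))
    (a1 : k.-tuple (X -> R)) (a2 : l.-tuple (X -> R)) :
  val a = a1 ++ a2 -> psi (tmul t u) a = psi t a1 * psi u a2.
Proof.
move=> ae; have {ae} -> : a = cat_tuple a1 a2 by apply: val_inj.
elim/tpow_ind: t => [|c v v' IH IH'|q].
- by rewrite (linear_eq0 (tmul_linearl u)) !psi0 mul0r.
- by rewrite tmul_linearl !psi_linear IH IH' mulrDl mulrA.
elim/tpow_ind: u => [|c v v' IH IH'|q'].
- by rewrite (linear_eq0 (tmul_linearr _)) !psi0 mulr0.
- rewrite (tmul_linearr (tpure q) c v v').
  rewrite psi_linear (psi_linear c v v').
  by rewrite [LHS](congr2 (fun x y => c * x + y) IH IH'); ring.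
rewrite tmul_pure !psi_pure big_split_ord; congr (_ * _); apply: eq_bigr => i _.
  by rewrite !tnth_lshift.
by rewrite !tnth_rshift.
Qed.

Lemma psi_ecast m n (e : m = n) (t : TR b X m) (a : n.-tuple (X -> R)) (a' : m.-tuple (X -> R)) :
  val a = val a' -> psi (ecast n (TR b X n) e t) a = psi t a'.
Proof. by case: n / e a => a ae; congr psi; apply: val_inj. Qed.

Lemma psi_tpair (p q : A) a a' : psi (tpair p q) [tuple a; a'] = ev a (val p) * ev a' (val q).
Proof. by rewrite psi_pure big_ord_recl big_ord1 !(tnth0, tnthS). Qed.

Lemma cup1_linear (c : A) : linear (fun t : TR b X 2 => cup1 t c).
Proof.
move=> d t t'; apply: tlift_linear; apply: bilin_multilinear => q e u v /=.
  by rewrite augM_linearl !tpair_linearl addrACA scalerDr.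
by rewrite augM_linearl !tpair_linearr addrACA scalerDr.
Qed.

Lemma circ_linearl (u : TR b X 2) : linear (fun t : TR b X 2 => circ t u).
Proof.
move=> d t t'; apply: tlift_linear; apply: bilin_multilinear => q e v w /=.
  by apply: tlift_fun_linear => s; rewrite /bilin augM_linearl tpair_linearl.
by apply: tlift_fun_linear => s; rewrite /bilin augM_linearl tpair_linearr.
Qed.

Lemma circ_linearr (t : TR b X 2) : linear (circ t).
Proof.
move=> d u u'; apply: tlift_fun_linear => s; apply: tlift_linear.
apply: bilin_multilinear => q e v w /=.
  by rewrite augM_linearr tpair_linearl.
by rewrite augM_linearr tpair_linearr.
Qed.

Lemma tuple2E (T : Type) (s : 2.-tuple T) : s = [tuple tnth s ord0; tnth s ord_max].
Proof.
case/tupleP: s => x s; case/tupleP: s => y s; rewrite (tuple0 s).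
exact: val_inj.
Qed.

Lemma ev_augM a (p q : A) : ev a (val (augM p q)) = ev a (val p) * ev a (val q).
Proof. exact: (ev_monoid a).2. Qed.

Lemma psi_cup1 (t : TR b X 2) (c : A) a a' :
  psi (cup1 t c) [tuple a; a'] = psi t [tuple a; a'] * (ev a (val c) + ev a' (val c)).
Proof.
elim/tpow_ind: t => [|d v v' IH IH'|q].
- by rewrite (linear_eq0 (cup1_linear c)) !psi0 mul0r.
- by rewrite cup1_linear !psi_linear IH IH' mulrDl mulrA.
rewrite (tuple2E q); move: (tnth q ord0) (tnth q ord_max) => q1 q2.
rewrite -[tpure _]/(tpair q1 q2) cup1_pure psiD.
rewrite [LHS](congr2 (fun x y => x + y) (psi_tpair (augM q1 c) q2 a a') (psi_tpair q1 (augM q2 c) a a')).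
rewrite [X in _ = X * _](psi_tpair q1 q2 a a').
rewrite (ev_augM a) (ev_augM a'); ring.
Qed.

Lemma psi_circ (t u : TR b X 2) a a' :
  psi (circ t u) [tuple a; a'] = psi t [tuple a; a'] * psi u [tuple a; a'].
Proof.
elim/tpow_ind: t => [|d v v' IH IH'|q].
- by rewrite (linear_eq0 (circ_linearl u)) !psi0 mul0r.
- by rewrite circ_linearl !psi_linear IH IH' mulrDl mulrA.
elim/tpow_ind: u => [|d v v' IH IH'|q'].
- by rewrite (linear_eq0 (circ_linearr _)) !psi0 mulr0.
- rewrite (circ_linearr (tpure q) d v v').
  rewrite psi_linear (psi_linear d v v').
  by rewrite [LHS](congr2 (fun x y => d * x + y) IH IH'); ring.
rewrite (tuple2E q) (tuple2E q'); move: (tnth q ord0) (tnth q ord_max) (tnth q' ord0) (tnth q' ord_max) => q1 q2 q1' q2'.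
rewrite -[tpure [tuple q1; q2]]/(tpair q1 q2) -[tpure [tuple q1'; q2']]/(tpair q1' q2') circ_pure.
rewrite [LHS](psi_tpair (augM q1 q1') (augM q2 q2') a a').
rewrite [RHS](congr2 (fun x y => x * y) (psi_tpair q1 q2 a a') (psi_tpair q1' q2' a a')).
rewrite (ev_augM a) (ev_augM a'); ring.
Qed.
End TensorEvaluation.

Section GroupDga.
Context (b : base) (Z : choiceType).
Local Notation R := (coef b).
Local Notation pt := (cpt b Z).
Variables (mulG : pt -> pt -> pt).
Hypotheses (mulGA : associative mulG) (mulG1 : right_id (fun=> 0) mulG)
  (mul1G : left_id (fun=> 0) mulG).
Hypothesis mulG_polmap : polmap (S := cprod pt pt) (S' := pt) (fun s => mulG s.1 s.2).
Local Notation M := (ptmon mulGA mulG1 mul1G mulG_polmap).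
Local Notation psiM := (@psip b Z mulG mulGA mulG1 mul1G mulG_polmap _).

Lemma psip_inj k (t u : TR b Z k) : (forall s, psiM t s = psiM u s) -> t = u.
Proof. by move=> e; apply: psi_eq => a; have := e (t2p (S := pt) a); rewrite /psip t2pK. Qed.

Lemma psip_linear k c (t u : TR b Z k) s : psiM (c *: t + u) s = c * psiM t s + psiM u s.
Proof. exact: psi_linear. Qed.

Fact bar_lift k (t : TR b Z k) : exists t' : TR b Z k.+1, forall s, psiM t' s = bdiff (psiM t) s.
Proof. by apply: npol_psipP; apply: npol_bdiff; exact: npol_psip. Qed.

(** [bdiff] preserves P, the image of [psi]. The lift is chosen, but injectivity of [psi] makes it
    unique, hence linear in t. *)
Definition gdiff k (t : TR b Z k) : TR b Z k.+1 := projT1 (cid (bar_lift t)).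

Lemma psip_gdiff k (t : TR b Z k) s : psiM (gdiff t) s = bdiff (psiM t) s.
Proof. exact: (projT2 (cid (bar_lift t))). Qed.

Lemma gdiff_linear k : linear (@gdiff k).
Proof.
move=> c t u; apply: psip_inj => s; rewrite psip_linear !psip_gdiff.
have -> : psiM (c *: t + u) = fun s => c * psiM t s + psiM u s.
  by apply: funext => s'; exact: psip_linear.
by rewrite bdiffD bdiffZ.
Qed.
HB.instance Definition _ k :=
  GRing.isLinear.Build R (TR b Z k) (TR b Z k.+1) *:%R (@gdiff k) (@gdiff_linear k).

Lemma gdiff_sq k (t : TR b Z k) : gdiff (gdiff t) = 0.
Proof.
apply: psip_inj => s; rewrite psip_gdiff.
have -> : psiM (gdiff t) = bdiff (psiM t) by apply: funext => s'; exact: psip_gdiff.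
by rewrite dlt_bdiff /psip psi0.
Qed.

Lemma psip_tmul k l (t : TR b Z k) (u : TR b Z l) (s : cpw M (k + l)) :
  psiM (tmul t u) s = cup (psiM t) (psiM u) s.
Proof. by apply: psi_tmul; exact: (@val_parts b M k l s). Qed.

Lemma gdiff_leibniz k l (t : TR b Z k) (u : TR b Z l) :
  gdiff (tmul t u) =
    tmul (gdiff t) u + (-1) ^+ k *: ecast n (TR b Z n) (addnS k l) (tmul t (gdiff u)).
Proof.
apply: psip_inj => s; rewrite psip_gdiff addrC.
have -> : psiM (tmul t u) = cup (psiM t) (psiM u) by apply: funext => s'; exact: psip_tmul.
rewrite bdiff_cup psip_linear addrC; congr (_ * _ + _).
  rewrite /cupS -psip_gdiff /psip.
  pose v := p2t (lpartS s) ++ p2t (rpartS s) : seq pt.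
  have sv : size v == (k + l.+1)%N by rewrite size_cat !size_tuple.
  rewrite (@psi_ecast _ _ _ _ (addnS k l) _ _ (Tuple sv)); last exact: (@val_partsS b M k l s).
  by apply/esym; apply: psi_tmul.
rewrite (psip_tmul (gdiff t) u s) /cup psip_gdiff.
by [].
Qed.

Lemma psi_gdiff_deg1 (p : aug b Z) a a' :
  psi (gdiff (tdeg1 p)) [tuple a; a'] = ev a' (val p) - ev (mulG a a') (val p) + ev a (val p).
Proof.
have psi1 e : psi (tdeg1 p) [tuple e] = ev e (val p) by rewrite psi_pure big_ord1 !tnth0.
have := psip_gdiff (tdeg1 p) ((a, (a', tt)) : cpw M 2).
have -> : psiM (gdiff (tdeg1 p)) (a, (a', tt)) = psi (gdiff (tdeg1 p)) [tuple a; a'].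
  by congr psi; apply: val_inj.
move=> ->; rewrite /bdiff /=.
have pE e : psiM (tdeg1 p) (e, tt) = ev e (val p).
  by rewrite -psi1; congr psi; apply: val_inj.
rewrite !pE; ring.
Qed.

(** This is multiplicativity of evaluation at aa': expand p(aa') q(aa') using p(aa') = p(a) + p(a')
    - dp(a, a') and the same for q. *)
Lemma gdiff_cup1 (p q : aug b Z) :
  gdiff (tdeg1 (augM p q)) =
    - tpair p q - tpair q p
    + cup1 (gdiff (tdeg1 p)) q + cup1 (gdiff (tdeg1 q)) p
    - circ (gdiff (tdeg1 p)) (gdiff (tdeg1 q)).
Proof.
(* The values are passed to an identity between variables, since unification would
   unfold distinct tensors. *)
have sumE (t u v w x : TR b Z 2) y : psi (- t - u + v + w - x) y =
    - psi t y - psi u y + psi v y + psi w y - psi x y.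
  by rewrite !(psiD, psiN).
have id (P P1 P2 Q Q1 Q2 dp dq pq qp cp cq co pq1 pq2 pq3 l : R) :
    l = pq2 - pq3 + pq1 -> pq1 = P * Q -> pq2 = P1 * Q1 -> pq3 = P2 * Q2 ->
    pq = P * Q1 -> qp = Q * P1 -> dp = P1 - P2 + P -> dq = Q1 - Q2 + Q ->
    cp = dp * (Q + Q1) -> cq = dq * (P + P1) -> co = dp * dq ->
    l = - pq - qp + cp + cq - co.
  by move=> -> -> -> -> -> -> -> -> -> -> ->; ring.
apply: psi_eq => s; rewrite (tuple2E s); move: (tnth s ord0) (tnth s ord_max) => a a'.
apply: (etrans _ (esym (sumE _ _ _ _ _ _))).
exact: (id _ _ _ _ _ _ _ _ _ _ _ _ _ _ _ _ _ (psi_gdiff_deg1 _ a a') (ev_augM a p q)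
  (ev_augM a' p q) (ev_augM (mulG a a') p q) (psi_tpair p q a a') (psi_tpair q p a a')
  (psi_gdiff_deg1 p a a') (psi_gdiff_deg1 q a a') (psi_cup1 _ q a a') (psi_cup1 _ p a a')
  (psi_circ _ _ a a')).
Qed.

Definition group_dga : fbdga b Z :=
  @FBDGA b Z (fun k => @gdiff k : {linear TR b Z k -> TR b Z k.+1}) gdiff_sq gdiff_leibniz gdiff_cup1.

Lemma GT_mul_group_dga (a a' : GT group_dga) : GT_mul a a' = mulG a a'.
Proof.
apply: funext => x; rewrite /GT_mul.
have -> : psi (group_dga 1%N (tdeg1 (augX b x))) [tuple a; a'] = a' x - mulG a a' x + a x.
  by rewrite [LHS]psi_gdiff_deg1 /= !ev_gen.
ring.
Qed.
End GroupDga.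

(** * The bar complex and quasi-isomorphisms *)

Section BarComplex.
Context (b : base) (G : magmaType) (M : pmon b) (phi : M -> G).
Local Notation R := (coef b).
Hypothesis phiM : forall x y, phi (pmul x y) = (phi x * phi y)%g.

Definition gtup k (s : cpw M k) : k.-tuple G := map_tuple phi (p2t s).

Lemma gtup_cons k e (s : cpw M k) : gtup ((e, s) : cpw M k.+1) = cons_tuple (phi e) (gtup s).
Proof. exact: val_inj. Qed.

Lemma bar_face0 k (e : G) (s : k.-tuple G) : bar_face ord0 (cons_tuple e s) = s.
Proof. by apply: eq_from_tnth => j; rewrite tnth_mktuple /= tnthS. Qed.

Lemma bar_face1 k (e e' : G) (s : k.-tuple G) :
  bar_face (lift ord0 ord0) (cons_tuple e (cons_tuple e' s)) = cons_tuple (e * e')%g s.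
Proof.
apply: eq_from_tnth => j; rewrite tnth_mktuple.
case: (unliftP ord0 j) => [i|] ->; rewrite /=.
  by rewrite !tnthS.
by rewrite tnth0 tnthS tnth0; congr (_ * _)%g.
Qed.

Lemma bar_faceS k (i : 'I_k.+1) (e : G) (s : k.+1.-tuple G) :
  bar_face (lift ord0 (lift ord0 i)) (cons_tuple e s) = cons_tuple e (bar_face (lift ord0 i) s).
Proof.
apply: eq_from_tnth => j; rewrite tnth_mktuple.
case: (unliftP ord0 j) => [l|] ->; rewrite /=.
  rewrite !tnthS tnth_mktuple /= !/bump /= !add1n !ltnS !eqSS.
  by rewrite (_ : widen_ord _ (lift ord0 l) = lift ord0 (widen_ord (leqnSn k) l)) ?tnthS //; apply: val_inj.
by rewrite tnth0 (_ : widen_ord _ _ = ord0) ?tnth0 //; apply: val_inj.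
Qed.

Lemma inner_bar k (c : bar_cochain G R k) (s : cpw M k.+1) :
  inner (fun u => c (gtup u)) s =
  \sum_(i < k.+1) (-1) ^+ i * c (bar_face (lift ord0 i) (gtup s)).
Proof.
elim: k c s => [|k IH] c s.
  rewrite big_ord_recl big_ord0 addr0 expr0 mul1r; congr c.
  by rewrite [LHS]tuple0 [RHS]tuple0.
case: s => e [e' s]; rewrite innerS.
have -> : (fun t => c (gtup ((e, t) : cpw M k.+1))) = fun t => c (cons_tuple (phi e) (gtup t)).
  by apply: funext => t; rewrite gtup_cons.
rewrite (IH (fun u => c (cons_tuple (phi e) u))) [RHS]big_ord_recl expr0 mul1r; congr (_ + _).
  by rewrite !gtup_cons phiM bar_face1.
rewrite -[LHS]mulN1r mulr_sumr; apply: eq_bigr => i _.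
by rewrite exprS mulrA (gtup_cons e ((e', s) : cpw M k.+1)) bar_faceS.
Qed.

Lemma bar_diff_bdiff k (c : bar_cochain G R k) (s : cpw M k.+1) :
  bar_diff G R c (gtup s) = bdiff (fun u => c (gtup u)) s.
Proof.
rewrite /bar_diff /bdiff big_ord_recl expr0 mul1r inner_bar; congr (_ + _).
  by case: s => e s; rewrite gtup_cons bar_face0.
rewrite -[RHS]mulN1r mulr_sumr; apply: eq_bigr => i _.
by rewrite exprS mulrA.
Qed.
End BarComplex.

Section QuasiIso.
Context (b : base) (X : choiceType) (D : fbdga b X).
Local Notation R := (coef b).
Local Notation pt := (cpt b X).
Variables (mulG : pt -> pt -> pt).
Hypotheses (mulGA : associative mulG) (mulG1 : right_id (fun=> 0) mulG)
  (mul1G : left_id (fun=> 0) mulG).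
Hypothesis mulG_polmap : polmap (S := cprod pt pt) (S' := pt) (fun s => mulG s.1 s.2).
Local Notation M := (ptmon mulGA mulG1 mul1G mulG_polmap).
Local Notation psiM := (@psip b X mulG mulGA mulG1 mul1G mulG_polmap _).

Section FromGroup.
Variables (G : magmaType) (phi : M -> G) (phi' : G -> M).
Hypotheses (phiM : forall x y, phi (pmul x y) = (phi x * phi y)%g)
  (phiK : cancel phi phi') (phi'K : cancel phi' phi).

(** The magma [G] is only identified with [M], which allows both [GT T] and the abstract group E. *)
Definition psiG k (t : TR b X k) : bar_cochain G R k := fun s => psi t (map_tuple phi' s).

Definition pwG k (s : k.-tuple G) : cpw M k := t2p (S := M) (map_tuple phi' s).

Lemma pwGK k (s : k.-tuple G) : gtup phi (pwG s) = s.
Proof.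
rewrite /gtup /pwG t2pK; apply: eq_from_tnth => i.
by rewrite !tnth_map phi'K.
Qed.

Lemma gtupK k (s : cpw M k) : pwG (gtup phi s) = s.
Proof.
rewrite -[RHS]p2tK /pwG; congr t2p; apply: eq_from_tnth => i.
by rewrite !tnth_map phiK.
Qed.

Lemma psiG_gtup k (t : TR b X k) (s : cpw M k) : psiG t (gtup phi s) = psiM t s.
Proof.
rewrite /psiG /psip; congr psi; apply: eq_from_tnth => i.
by rewrite !tnth_map phiK.
Qed.

Lemma bar_diffE k (c : bar_cochain G R k) s :
  bar_diff G R c s = bdiff (fun u => c (gtup phi u)) (pwG s).
Proof. by rewrite -{1}(pwGK s) (bar_diff_bdiff phiM). Qed.

(** If [bdiff f] = psi t, then t is closed and psi t bounds, so t = Du by injectivity in degree k +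
    1. Then f - psi u is closed, and surjectivity in degree k makes it some psi v up to a
    coboundary. *)
Lemma acyc_of_quasi_iso :
  quasi_iso (@diffT _ _ D) (@bar_diff G R) psiG -> forall k, acyc M k.
Proof.
move=> [cm qi] k f ndf.
have psiB n (t u : TR b X n) s : psiG (t - u) s = psiG t s - psiG u s.
  by rewrite /psiG psiD psiN.
have psiTM n (t : TR b X n) s : bdiff (psiM t) s = psiM (D n t) s.
  rewrite -(psiG_gtup (D n t)) -[psiG _]/(psiG (diffT D t)) (cm n).2 bar_diffE gtupK.
  by congr (bdiff _ s); apply: funext => u; rewrite psiG_gtup.
have [t tf] := npol_psipP ndf.
pose c : bar_cochain G R k := fun s => f (pwG s).
have cE : (fun u => c (gtup phi u)) = f by apply: funext => u; rewrite /c gtupK.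
have bc s : bar_diff G R c s = psiG t s.
  by rewrite bar_diffE cE -tf -psiG_gtup pwGK.
have Dt : diffT D t = 0.
  apply: (psip_inj (mulGA := mulGA) (mulG1 := mulG1) (mul1G := mul1G) (mulG_polmap := mulG_polmap)) => s.
  rewrite -[LHS]psiTM (_ : psiM t = bdiff f); last by apply: funext => u; exact: tf.
  by rewrite dlt_bdiff /psip psi0.
have [u tu] : exists u, t = diffT D u.
  have D0 : diffT D (0 : TR b X k.+1) = 0 by exact: (linear0 (D k.+1)).
  have [|u tu] := (qi k.+1).1 t 0 Dt D0; last by exists u; rewrite -tu subr0.
  by exists c; apply: funext => s; rewrite [RHS]bc -[LHS]/(psiG t s - psiG 0 s) -psiB subr0.
pose c' : bar_cochain G R k := fun s => c s - psiG u s.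
have c'E : (fun v => c' (gtup phi v)) = fun v => f v - psiM u v.
  by apply: funext => v; rewrite /c' psiG_gtup -cE.
have dc' : bar_diff G R c' = 0.
  apply: funext => s; rewrite bar_diffE c'E bdiffB psiTM -tf tu.
  exact: subrr.
have [v [_ cv]] := (qi k).2 c' dc'.
have nuv : npol (fun s => psiM u s + psiM v s) by apply: npolD; exact: npol_psip.
move: {dc' nuv} (nuv) cv; case: k f ndf t tf c cE bc Dt u tu c' c'E v => [|k] f ndf t tf c cE bc Dt u tu c' c'E v nuv cv.
  apply: eq_npol nuv => s.
  have := congr1 (fun h => h (gtup phi s)) cv.
  rewrite -[X in X = _]/(psiG v (gtup phi s) - c' (gtup phi s)) psiG_gtup.
  rewrite -[c' _]/((fun v => c' (gtup phi v)) s) c'E => /eqP; rewrite subr_eq0 => /eqP ->.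
  by rewrite addrC subrK.
have [e ve] := cv.
exists (fun s => - e (gtup phi s)); apply: eq_npol nuv => s.
have := congr1 (fun h => h (gtup phi s)) ve.
rewrite -[X in X = _]/(psiG v (gtup phi s) - c' (gtup phi s)) psiG_gtup.
rewrite -[c' _]/((fun v => c' (gtup phi v)) s) c'E bar_diffE gtupK => ev.
have -> : bdiff (fun s => - e (gtup phi s)) s = - bdiff (fun s => e (gtup phi s)) s.
  rewrite -mulN1r -bdiffZ; congr (bdiff _ s); apply: funext => w; by rewrite mulN1r.
by rewrite -ev; ring.
Qed.

Lemma quasi_iso_of_acyc :
  (forall k (t : TR b X k) s, psiM (D k t) s = bdiff (psiM t) s) ->
  (forall k, acyc M k) -> quasi_iso (@diffT _ _ D) (@bar_diff G R) psiG.
Proof.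
move=> psiTM acM.
have psiTG k (t : TR b X k) : psiG (diffT D t) = bar_diff G R (psiG t).
  apply: funext => s; rewrite bar_diffE -{1}(pwGK s) psiG_gtup psiTM.
  by congr (bdiff _ _); apply: funext => u; rewrite psiG_gtup.
(* For a cochain c with differential in P, t has the same differential and the same class modulo
   coboundaries. A closed c gives surjectivity; a c bounding psi (t1 - t2) gives injectivity. *)
have lift k (c : bar_cochain G R k) : npol (bdiff (fun u => c (gtup phi u))) ->
    exists t : TR b X k, (forall s, psiM (D k t) s = bdiff (fun u => c (gtup phi u)) s) /\
      coboundary (@bar_diff G R) (psiG t - c : bar_cochain G R k).
  move=> ndc; have := acM k _ ndc; case: k c ndc => [|k] c ndc.
    move=> /npol_psipP[t tc]; exists t; split=> [s|].
      by rewrite psiTM; congr (bdiff _ s); apply: funext.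
    apply: funext => s; rewrite -[LHS]/(psiG t s - c s) -(pwGK s) psiG_gtup tc.
    exact: subrr.
  move=> [e /npol_psipP[t tc]]; exists t; split=> [s|].
    rewrite psiTM (_ : psiM t = fun s => c (gtup phi s) - bdiff e s); last exact: funext.
    by rewrite bdiffB dlt_bdiff subr0.
  exists (fun s => - e (pwG s)); apply: funext => s.
  rewrite -[LHS]/(psiG t s - c s) bar_diffE -{1 2}(pwGK s) psiG_gtup tc.
  rewrite (_ : (fun u => - e (pwG (gtup phi u))) = fun u => -1 * e u); last first.
    by apply: funext => u; rewrite gtupK mulN1r.
  by rewrite bdiffZ; ring.
split=> [k|k].
  split=> [c t u|t]; last exact: psiTG.
  by apply: funext => s; exact: psi_linear.
split=> [t1 t2 Dt1 Dt2 cob|c dc].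
  have inj n (t : TR b X n) : (forall s, psiM t s = 0) -> t = 0.
    move=> t0; apply: (psip_inj (mulGA := mulGA) (mulG1 := mulG1) (mul1G := mul1G) (mulG_polmap := mulG_polmap)) => s.
    by rewrite t0 /psip psi0.
  have psiBM n (t u : TR b X n) s : psiM (t - u) s = psiM t s - psiM u s.
    by rewrite /psip psiD psiN.
  case: k t1 t2 Dt1 Dt2 cob => [|k] t1 t2 Dt1 Dt2 cob.
    apply: inj => s; rewrite psiBM -!psiG_gtup.
    exact: (congr1 (fun h => h (gtup phi s)) cob).
  have [e te] := cob.
  have dE s : bdiff (fun u => e (gtup phi u)) s = psiM (t1 - t2) s.
    have := congr1 (fun h => h (gtup phi s)) te.
    by rewrite bar_diffE gtupK => <-; rewrite psiBM -!psiG_gtup.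
  have [|u [Du _]] := lift k e.
    by apply: eq_npol (npol_psip mulGA mulG1 mul1G mulG_polmap (t1 - t2)) => s; rewrite dE.
  exists u; apply/eqP; rewrite -subr_eq0; apply/eqP; apply: inj => s.
  by rewrite psiBM -dE -Du subrr.
have dc0 s : bdiff (fun u => c (gtup phi u)) s = 0.
  have := congr1 (fun h => h (gtup phi s)) dc.
  by rewrite bar_diffE gtupK.
have [|t [Dt ct]] := lift k c; first by apply: eq_npol (npol0 _ _) => s; rewrite dc0.
exists t; split=> //.
apply: (psip_inj (mulGA := mulGA) (mulG1 := mulG1) (mul1G := mul1G) (mulG_polmap := mulG_polmap)) => s.
by rewrite Dt dc0 /psip psi0.
Qed.
End FromGroup.
End QuasiIso.

(** * Central extensions *)

Import VectorInternalTheory.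

Section PointMaps.
Context (b : base).
Local Notation R := (coef b).

Lemma acyc_iso (M M' : pmon b) (phi : M -> M') (psi : M' -> M) :
  (forall e, psi (phi e) = e) ->
  (forall e e', phi (pmul e e') = pmul (phi e) (phi e')) -> phi (pone M) = pone M' -> polmap phi ->
  (forall e e', psi (pmul e e') = pmul (psi e) (psi e')) -> psi (pone M') = pone M -> polmap psi ->
  forall k, acyc M' k -> acyc M k.
Proof.
move=> phiK phiM phi1 pphi psiM psi1 ppsi k ac c nc.
have /(ncob_pwmap phiM pphi phi1) : ncob (fun s => c (pwmap psi s)).
  apply: ac; apply: eq_npol (npol_pwmap ppsi psi1 nc) => s.
  by rewrite (bdiff_pwmap psiM).
apply: eq_ncob => s; rewrite pwmap_comp -[in RHS](pwmap_id s); congr c.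
exact: eq_pwmap.
Qed.

Lemma polmap_pt (S : cspace b) (X : choiceType) (phi : S -> cpt b X) :
  (forall x, pol (fun s => phi s x)) -> polmap phi.
Proof. by move=> pphi _ [x ->]. Qed.

Lemma pol_pt (S : cspace b) (X : choiceType) (phi : S -> cpt b X) x :
  polmap phi -> pol (fun s => phi s x).
Proof. by move=> pphi; apply: (pphi (fun v => v x)); exists x. Qed.

Lemma pol_psi2 (X : choiceType) (t : TR b X 2) :
  pol (S := cprod (cpt b X) (cpt b X)) (fun s => psi t [tuple s.1; s.2]).
Proof.
elim/tpow_ind: t => [|c u v pu pv|q].
- by apply: eq_pol (pol_const _ 0) => s; rewrite psi0.
- by apply: eq_pol (polD (polM (pol_const _ c) pu) pv) => s; rewrite psi_linear.
rewrite (tuple2E q); move: (tnth q ord0) (tnth q ord_max) => p p'.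
have pE (s : cprod (cpt b X) (cpt b X)) :
    psi (tpure [tuple p; p']) [tuple s.1; s.2] = ev s.1 (val p) * ev s.2 (val p').
  exact: psi_tpair.
apply: eq_pol (fun s => esym (pE s)) _; apply: polM.
  by apply: (pol_comp (phi := fun s : cprod (cpt b X) (cpt b X) => s.1) _ (pol_ev (val p))); pm.
by apply: (pol_comp (phi := fun s : cprod (cpt b X) (cpt b X) => s.2) _ (pol_ev (val p'))); pm.
Qed.

Lemma TR_map_linear (X X' : choiceType) (f : X -> X') k : linear (@TR_map b X X' f k).
Proof.
have e i u (s : k.-tuple (aug b X)) :
    map_tuple (aug_map f) (tupd s i u) = tupd (map_tuple (aug_map f) s) i (aug_map f u).
  by apply: eq_from_tnth => j; rewrite !(tnth_map, tnth_mktuple); case: eqP.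
apply: tlift_linear => s i c u v.
by rewrite !e linearP tpure_multilinear.
Qed.

Lemma psi_TR_map (X X' : choiceType) (f : X -> X') k (t : TR b X k) (a : k.-tuple (X' -> R)) :
  psi (TR_map f t) a = psi t (map_tuple (fun g x => g (f x)) a).
Proof.
elim/tpow_ind: t => [|c u v IHu IHv|q].
- by rewrite (linear_eq0 (@TR_map_linear X X' f k)) !psi0.
- rewrite TR_map_linear psi_linear (psi_linear c u v).
  exact: (congr2 (fun x y => c * x + y) IHu IHv).
rewrite TR_map_pure !psi_pure; apply: eq_bigr => i _.
by rewrite !tnth_map; exact: ev_map.
Qed.
End PointMaps.

Section Extension.
Context (b : base) (X : choiceType) (T : fbdga b X).
Local Notation R := (coef b).
Local Notation pt := (cpt b X).
Hypothesis psi_qi : quasi_iso (@diffT _ _ T) (@bar_diff (GT T) R) (@psiT _ _ T).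
Context (F : vectType R) (E : groupType) (iota : F -> E) (pi : E -> GT T).
Hypothesis E_ext : central_ext iota pi.

Definition mulT : pt -> pt -> pt := @GT_mul b X T.

Lemma pi1 : pi 1%g = (fun=> 0 : R).
Proof.
apply/(ce_exact E_ext); exists 0.
have := ce_iotaD E_ext 0 0; rewrite addr0 => e.
by apply: (@mulgI E (iota 0)); rewrite mulg1.
Qed.

Lemma piM g h : pi (g * h)%g = mulT (pi g) (pi h).
Proof. exact: (ce_piM E_ext). Qed.

(** Transported from the group E along the surjection [pi]. *)
Lemma mulTA : associative mulT.
Proof.
move=> x y z; have [g <-] := ce_pi_surj E_ext x.
have [h <-] := ce_pi_surj E_ext y; have [l <-] := ce_pi_surj E_ext z.
by rewrite -!piM mulgA.
Qed.
Lemma mulT1 : right_id (fun=> 0) mulT.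
Proof. by move=> x; have [g <-] := ce_pi_surj E_ext x; rewrite -pi1 -piM mulg1. Qed.
Lemma mul1T : left_id (fun=> 0) mulT.
Proof. by move=> x; have [g <-] := ce_pi_surj E_ext x; rewrite -pi1 -piM mul1g. Qed.
Lemma mulT_polmap : polmap (S := cprod pt pt) (S' := pt) (fun s => mulT s.1 s.2).
Proof.
apply: polmap_pt => x; apply: polB (pol_psi2 _).
apply: polD.
  by apply: (@pol_pt _ _ _ (fun s : cprod pt pt => s.1)); pm.
by apply: (@pol_pt _ _ _ (fun s : cprod pt pt => s.2)); pm.
Qed.

Local Notation G := (ptmon mulTA mulT1 mul1T mulT_polmap).

Lemma psiT_psiG : @psiT _ _ T = @psiG b X mulT mulTA mulT1 mul1T mulT_polmap (GT T) id.
Proof.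
apply: functional_extensionality_dep => k; apply: funext => t; apply: funext => s.
by congr psi; apply: val_inj; rewrite /= map_id.
Qed.

Lemma acycG k : acyc G k.
Proof.
apply: (@acyc_of_quasi_iso b X T mulT mulTA mulT1 mul1T mulT_polmap (GT T) id id) => //.
by rewrite -psiT_psiG.
Qed.

Lemma gtup_id n (u : cpw G n) : @gtup b (GT T) G id n u = p2t u.
Proof. by apply: val_inj; rewrite /= map_id. Qed.

Lemma bar_diff_GT k (c : bar_cochain (GT T) R k) (s : cpw G k.+1) :
  bar_diff (GT T) R c (p2t s) = bdiff (fun u : cpw G k => c (p2t u)) s.
Proof.
have := @bar_diff_bdiff b (GT T) G id (fun _ _ => erefl) k c s.
rewrite gtup_id => ->; congr (bdiff _ s); apply: funext => u.
by rewrite gtup_id.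
Qed.

Lemma psip_T k (t : TR b X k) (s : cpw G k.+1) :
  @psip b X mulT mulTA mulT1 mul1T mulT_polmap k.+1 (T k t) s =
  bdiff (@psip b X mulT mulTA mulT1 mul1T mulT_polmap k t) s.
Proof.
have := congr1 (fun c => c (p2t s)) ((psi_qi.1 k).2 t).
by rewrite bar_diff_GT.
Qed.

Definition co (u : F) : 'I_(dim F) -> R^o := fun i => v2r u 0 i.

Lemma co_linear : linear co.
Proof. by move=> c u v; apply: funext => i; rewrite /co linearP !mxE. Qed.
Lemma co_bij : bijective co.
Proof.
exists (fun v : (_ -> R^o) => r2v (\row_i (v i : R)) : F) => [u|v].
  by rewrite -[RHS]v2rK; congr r2v; apply/rowP => i; rewrite mxE.
by apply: funext => i; rewrite /co r2vK mxE.
Qed.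

Lemma coD u v i : co (u + v) i = co u i + co v i.
Proof. by rewrite /co linearD mxE. Qed.

Lemma kernel_diff e e' : pi e = pi e' -> exists u, e' = (e * iota u)%g.
Proof.
move=> ee'; have [|u e'u] := (ce_exact E_ext (e^-1 * e')%g).1.
  by rewrite (ce_piM E_ext) -ee' -(ce_piM E_ext) mulVg; exact: pi1.
by exists u; rewrite -e'u mulgA mulgV mul1g.
Qed.

Lemma pi_iota e u : pi (e * iota u)%g = pi e.
Proof.
rewrite piM (_ : pi (iota u) = (fun=> 0)) ?mulT1 //.
by apply/(ce_exact E_ext); exists u.
Qed.

(* The classes of the coordinates of the extension cocycle lie in the image of
   psi; the coordinates of E are corrected by the bounding cochains. *)
Lemma extension_coordinates : exists (c : 'I_(dim F) -> TR b X 2) (y : E -> 'I_(dim F) -> R),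
  [/\ forall i, T 2%N (c i) = 0,
      forall e e' i, y (e * e')%g i = y e i + y e' i - psi (c i) [tuple pi e : X -> R; pi e' : X -> R] &
      forall e u i, y (e * iota u)%g i = y e i + co u i].
Proof.
have [sigma sigmaK] : {sigma : GT T -> E | forall g, pi (sigma g) = g}.
  have /choice[sigma sK] : forall g, exists e, pi e = g by exact: (ce_pi_surj E_ext).
  by apply: cid; exists sigma.
have [y0 y0P] : {y0 : E -> F | forall e, e = (sigma (pi e) * iota (y0 e))%g}.
  have /choice[y0 y0P] : forall e, exists u, e = (sigma (pi e) * iota u)%g.
    by move=> e; apply: kernel_diff; rewrite sigmaK.
  by apply: cid; exists y0.
have y0_iota e u : y0 (e * iota u)%g = y0 e + u.
  apply: (ce_iota_inj E_ext); apply: (@mulgI E (sigma (pi e))).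
  rewrite (ce_iotaD E_ext) mulgA -y0P -{1}(pi_iota e u) -y0P.
  by [].
(* The factor set of the section. It is not normalized; normalization appears once a tensor replaces
   it. *)
pose f0 g h := y0 (sigma g * sigma h)%g.
have y0M e e' : y0 (e * e')%g = f0 (pi e) (pi e') + (y0 e + y0 e').
  rewrite {1}[e]y0P {1}[e']y0P -mulgA [(iota _ * (_ * _))%g]mulgA (ce_central E_ext).
  by rewrite -mulgA -(ce_iotaD E_ext) mulgA y0_iota.
have f0_cocycle g h l : f0 g h + f0 (mulT g h) l = f0 h l + f0 g (mulT h l).
  have [[e eg] [e' e'h] [e'' e''l]] : [/\ exists e, pi e = g, exists e, pi e = h & exists e, pi e = l].
    by split; exact: (ce_pi_surj E_ext).
  have := congr1 y0 (mulgA e e' e''); rewrite !y0M !piM eg e'h e''l => h1.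
  apply: (addIr (y0 e + (y0 e' + y0 e''))).
  transitivity (f0 (mulT g h) l + (f0 g h + (y0 e + y0 e') + y0 e'')).
    by rewrite -!addrA addrCA.
  by rewrite -h1 -!addrA [RHS]addrCA; congr (_ + _); rewrite addrCA.
(* The sign matches the product of [GT], where the quadratic term is subtracted. *)
pose f i : bar_cochain (GT T) R 2 := fun s => - co (f0 (tnth s ord0) (tnth s ord_max)) i.
have df i : bar_diff (GT T) R (f i) = 0.
  apply: funext => s; rewrite -(@t2pK b pt 3 s) bar_diff_GT.
  case: (@t2p b pt 3 s) => g [h [l []]].
  have dE : bdiff (fun u : cpw G 2 => f i (p2t u)) (g, (h, (l, tt))) =
      f i [tuple h; l] - (f i [tuple mulT g h; l] - (f i [tuple g; mulT h l] - f i [tuple g; h])).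
    rewrite /bdiff /=; congr (_ - (_ - (_ - _))); congr (f i _); exact: val_inj.
  have fE x y : f i [tuple x; y] = - co (f0 x y) i by [].
  rewrite dE !fE; have := congr1 (fun u => co u i) (f0_cocycle g h l); rewrite /= !coD => h1.
  transitivity ((co (f0 g h) i + co (f0 (mulT g h) l) i : R)
    - (co (f0 h l) i + co (f0 g (mulT h l)) i : R)); first by ring.
  by rewrite h1 subrr.
have cP i : exists ce : TR b X 2 * (1.-tuple (GT T) -> R), T 2%N ce.1 = 0 /\
    forall x y : pt, psi ce.1 [tuple x; y] =
      - co (f0 x y) i + (ce.2 [tuple y] - ce.2 [tuple mulT x y] + ce.2 [tuple x]).
  have [c [dc [e ce]]] := (psi_qi.2 2%N).2 (f i) (df i).
  exists (c, e); split=> // x y.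
  have fE : f i [tuple x; y] = - co (f0 x y) i by [].
  have := congr1 (fun h => h (p2t (S := pt) (k := 2) (x, (y, tt)))) ce.
  rewrite bar_diff_GT -[X in X = _]/(psiT T c (p2t (S := pt) (k := 2) (x, (y, tt))) - f i (p2t (S := pt) (k := 2) (x, (y, tt)))).
  have -> : p2t (S := pt) (k := 2) (x, (y, tt)) = [tuple x; y] by exact: val_inj.
  have -> : bdiff (fun u : cpw G 1 => e (p2t u)) (x, (y, tt)) = e [tuple y] - (e [tuple mulT x y] - e [tuple x]).
    by rewrite /bdiff /=; congr (_ - (_ - _)); congr e; exact: val_inj.
  rewrite fE -[psiT T c _]/(psi c [tuple x; y]) => /eqP; rewrite subr_eq => /eqP ->.
  by rewrite [LHS]addrC; congr (_ + _); rewrite opprB addrA addrAC.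
have [ce ceP] := choice cP.
(* The bounding 1-cochain is evaluated at [pi e] only, so the correction leaves the translation by
   [iota u] unchanged. *)
exists (fun i => (ce i).1), (fun e i => co (y0 e) i + (ce i).2 [tuple pi e]); split.
- by move=> i; exact: (ceP i).1.
- move=> e e' i; rewrite y0M piM (ceP i).2 !coD; ring.
- by move=> e u i; rewrite y0_iota coD pi_iota; ring.
Qed.

(** * The Hirsch extension attached to coordinates on E *)

Section Coordinates.
Variables (c : 'I_(dim F) -> TR b X 2) (y : E -> 'I_(dim F) -> R).
Hypothesis Tc : forall i, T 2%N (c i) = 0.
Hypothesis yM : forall e e' i,
  y (e * e')%g i = y e i + y e' i - psi (c i) [tuple pi e : X -> R; pi e' : X -> R].
Hypothesis y_iota : forall e u i, y (e * iota u)%g i = y e i + co u i.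

Definition kappa (g h : G) : cvec b (dim F) := fun i => - psi (c i) [tuple g; h].

Lemma psip2 i (g h : pt) :
  @psip b X mulT mulTA mulT1 mul1T mulT_polmap 2 (c i) (g, (h, tt)) = psi (c i) [tuple g; h].
Proof. by congr psi; exact: val_inj. Qed.

Lemma kappa_cocycle g h l i : kappa g h i + kappa (pmul g h) l i = kappa h l i + kappa g (pmul h l) i.
Proof.
have := psip_T (c i) ((g, (h, (l, tt))) : cpw G 3).
rewrite Tc {1}/psip psi0 /bdiff /= !psip2 /kappa => /eqP.
rewrite eq_sym subr_eq0 => /eqP ->; ring.
Qed.

Lemma kappa1 g i : kappa g (pone G) i = 0.
Proof.
have [_ [_ /(_ g) [n0 _]]] := npol_psip mulTA mulT1 mul1T mulT_polmap (c i).
by rewrite /kappa -psip2 n0 oppr0.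
Qed.

Lemma kappa_1 g i : kappa (pone G) g i = 0.
Proof.
have [_ [n0 _]] := npol_psip mulTA mulT1 mul1T mulT_polmap (c i).
by rewrite /kappa -psip2 n0 oppr0.
Qed.

Lemma kappa_polmap : polmap (S := cprod G G) (fun w => kappa w.1 w.2).
Proof. by apply: polmap_vec => i; apply: polN; exact: pol_psi2. Qed.

Local Notation TG := (ov (tower kappa_cocycle kappa1 kappa_1 kappa_polmap 1)).
Local Notation Z := (X + 'I_(dim F))%type.
Local Notation ptZ := (cpt b Z).

Definition toT (a : ptZ) : TG := ((fun i => a (inr i)) : cvec b (dim F), (fun x => a (inl x)) : G).
Definition ofT (w : TG) : ptZ := fun z => match z with inl x => w.2 x | inr i => w.1 i end.

Lemma toTK a : ofT (toT a) = a.
Proof. by apply: funext => -[]. Qed.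
Lemma ofTK w : toT (ofT w) = w.
Proof. by case: w. Qed.

Lemma toT_polmap : polmap toT.
Proof.
refine (@polmap_pair b ptZ (cvec b (dim F)) G _ _ _ _).
  by apply: polmap_vec => i; apply: pol_coord; exists (inr i).
by apply: polmap_pt => x; apply: pol_coord; exists (inl x).
Qed.

Lemma ofT_polmap : polmap ofT.
Proof.
apply: polmap_pt => -[x|i].
  apply: (@pol_pt b _ X (fun w : TG => w.2)).
  exact: (@polmap_snd b TG (cvec b (dim F)) G _ (@polmap_id _ _)).
apply: (@pol_vec b _ _ (fun w : TG => w.1)).
exact: (@polmap_fst b TG (cvec b (dim F)) G _ (@polmap_id _ _)).
Qed.

Definition mulE (a a' : ptZ) : ptZ := ofT (pmul (toT a) (toT a')).

Lemma mulEA : associative mulE.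
Proof. by move=> u v w; rewrite /mulE !ofTK pmulA. Qed.
Lemma toT1 : toT (fun=> 0) = pone TG. Proof. by []. Qed.
Lemma mulE1 : right_id (fun=> 0) mulE.
Proof. by move=> u; rewrite /mulE toT1 pmul1 toTK. Qed.
Lemma mul1E : left_id (fun=> 0) mulE.
Proof. by move=> u; rewrite /mulE toT1 p1mul toTK. Qed.
Lemma mulE_polmap : polmap (S := cprod ptZ ptZ) (S' := ptZ) (fun s => mulE s.1 s.2).
Proof.
apply: (polmap_comp ofT_polmap).
by apply: (@polmapM b); apply: (polmap_comp toT_polmap); pm.
Qed.

Local Notation EZ := (ptmon mulEA mulE1 mul1E mulE_polmap).

Lemma acycEZ k : acyc EZ k.
Proof.
apply: (@acyc_iso b EZ TG toT ofT).
- exact: toTK.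
- by move=> e e'; rewrite /= /mulE ofTK.
- by [].
- exact: toT_polmap.
- by move=> e e'; rewrite /= /mulE !ofTK.
- exact: (toTK (fun=> 0)).
- exact: ofT_polmap.
apply: acyc_tower1; exact: acycG.
Qed.

Definition Phi (e : E) : ptZ := ofT (y e, pi e).

Lemma PhiM e e' : Phi (e * e')%g = mulE (Phi e) (Phi e').
Proof.
rewrite /mulE !ofTK; congr ofT; congr (_, _); last exact: piM.
by apply: funext => i; rewrite yM.
Qed.

Lemma Phi_bij : bijective Phi.
Proof.
have [co' coK co'K] := co_bij.
have surj a : exists e, Phi e = a.
  have [e0 e0a] := ce_pi_surj E_ext (toT a).2.
  exists (e0 * iota (co' (fun i => a (inr i) - y e0 i)))%g; apply: funext => -[x|i].
    by rewrite /Phi /= pi_iota e0a.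
  by rewrite /Phi /= y_iota co'K addrC subrK.
have inj e e' : Phi e = Phi e' -> e = e'.
  move=> ee'; have pe : pi e = pi e' by have := congr1 (fun a => (toT a).2) ee'.
  have [u e'u] := kernel_diff pe; rewrite e'u.
  have cu : co u = co 0.
    apply: funext => i; have := congr1 (fun a => a (inr i)) ee'.
    rewrite /Phi /= e'u y_iota => /eqP; rewrite -subr_eq0 opprD addrA subrr sub0r oppr_eq0.
    by move=> /eqP ->; rewrite /co linear0 mxE.
  rewrite (bij_inj co_bij cu).
  have i0 : iota 0 = 1%g.
    by apply: (@mulgI E (iota 0)); rewrite -(ce_iotaD E_ext) addr0 mulg1.
  by rewrite i0 mulg1.
have [g gK] := choice surj.
by exists g => [e|a]; [apply: inj; exact: gK|exact: gK].
Qed.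

Definition Tbar : fbdga b Z := group_dga mulEA mulE1 mul1E mulE_polmap.

Lemma psip_TR_map k (t : TR b X k) (s : cpw EZ k) :
  @psip b Z mulE mulEA mulE1 mul1E mulE_polmap k (TR_map inl t) s =
  @psip b X mulT mulTA mulT1 mul1T mulT_polmap k t (pwmap (M := EZ) (M' := G) (fun a => (toT a).2) s).
Proof.
rewrite /psip psi_TR_map; congr psi; apply: val_inj => /=.
by elim: k {t} s => [|k IH] s //=; rewrite IH.
Qed.

(** Restriction to X is a homomorphism to [G], so on old tensors both differentials have the same
    [psi]. On a new variable the differential evaluates to minus [kappa], which is psi of [c i]. *)
Lemma Tbar_hirsch : hirsch_ext inl T Tbar.
Proof.
split; first split; first by move=> x x' [].
  move=> k t.
  apply: (psip_inj (mulGA := mulEA) (mulG1 := mulE1) (mul1G := mul1E) (mulG_polmap := mulE_polmap)) => s.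
  have e := @psip_gdiff b Z mulE mulEA mulE1 mul1E mulE_polmap k (TR_map inl t) s.
  rewrite [LHS]e psip_TR_map psip_T.
  rewrite -(bdiff_pwmap (M := EZ) (M' := G) (phi := fun a => (toT a).2)).
    by congr (bdiff _ s); apply: funext => u; exact: psip_TR_map.
  by [].
move=> [x|i] zx; first by case: (zx x).
exists (c i); split; first exact: Tc.
apply: psi_eq => s; rewrite (tuple2E s); move: (tnth s ord0) (tnth s ord_max) => a a'.
have e := @psi_gdiff_deg1 b Z mulE mulEA mulE1 mul1E mulE_polmap (augX b (inr i : Z)) a a'.
rewrite [LHS]e [RHS]psi_TR_map /= !ev_gen.
rewrite (_ : map_tuple _ [tuple a; a'] = [tuple (toT a).2; (toT a').2]); last exact: val_inj.
by rewrite /= /vadd /kappa /=; ring.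
Qed.

Lemma Phi_ext_iso : ext_iso iota pi (Phi : E -> GT Tbar).
Proof.
split.
- exact: Phi_bij.
- move=> g h; rewrite PhiM; apply/esym.
  exact: (GT_mul_group_dga (mulGA := mulEA) (mulG1 := mulE1) (mul1G := mul1E) (mulG_polmap := mulE_polmap)).
- by [].
exists co; split; [exact: co_linear|exact: co_bij|].
move=> u; apply: funext => -[x|i].
  rewrite /Phi /= (_ : pi (iota u) = (fun=> 0)) //.
  by apply/(ce_exact E_ext); exists u.
(* psi of [c i] vanishes at the unit, so [yM] at (1, 1) forces y 1 = 0, and [iota u] has coordinates
   [co u]. *)
have y1 : y 1%g i = 0.
  have := yM 1%g 1%g i; rewrite mulg1 pi1.
  have -> : psi (c i) [tuple (fun=> 0) : X -> R; (fun=> 0) : X -> R] = 0.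
    by have := kappa1 (fun=> 0) i; rewrite /kappa => /eqP; rewrite oppr_eq0 => /eqP.
  by rewrite subr0 => e; apply: (addrI (y 1%g i)); rewrite -e addr0.
by rewrite /Phi /= -[iota u]mul1g y_iota y1 add0r.
Qed.

Lemma Tbar_square k (t : TR b X k) :
  bar_pull (Phi : E -> GT Tbar) (psiT Tbar (TR_map inl t)) = bar_pull pi (psiT T t).
Proof.
apply: funext => s; rewrite /bar_pull /psiT psi_TR_map; congr psi.
by apply: val_inj; rewrite /= -map_comp.
Qed.

Lemma Tbar_quasi_iso : quasi_iso (@diffT _ _ Tbar) (@bar_diff E R)
  (fun k (t : TR b Z k) => bar_pull (Phi : E -> GT Tbar) (psiT Tbar t)).
Proof.
have [Psi PhiK PsiK] := Phi_bij.
apply: (@quasi_iso_of_acyc b Z Tbar mulE mulEA mulE1 mul1E mulE_polmap E Psi Phi) => //.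
- by move=> a a'; apply: (can_inj PhiK); rewrite PhiM !PsiK.
- move=> k t s; exact: psip_gdiff.
- exact: acycEZ.
Qed.
End Coordinates.
End Extension.

Theorem theorem8p13 (b : base) (X : choiceType) (T : fbdga b X)
    (T_colim : colimit_hirsch T)
    (psi_qi : quasi_iso (@diffT _ _ T) (@bar_diff (GT T) (coef b)) (@psiT _ _ T))
    (F : vectType (coef b)) (E : groupType) (iota : F -> E) (pi : E -> GT T)
    (E_ext : central_ext iota pi) :
  exists (Y : choiceType) (Tbar : fbdga b (X + Y)%type) (Phi : E -> GT Tbar),
    [/\ hirsch_ext inl T Tbar /\ ext_iso iota pi Phi,
        forall k (t : TR b X k),
          bar_pull Phi (psiT Tbar (TR_map inl t)) = bar_pull pi (psiT T t) &
        quasi_iso (@diffT _ _ Tbar) (@bar_diff E (coef b))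
          (fun k (t : TR b (X + Y)%type k) => bar_pull Phi (psiT Tbar t))].
Proof.
have [c [y [Tc yM y_iota]]] := extension_coordinates psi_qi E_ext.
exists 'I_(dim F), (Tbar psi_qi E_ext Tc), (Phi psi_qi E_ext y Tc); split.
- split; [exact: Tbar_hirsch|exact: Phi_ext_iso].
- exact: Tbar_square.
- exact: Tbar_quasi_iso.
Qed.
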